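(* Let $s,s_1,s_2\in\mathbb{R}$, $1<p,p_1,p_2<\infty$ and $0<\theta<1$. Put $s_*=(1-\theta)s_1+\theta s_2$ and $\frac1{p_*}=\frac{1-\theta}{p_1}+\frac{\theta}{p_2}$. If there is a constant $C>0$ such that $$\|f\|_{\dot F^{s,1}_{p,1}}\le C\,\|f\|_{\dot F^{s_1,\infty}_{p_1,\infty}}^{1-\theta}\|f\|_{\dot F^{s_2,\infty}_{p_2,\infty}}^{\theta}\quad\text{for all } f\in \dot F^{s_1,\infty}_{p_1,\infty}\cap \dot F^{s_2,\infty}_{p_2,\infty},$$ then one of the following conditions is satisfied: (i) $s_*=s$, $p_*=p$, $s_1\ne s_2$, $p_1\ne p_2$, $s_2-s_1\ne n/p_2-n/p_1$; (ii) $s_*-s=n/p_*-n/p>0$, $s_2-s_1\ne n/p_2-n/p_1$.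
   Context: All spaces are on $\mathbb{R}^n$. $\mathscr{S}$ is the Schwartz class, $\mathscr{S}'$ its dual, $\mathscr{S}_0=\{\psi\in\mathscr{S}: D^\alpha\hat\psi(0)=0\text{ for all multi-indices }\alpha\}$ (a closed subspace of $\mathscr{S}$), and $\mathscr{S}_0'$ its dual. Every $f\in\mathscr{S}_0'$ has an extension $F\in\mathscr{S}'$, unique up to polynomials. Lorentz spaces: for $1\le p<\infty$, $1\le q\le\infty$, $L^{p,q}$ is the space of measurable $f$ on $\mathbb{R}^n$ with finite quasi-norm $\|f\|_{L^{p,q}}=\left(p\int_0^\infty[\alpha\mu_f(\alpha)^{1/p}]^q\frac{d\alpha}{\alpha}\right)^{1/q}$ if $q<\infty$, and $\sup_{\alpha>0}\alpha\mu_f(\alpha)^{1/p}$ if $q=\infty$, where $\mu_f(\alpha)=|\{x:|f(x)|>\alpha\}|$. Homogeneous Triebel-Lizorkin-Lorentz spaces: fix $\{\varphi_j\}_{j\in\mathbb{Z}}\subset C_c^\infty(\mathbb{R}^n)$ with $\operatorname{supp}\varphi_j\subset\{2^{j-1}\le|\xi|\le2^{j+1}\}$, $\sup_{j,\xi}2^{j|\alpha|}|D^\alpha\varphi_j(\xi)|<\infty$ for every multi-index $\alpha$, and $\sum_{j\in\mathbb{Z}}\varphi_j=1$ on $\mathbb{R}^n\setminus\{0\}$. For $f\in\mathscr{S}_0'$ let $\dot\Delta_jf=(\varphi_j\hat F)^\vee$ for any extension $F\in\mathscr{S}'$ of $f$ (independent of the choice). Then $\dot F^{s,r}_{p,q}$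 is the space of $f\in\mathscr{S}_0'$ with $$\|f\|_{\dot F^{s,r}_{p,q}}=\Big\|\,\big\|\{2^{js}\dot\Delta_jf\}_{j\in\mathbb{Z}}\big\|_{l^r}\Big\|_{L^{p,q}}<\infty .$$ *)

(* Defs.v *)
From HB Require Import structures.
From mathcomp Require Import all_boot all_order all_algebra.
From mathcomp Require Import all_classical all_reals all_analysis.
From mathcomp Require Import complex.
Set Implicit Arguments.
Unset Strict Implicit.
Unset Printing Implicit Defensive.
Import Order.TTheory GRing.Theory Num.Theory.
Import numFieldNormedType.Exports.
Import Normc.
Local Open Scope classical_set_scope.
Local Open Scope ring_scope.

(* Lebesgue measure on n-tuples (with the library's product sigma-algebra),
   obtained by iterating the binary product measure. *)
Section LebesgueTuple.
Context (R : realType).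

Definition tcons n (x : measurableTypeR R * n.-tuple (measurableTypeR R)) :
  n.+1.-tuple (measurableTypeR R) := [tuple of x.1 :: x.2].

Lemma measurable_tcons n : measurable_fun setT (@tcons n).
Proof. by apply: measurable_cons. Qed.

Section step.
Context n
  (mu : {sigma_finite_measure set (n.-tuple (measurableTypeR R)) -> \bar R}).

Definition lebesgueS : set (n.+1.-tuple (measurableTypeR R)) -> \bar R :=
  pushforward (@lebesgue_measure R \x mu)%E (@tcons n).

Let image_measure : {measure set _ -> \bar R} :=
  measure_function_pushforward__canonical__measure_function_Measure
    ((@lebesgue_measure R \x mu)%E : {measure set _ -> \bar R})
    (measurable_tcons (n := n)).

HB.instance Definition _ := isMeasure.Build _ _ _ lebesgueS
  (measure0 image_measure) (measure_ge0 image_measure)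
  (@measure_semi_sigma_additive _ _ _ image_measure).

Let tuncons (t : n.+1.-tuple (measurableTypeR R)) :
    measurableTypeR R * n.-tuple (measurableTypeR R) :=
  (thead t, [tuple of behead t]).

Let tconsK : cancel (@tcons n) tuncons.
Proof.
by case=> x t; rewrite /tuncons /tcons /= theadE; congr pair; apply/val_inj.
Qed.

Let measurable_tuncons : measurable_fun setT tuncons.
Proof.
apply/measurable_fun_pairP; split; first exact: measurable_tnth.
exact: measurable_behead.
Qed.

Let lebesgueS_sigma_finite : sigma_finite setT lebesgueS.
Proof.
have /sigma_finiteP[F [UF ndF mF]] := sigma_finiteT (@lebesgue_measure R).
have /sigma_finiteP[G [UG ndG mG]] := sigma_finiteT mu.
exists (fun k => tuncons @^-1` (F k `*` G k)) => [|k].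
  rewrite -preimage_bigcup -[LHS](preimage_setT tuncons); congr (_ @^-1` _).
  apply/esym/seteqP; split=> // -[x t] _.
  have [i _ Fix] : (\bigcup_i F i) x by rewrite -UF.
  have [j _ Gjt] : (\bigcup_i G i) t by rewrite -UG.
  exists (maxn i j) => //; split => /=.
  - by move: x Fix; exact/subsetPset/ndF/leq_maxl.
  - by move: t Gjt; exact/subsetPset/ndG/leq_maxr.
have [mFk Fky] := mF k; have [mGk Gky] := mG k.
split.
  rewrite -[X in measurable X]setTI; apply: measurable_tuncons => //.
  exact: measurableX.
rewrite /lebesgueS /pushforward -comp_preimage.
rewrite (_ : tuncons \o @tcons n = id); last first.
  by apply/funext => x; exact: tconsK.
by rewrite preimage_id product_measure1E// lte_mul_pinfty// ge0_fin_numE.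
Qed.

HB.instance Definition _ := Measure_isSigmaFinite.Build _ _ _ lebesgueS
  lebesgueS_sigma_finite.

End step.

Fixpoint lebesgue_tuple n :
    {sigma_finite_measure set (n.-tuple (measurableTypeR R)) -> \bar R} :=
  match n with
  | 0 => @dirac _ (0.-tuple (measurableTypeR R)) [tuple] R
  | n'.+1 => lebesgueS (lebesgue_tuple n')
  end.

End LebesgueTuple.

Section SmoothFunctions.
Context (R : realType) (n : nat).

(* Complex-valued functions on R^n.  The type R[i] carries no topology over R
   in the library, so analytic notions are imposed on real and imaginary
   parts. *)
Definition cfun := 'rV[R]_n -> R[i].
Implicit Types (f g psi chi : cfun) (x xi : 'rV[R]_n).

Definition ReF f : 'rV[R]_n -> R := fun x => complex.Re (f x).
Definition ImF f : 'rV[R]_n -> R := fun x => complex.Im (f x).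

Definition ccontinuous f := continuous (ReF f) /\ continuous (ImF f).

Definition partial (i : 'I_n) f : cfun :=
  fun x => ('D_(delta_mx 0 i) (ReF f) x +i* 'D_(delta_mx 0 i) (ImF f) x)%C.

(* all iterated partial derivatives, taken in any order, exist and are
   continuous *)
Definition smooth f := forall l : seq 'I_n,
  let g := foldr partial f l in
  ccontinuous g /\
  forall i x, derivable (ReF g) x (delta_mx 0 i) /\
              derivable (ImF g) x (delta_mx 0 i).

Definition multi_index := 'I_n -> nat.
Implicit Types alpha beta : multi_index.

Definition mdeg alpha : nat := (\sum_(i < n) alpha i)%N.

Definition mderiv alpha f : cfun :=
  foldr (fun i g => iter (alpha i) (partial i) g) f (enum 'I_n).

Definition monomial alpha x : R := \prod_(i < n) x 0 i ^+ alpha i.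

Definition dot x xi : R := \sum_(i < n) x 0 i * xi 0 i.

(* Euclidean length; the library norm of 'rV[R]_n is the sup norm *)
Definition euclid x : R := Num.sqrt (dot x x).

Definition csupport f : set 'rV[R]_n := closure [set x | f x != 0].

Definition Cc_infty f := smooth f /\ compact (csupport f).

Definition seminorm alpha beta f : \bar R :=
  ereal_sup (range (fun x =>
    (`|monomial alpha x| * normc (mderiv beta f x))%:E)).

Definition schwartz : set cfun :=
  [set f | smooth f /\ forall alpha beta, (seminorm alpha beta f < +oo)%E].

End SmoothFunctions.

Section Fourier.
Context (R : realType) (n : nat).
Implicit Types (f psi : cfun R n) (x xi : 'rV[R]_n).

Definition vec (t : n.-tuple (measurableTypeR R)) : 'rV[R]_n :=
  \row_i tnth t i.

Definition volume (A : set 'rV[R]_n) : \bar R :=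
  lebesgue_tuple R n (vec @^-1` A).

Definition cintegrable f :=
  (lebesgue_tuple R n).-integrable setT (fun t => (ReF f (vec t))%:E) /\
  (lebesgue_tuple R n).-integrable setT (fun t => (ImF f (vec t))%:E).

Definition cintegral f : R[i] :=
  ((\int[lebesgue_tuple R n]_t ReF f (vec t)) +i*
   (\int[lebesgue_tuple R n]_t ImF f (vec t)))%C.

Definition cis (t : R) : R[i] := (cos t +i* sin t)%C.

(* normalisation: kernel exp(-2 pi i x.xi), so that no constant appears in the
   inverse transform *)
Definition fourier f : cfun R n :=
  fun xi => cintegral (fun x => cis (- (2 * pi * dot x xi)) * f x).

Definition inv_fourier f : cfun R n :=
  fun x => cintegral (fun xi => cis (2 * pi * dot x xi) * f xi).

Definition schwartz0 : set (cfun R n) :=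
  [set psi | schwartz psi /\
     forall alpha : multi_index n, mderiv alpha (fourier psi) 0 = 0].

(* A distribution is given by a functional on all of cfun; only its values on
   the space of test functions under consideration are relevant. *)
Definition functional := cfun R n -> R[i].
Implicit Types (T F : functional) (X : set (cfun R n)).

Definition linear_on X T := forall (a : R[i]) psi chi, X psi -> X chi ->
  T (fun x => a * psi x + chi x) = a * T psi + T chi.

(* continuity for the topology generated by the Schwartz seminorms; the sets
   { chi | seminorm alpha beta (chi - psi) < delta for all alpha, beta of
   degree <= N } form a base of neighbourhoods of psi *)
Definition continuous_on X T := forall psi, X psi -> forall e : R, 0 < e ->
  exists (N : nat) (delta : R), 0 < delta /\
  forall chi, X chi ->
    (forall alpha beta : multi_index n, (mdeg alpha <= N)%N ->
       (mdeg beta <= N)%N ->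
       (seminorm alpha beta (fun x => chi x - psi x)%R < delta%:E)%E) ->
    normc (T chi - T psi) < e.

Definition dual X : set functional :=
  [set T | linear_on X T /\ continuous_on X T].

Definition tempered := dual (@schwartz R n).
Definition tempered0 := dual schwartz0.

Definition extends (f F : functional) := forall psi, schwartz0 psi ->
  F psi = f psi.

Definition fourier_dist T : functional := fun psi => T (fourier psi).
Definition inv_fourier_dist T : functional := fun psi => T (inv_fourier psi).
Definition mul_dist (phi : cfun R n) T : functional :=
  fun psi => T (fun x => phi x * psi x).

Definition is_function T (g : cfun R n) := forall psi, schwartz psi ->
  cintegrable (fun x => g x * psi x) /\
  T psi = cintegral (fun x => g x * psi x).

End Fourier.

Section TriebelLizorkinLorentz.
Context (R : realType) (n : nat).
Implicit Types (x xi : 'rV[R]_n) (f F : functional R n).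

Definition dyadic_partition (phi : int -> cfun R n) :=
  [/\ forall j, Cc_infty (phi j),
      forall j, csupport (phi j) `<=`
        [set xi | (2 : R) ^ (j - 1) <= euclid xi <= 2 ^ (j + 1)],
      forall alpha : multi_index n, exists M : R, forall j xi,
        (2 : R) ^ (j *+ mdeg alpha) * normc (mderiv alpha (phi j) xi) <= M &
      forall xi, xi != 0 -> \sum_(j \in [set: int]) phi j xi = 1].

(* (phi hat F)^vee has compactly supported Fourier transform, hence is a
   continuous function (Paley-Wiener), which is unique; it does not depend on
   the extension F of f. *)
Definition LP_block (phi : cfun R n) f : cfun R n :=
  xget (fun=> 0) [set g | ccontinuous g /\
    exists F, [/\ tempered F, extends f F &
      is_function (inv_fourier_dist (mul_dist phi (fourier_dist F))) g]].

Definition lr_norm (r : \bar R) (a : int -> R[i]) : \bar R :=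
  match r with
  | r'%:E => ((\esum_(j in [set: int]) (normc (a j) `^ r')%:E) `^ r'^-1)%E
  | +oo%E => ereal_sup (range (fun j => (normc (a j))%:E))
  | -oo%E => 0%E
  end.

Definition distr_fun (g : 'rV[R]_n -> \bar R) (a : R) : \bar R :=
  volume [set x | (a%:E < `|g x|)%E].

Definition lorentz_norm (p : R) (q : \bar R) (g : 'rV[R]_n -> \bar R) :
    \bar R :=
  match q with
  | q'%:E => ((p%:E * \int[@lebesgue_measure R]_(a in `]0%R, +oo[)
       ((a%:E * distr_fun g a `^ p^-1) `^ q' * (a^-1)%:E)) `^ q'^-1)%E
  | +oo%E => ereal_sup
       [set (a%:E * distr_fun g a `^ p^-1)%E | a in `]0%R, +oo[%classic]
  | -oo%E => 0%E
  end.

Definition TLL_norm (phi : int -> cfun R n) (s : R) (r : \bar R) (p : R)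
    (q : \bar R) f : \bar R :=
  lorentz_norm p q (fun x => lr_norm r (fun j =>
    (2 `^ (j%:~R * s))%:C%C * LP_block (phi j) f x)).

Definition TLL_space (phi : int -> cfun R n) (s : R) (r : \bar R) (p : R)
    (q : \bar R) : set (functional R n) :=
  [set f | tempered0 f /\ (TLL_norm phi s r p q f < +oo)%E].

End TriebelLizorkinLorentz.

(* Main.v *)
Require Import Defs.
From HB Require Import structures.
From mathcomp Require Import all_boot all_order all_algebra.
From mathcomp Require Import all_classical all_reals all_analysis.
From mathcomp Require Import complex ring lra zify measurable_realfun.
Set Implicit Arguments.
Unset Strict Implicit.
Unset Printing Implicit Defensive.
Import Order.TTheory GRing.Theory Num.Theory.
Import numFieldNormedType.Exports.
Import Normc.
Local Open Scope classical_set_scope.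
Local Open Scope ring_scope.

(** The inequality is tested on explicit functions.  Let gam be a smooth bump
supported close to the origin, g its inverse Fourier transform, and
  atom A (2^l) x = e^(2 pi i 2^l x_1) g(A x),   0 < A <= 2^l,
whose spectrum lies in a small ball around 2^l e_1.  Only the blocks l - 1, l
and l + 1 see an atom; each of them is a bump of height O(1) and width 1/A
([atom_Blk_bound]), and together they give back a nonzero multiple of the atom
([reproducing]).  So the weighted blocks of an atom have size 2^(ls) on a cube
of side 1/A and decay fast away from it.

Upper bounds for the weak norms follow from pointwise bounds O(|x|^(-n/q)) of
the blocks ([TLL_upper]); this uses q > 1, as the decay of a bump is then faster
than |x|^(-n/q).  Lower bounds for the L^(p,1) norm follow from cubes on which
the blocks sum to geometrically growing levels ([TLL_lower]): N levels that
contribute equally produce a factor N.  Four families of functions give the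
result.

- A single atom gives 2^(ls) A^(-n/p) <= K 2^(l sstar) A^(-n/pstar) for all
  A <= 2^l.  With A = 2^l and l -> +oo, -oo this forces
  sstar - s = n/pstar - n/p; with l = 0 and A -> 0 it forces n/pstar >= n/p.
- If s2 - s1 = n/p2 - n/p1, then s1 - n/p1 = s2 - n/p2 = s - n/p, and N
  atoms with A = 2^l, normalised in this common scaling, have weak norms O(1)
  and L^(p,1) norm at least c N ([not_same_scaling]).
- If s1 = s2 = s, then N atoms of width one at different frequencies have
  blocks O(1) each, but the sum of the blocks is of size N
  ([not_same_smoothness]).
- If p1 = p2 = p, then atoms of one frequency and lacunary widths add up to a
  truncation of |x|^(-n/p), which is bounded in weak L^p but not in L^(p,1)
  ([not_same_integrability]).

If n/pstar > n/p, the first two points are the second alternative of the theorem;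
otherwise pstar = p and sstar = s, and the remaining points give the first
alternative, since s1 = s2 would mean s1 = s2 = s, and p1 = p2 would mean
p1 = p2 = p.

Before that, the blocks of the distribution psi |-> int h psi have to be
identified with the convolutions that one expects ([LP_block_regular]).  This
takes Fourier analysis for functions dominated by powers of the weight
prod_i 1 / (1 + x_i^2): the multiplication formula, smoothness of transforms,
and Fourier inversion up to an unspecified nonzero constant, which is enough for
estimates up to constants. *)

(** * Lebesgue measure on R^n: dilations, and measurability of open sets *)

Section measure_Rn.
Context (R : realType).

Lemma rV_norm_ltP n (x : 'rV[R]_n) (e : R) : 0 < e ->
  (`|x| < e) <-> (forall i, `|x 0 i| < e).
Proof.
move=> e0; rewrite /Num.norm/= mx_normrE; split=> [/bigmax_ltP[_ h] i|h].
  by have := h (0, i) isT.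
apply/bigmax_ltP; split => // -[j i] _ /=; rewrite (ord1 j); exact: h.
Qed.

Lemma rV_norm_leP n (x : 'rV[R]_n) (e : R) : 0 <= e ->
  (`|x| <= e) <-> (forall i, `|x 0 i| <= e).
Proof.
move=> e0; rewrite /Num.norm/= mx_normrE; split=> [/bigmax_leP[_ h] i|h].
  by have := h (0, i) isT.
apply/bigmax_leP; split => // -[j i] _ /=; rewrite (ord1 j); exact: h.
Qed.

Local Notation mu := (lebesgue_tuple R).

(** The pushforward of the measure under x |-> a x + b, multiplied by a, agrees
    with Lebesgue measure on intervals; uniqueness does the rest. *)
Lemma lebesgue_affine (a b : R) (A : set (measurableTypeR R)) : 0 < a ->
  measurable A ->
  lebesgue_measure [set x : R | A (a * x + b)] =
  ((a^-1)%:E * lebesgue_measure A)%E.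
Proof.
move=> a0 mA.
have mf : measurable_fun setT (fun x : measurableTypeR R => a * x + b : measurableTypeR R).
  apply: (@measurable_funD _ _ _ _ (fun x => a * x) (fun=> b)) => //.
  exact: measurable_funM.
pose nu := mscale (NngNum (ltW a0)) (measure_function_pushforward__canonical__measure_function_Measure lebesgue_measure mf).
have -> : lebesgue_measure A = nu A.
  apply: lebesgue_measure_unique => // _ [[c d] _ <-].
  rewrite /nu /mscale /pushforward /=.
  pose I := `](c - b) / a, (d - b) / a]%classic.
  transitivity (a%:E * lebesgue_measure I)%E; last first.
    congr (_ * lebesgue_measure _)%E; rewrite /I.
    by apply/seteqP; split=> x /=; rewrite !in_itv/= ltr_pdivrMr// ler_pdivlMr//;
      rewrite ltrBlDr lerBrDr (mulrC x).
  rewrite /I.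
  rewrite !lebesgue_measure_itv /= !lte_fin ltr_pM2r ?invr_gt0// ltrD2r.
  case: ifP => _; last by rewrite mule0.
  rewrite -!EFinB -EFinM; congr (_%:E).
  by field; rewrite gt_eqF.
by rewrite /nu /mscale /= muleA -EFinM mulVf ?gt_eqF// mul1e.
Qed.

Lemma measurable_affine1 (a b : R) :
  measurable_fun setT (fun x : measurableTypeR R => a * x + b : measurableTypeR R).
Proof.
apply: (@measurable_funD _ _ _ _ (fun x => a * x) (fun=> b)) => //.
exact: measurable_funM.
Qed.

Lemma ge0_integral_affine1 (a b : R) (f : R -> \bar R) : 0 < a ->
  measurable_fun setT f -> (forall x, 0 <= f x)%E ->
  (\int[@lebesgue_measure R]_x f (a * x + b)%R =
   (a^-1)%:E * \int[@lebesgue_measure R]_x f x)%E.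
Proof.
move=> a0 mf f0.
rewrite (_ : (a^-1)%:E = (NngNum (ltW (etrans (invr_gt0 a) a0)))%:num%:E)//.
rewrite -ge0_integral_mscale//.
have := @ge0_integral_pushforward _ _ _ _ R _ (measurable_affine1 a b)
   lebesgue_measure setT f measurableT mf (fun y _ => f0 y).
move=> /= <-.
apply: eq_measure_integral => [|? A mA _]; first exact: measurable_affine1.
rewrite /= /pushforward /mscale /=; exact: lebesgue_affine.
Qed.

Definition affine_tuple n (a : R) (b : n.-tuple R) (t : n.-tuple (measurableTypeR R)) :
  n.-tuple (measurableTypeR R) := [tuple a * tnth t i + tnth b i | i < n].

Lemma measurable_affine_tuple n a (b : n.-tuple R) :
  measurable_fun setT (affine_tuple a b).
Proof.
apply/measurable_fun_tnthP => i.
rewrite (_ : _ \o _ = (fun x => a * x + tnth b i) \o (fun t => tnth t i)).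
  apply: measurableT_comp; first exact: measurable_affine1.
  exact: measurable_tnth.
by apply/funext => t; rewrite /= tnth_mktuple.
Qed.

Lemma lebesgue_tupleS n (A : set (n.+1.-tuple (measurableTypeR R))) :
  mu n.+1 A = (\int[@lebesgue_measure R]_x mu n [set t | A (tcons (x, t))])%E.
Proof.
rewrite /= /lebesgueS /pushforward /product_measure1 /=.
by apply: eq_integral => x _ /=; congr (mu n _); apply/seteqP; split => t; rewrite /xsection/= inE.
Qed.

Lemma measurable_tcons_section n (A : set (n.+1.-tuple (measurableTypeR R))) x :
  measurable A -> measurable [set t : n.-tuple (measurableTypeR R) | A (tcons (x, t))].
Proof.
move=> mA.
rewrite (_ : mkset _ = xsection (@tcons R n @^-1` A) x).
  by apply: measurable_xsection; rewrite -[X in measurable X]setTI; exact: measurable_tcons.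
by apply/seteqP; split => t; rewrite /xsection/= inE.
Qed.

Lemma measurable_fun_tcons_section n (A : set (n.+1.-tuple (measurableTypeR R))) :
  measurable A -> measurable_fun setT
    (fun x => mu n [set t : n.-tuple (measurableTypeR R) | A (tcons (x, t))]).
Proof.
move=> mA.
have mB : measurable (@tcons R n @^-1` A).
  by rewrite -[X in measurable X]setTI; exact: measurable_tcons.
have := measurable_fun_xsection (mu n) mB; apply: eq_measurable_fun => x _ /=.
by congr (mu n _); apply/seteqP; split => t; rewrite /xsection/= inE.
Qed.

Lemma affine_tcons n a (b : n.+1.-tuple R) x t :
  affine_tuple a b (tcons (x, t)) =
  tcons (a * x + thead b, affine_tuple a [tuple of behead b] t).
Proof.
apply: eq_from_tnth => i; rewrite tnth_mktuple.
case: (unliftP ord0 i) => [j ->|->].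
  by rewrite !tnthS tnth_mktuple [b in LHS]tuple_eta tnthS.
by rewrite !tnth0.
Qed.

(** By induction on the dimension, slicing along the first coordinate. *)
Lemma lebesgue_tuple_affine n a (b : n.-tuple R) A : 0 < a -> measurable A ->
  mu n (affine_tuple a b @^-1` A) = ((a ^- n)%:E * mu n A)%E.
Proof.
move=> a0; elim: n b A => [|n IH] b A mA.
  rewrite expr0 invr1 mul1e; congr (mu 0 _).
  by apply/seteqP; split => t; rewrite /= (tuple0 (affine_tuple a b t)) (tuple0 t).
rewrite !lebesgue_tupleS.
under eq_integral => x _.
  rewrite (_ : mkset _ = affine_tuple a [tuple of behead b] @^-1`
     [set t | A (tcons (a * x + thead b, t))]); last first.
    by apply/seteqP; split => t /=; rewrite affine_tcons.
  rewrite IH; last exact: measurable_tcons_section.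
  over.
rewrite ge0_integralZl//=; last 2 first.
- apply: (measurableT_comp (measurable_fun_tcons_section mA)).
  exact: measurable_affine1.
- by rewrite lee_fin invr_ge0 exprn_ge0// ltW.
rewrite (ge0_integral_affine1 _ a0 (measurable_fun_tcons_section mA))//.
by rewrite muleA -EFinM exprSr invfM.
Qed.

Lemma vec_affine n a (b : n.-tuple R) t :
  vec (affine_tuple a b t) = a *: vec t + vec b.
Proof. by apply/rowP => i; rewrite !mxE tnth_mktuple. Qed.

Definition unvec n (x : 'rV[R]_n) : n.-tuple R := [tuple x 0 i | i < n].

Lemma unvecK n : cancel (@unvec n) (@vec R n).
Proof. by move=> x; apply/rowP => i; rewrite mxE tnth_mktuple. Qed.

(** Open sets refer to the sup norm on row vectors, measurable sets to the
    product sigma-algebra on tuples.  They are matched by writing U as the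
    countable union of the balls with rational centre and radius 1/(k+1) that
    it contains. *)
Lemma open_measurable_vec n (U : set 'rV[R]_n) : open U ->
  measurable (@vec R n @^-1` U).
Proof.
move=> oU.
pose B (p : {ffun 'I_n -> rat} * nat) : set 'rV[R]_n :=
  [set x | `|(\row_i ratr (p.1 i)) - x| < p.2.+1%:R^-1].
pose F (p : {ffun 'I_n -> rat} * nat) := if asbool (B p `<=` U) then @vec R n @^-1` B p else set0.
have -> : @vec R n @^-1` U = \bigcup_p F p.
  apply/seteqP; split => t; last first.
    by case=> p _; rewrite /F; case: asboolP => // BU; apply: BU.
  move=> /= Ut.
  have /nbhs_ballP[e /= e0 eU] : nbhs (vec t) U by exact: open_nbhs_nbhs.
  have [k ke] : exists k : nat, k.+1%:R^-1 < e / 2.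
    have := @ltr_add_invr R 0 (e/2); rewrite divr_gt0// => /(_ isT) [k].
    by rewrite add0r => ?; exists k.
  have k0 : 0 < k.+1%:R^-1 :> R by rewrite invr_gt0.
  have h (i : 'I_n) : {q : rat | `|ratr q - tnth t i| < k.+1%:R^-1}.
    apply: cid; have [q] := @rat_in_itvoo R (tnth t i - k.+1%:R^-1) (tnth t i + k.+1%:R^-1) (ltac:(rewrite ltrD2l; apply: lt_trans k0; by rewrite oppr_lt0)).
    by rewrite in_itv/= => qi; exists q; rewrite ltr_distl.
  exists ([ffun i => sval (h i)], k) => //.
  have Bt : B ([ffun i => sval (h i)], k) (vec t).
    rewrite /B/=; apply/rV_norm_ltP => // i.
    by rewrite !mxE ffunE; have := svalP (h i).
  rewrite /F asboolT//.
  apply: subset_trans eU => y; rewrite /B /= -ball_normE/= in Bt *.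
  move=> By; rewrite (_ : vec t - y = - ((\row_i ratr ([ffun i0 => sval (h i0)] i)) - vec t) + ((\row_i ratr ([ffun i0 => sval (h i0)] i)) - y)); last first.
    by rewrite opprB addrA subrK.
  apply: le_lt_trans (ler_normD _ _) _; rewrite normrN (splitr e) ltrD//; exact: lt_trans ke.
apply: countable_bigcupT_measurable => // p.
rewrite /F; case: asboolP => // _.
have -> : @vec R n @^-1` B p = \bigcap_(i in [set: 'I_n])
    ((fun t : n.-tuple (measurableTypeR R) => tnth t i) @^-1` ball (ratr (p.1 i) : R) (p.2.+1%:R^-1)).
  apply/seteqP; split => t /=; rewrite /B/=.
    by move/rV_norm_ltP => h i _; have := h ltac:(by []) i; rewrite !mxE /ball/=.
  by move=> h; apply/rV_norm_ltP => // i; have := h i I; rewrite !mxE.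
apply: fin_bigcap_measurable => // i _.
rewrite -[X in measurable X]setTI; apply: measurable_tnth => //.
exact: measurable_ball.
Qed.
End measure_Rn.

(** * Integrals of continuous functions dominated by a product weight *)

Section integral_Rn.
Context (R : realType).
Local Notation mu := (lebesgue_tuple R).

Lemma cont_measurable_vec n (F : 'rV[R]_n -> R) : continuous F ->
  measurable_fun setT (fun t : n.-tuple (measurableTypeR R) => F (vec t)).
Proof.
move=> cF; apply: (measurability _ (RGenOpens.measurableE R)).
move=> _ [_ [a [b ->] <-]]; rewrite setTI.
apply: (@open_measurable_vec R n (F @^-1` `]a, b[%classic)).
by move/continuousP: cF; apply; exact: interval_open.
Qed.

Lemma ge0_integral_tupleS n (f : n.+1.-tuple (measurableTypeR R) -> \bar R) :
  measurable_fun setT f -> (forall t, 0 <= f t)%E ->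
  (\int[mu n.+1]_t f t =
   \int[@lebesgue_measure R]_x \int[mu n]_t f (tcons (x, t)))%E.
Proof.
move=> mf f0.
have mtc := measurable_tcons (R := R) (n := n).
rewrite -(fubini_tonelli1 (m1 := @lebesgue_measure R) (m2 := mu n) (f \o @tcons R n))//=; last exact: measurableT_comp.
exact: (@ge0_integral_pushforward _ _ _ _ R _ mtc
  (@lebesgue_measure R \x mu n)%E setT f measurableT mf (fun y _ => f0 y)).
Qed.

(** Decay is measured by powers of this weight rather than of 1 + |x|: it is
    integrable and it factors over the coordinates, so that its integral is
    computed one variable at a time. *)
Definition wt n (x : 'rV[R]_n) : R := \prod_(i < n) (1 + x 0 i ^+ 2)^-1.

Lemma wt1_gt0 (t : R) : 0 < (1 + t ^+ 2)^-1.
Proof. by rewrite invr_gt0 ltr_wpDr// sqr_ge0. Qed.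

Lemma wt1_le1 (t : R) : (1 + t ^+ 2)^-1 <= 1.
Proof. by rewrite invf_le1 ?lerDl ?sqr_ge0// ltr_wpDr// sqr_ge0. Qed.

Lemma wt_gt0 n (x : 'rV[R]_n) : 0 < wt x.
Proof. by apply: prodr_gt0 => i _; exact: wt1_gt0. Qed.

Lemma wt_le1 n (x : 'rV[R]_n) : wt x <= 1.
Proof.
by apply: prodr_ile1 => i _; rewrite wt1_le1 ltW// wt1_gt0.
Qed.

Lemma continuous_big_prod (T : topologicalType) (I : Type) (s : seq I)
    (f : I -> T -> R) : (forall i, continuous (f i)) ->
  continuous (fun x => \prod_(i <- s) f i x).
Proof.
move=> cf; elim: s => [|i s IH] x.
  by under eq_fun do rewrite big_nil; exact: cst_continuous.
by under eq_fun do rewrite big_cons; exact: continuousM (cf i x) (IH x).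
Qed.

Lemma continuous_big_sum (T : topologicalType) (I : Type) (s : seq I)
    (f : I -> T -> R) : (forall i, continuous (f i)) ->
  continuous (fun x => \sum_(i <- s) f i x).
Proof.
move=> cf; elim: s => [|i s IH] x.
  by under eq_fun do rewrite big_nil; exact: cst_continuous.
by under eq_fun do rewrite big_cons; exact: continuousD (cf i x) (IH x).
Qed.

Lemma wt_continuous n : continuous (@wt n).
Proof.
apply: continuous_big_prod => i x.
apply: (@continuous_comp _ _ _ (fun y : 'rV[R]_n => y 0 i) (fun t => (1 + t ^+ 2)^-1)).
  exact: coord_continuous.
exact: continuous_oneDsqrV.
Qed.

Lemma integral_wt1_lty : (\int[@lebesgue_measure R]_x ((1 + x ^+ 2)^-1)%:E < +oo)%E.
Proof.
rewrite (ge0_symfun_integralT (f := fun x => (1 + x ^+ 2)^-1))//.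
- by rewrite -set_itvcy (integral0y_oneDsqr R) -EFinM ltry.
- by move=> x; exact/ltW/wt1_gt0.
- exact: continuous_oneDsqrV.
- by move=> x; rewrite /= sqrrN.
Qed.

Lemma integral_wt_lty n : (\int[mu n]_t (wt (vec t))%:E < +oo)%E.
Proof.
elim: n => [|n IH].
  rewrite (_ : mu 0 = @dirac _ (0.-tuple (measurableTypeR R)) [tuple] R)// integral_dirac//.
    by rewrite diracT mul1e ltry.
  by apply/measurable_EFinP; apply: cont_measurable_vec; exact: wt_continuous.
have mw m : measurable_fun setT (fun t : m.-tuple (measurableTypeR R) => (wt (vec t))%:E).
  by apply/measurable_EFinP; apply: cont_measurable_vec; exact: wt_continuous.
have w0 m (t : m.-tuple R) : (0 <= (wt (vec t))%:E)%E by rewrite lee_fin ltW// wt_gt0.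
rewrite ge0_integral_tupleS//.
have wS x (t : n.-tuple R) : wt (vec (tcons (x, t))) = (1 + x ^+ 2)^-1 * wt (vec t).
  rewrite /wt big_ord_recl !mxE tnth0/=; congr (_ * _).
  by apply: eq_bigr => i _; rewrite !mxE tnthS.
under eq_integral => x _.
  under eq_integral => t _ do rewrite wS EFinM.
  rewrite ge0_integralZl//; [over|exact: mw|by rewrite lee_fin ltW// wt1_gt0].
rewrite /= ge0_integralZr//; last 3 first.
- apply/measurable_EFinP; apply: continuous_measurable_fun; exact: continuous_oneDsqrV.
- by move=> x _; rewrite lee_fin ltW// wt1_gt0.
- exact: integral_ge0.
have I1 : (0 <= \int[@lebesgue_measure R]_x ((1 + x ^+ 2)^-1)%:E)%E.
  by apply: integral_ge0 => x _; rewrite lee_fin ltW// wt1_gt0.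
have I2 : (0 <= \int[mu n]_t (wt (vec t))%:E)%E by exact: integral_ge0.
rewrite -ge0_fin_numE; last exact: mule_ge0.
by rewrite fin_numM// ge0_fin_numE//; exact: integral_wt1_lty.
Qed.

Definition rinteg n (F : 'rV[R]_n -> R) :=
  (mu n).-integrable setT (fun t => (F (vec t))%:E).

Definition rint n (F : 'rV[R]_n -> R) : R := (\int[mu n]_t F (vec t))%R.

Lemma rinteg_wt n : rinteg (@wt n).
Proof.
apply/integrableP; split.
  by apply/measurable_EFinP; apply: cont_measurable_vec; exact: wt_continuous.
under eq_integral do rewrite gee0_abs ?lee_fin ?ltW// ?wt_gt0//.
exact: integral_wt_lty.
Qed.

Lemma rinteg_le n (F : 'rV[R]_n -> R) C : continuous F ->
  (forall x, `|F x| <= C * wt x) -> rinteg F.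
Proof.
move=> cF FC.
have : rinteg (fun x : 'rV[R]_n => C * wt x).
  rewrite /rinteg; under eq_fun do rewrite EFinM; exact: integrableZl (rinteg_wt n).
apply: le_integrable => //.
  by apply/measurable_EFinP; exact: cont_measurable_vec.
by move=> t _; rewrite /= lee_fin (le_trans (FC _))// ler_norm.
Qed.

Lemma rintD n (F G : 'rV[R]_n -> R) : rinteg F -> rinteg G ->
  rint (fun x => F x + G x) = rint F + rint G.
Proof. by move=> iF iG; rewrite /rint RintegralD. Qed.

Lemma rintB n (F G : 'rV[R]_n -> R) : rinteg F -> rinteg G ->
  rint (fun x => F x - G x) = rint F - rint G.
Proof. by move=> iF iG; rewrite /rint RintegralB. Qed.

Lemma rintZ n (a : R) (F : 'rV[R]_n -> R) : rinteg F ->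
  rint (fun x => a * F x) = a * rint F.
Proof. by move=> iF; rewrite /rint RintegralZl. Qed.

Lemma rint_ge0 n (F : 'rV[R]_n -> R) : (forall x, 0 <= F x) -> 0 <= rint F.
Proof. by move=> F0; apply: Rintegral_ge0. Qed.

Lemma rint_bound n (F : 'rV[R]_n -> R) C : continuous F ->
  (forall x, `|F x| <= C * wt x) -> `|rint F| <= C * rint (@wt n).
Proof.
move=> cF FC; have iF := rinteg_le cF FC.
have iw := rinteg_wt n.
rewrite -rintZ// (le_trans (le_normr_Rintegral _ iF))//.
apply: le_Rintegral => //.
- exact: (integrable_norm iF).
- by rewrite (_ : EFin \o _ = fun t => C%:E * (wt (vec t))%:E)%E//; exact: integrableZl.
Qed.

(** Change of variables, which carries all the scaling of the argument. *)
Lemma rint_affine n (F : 'rV[R]_n -> R) a (b : 'rV[R]_n) : 0 < a -> rinteg F ->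
  rinteg (fun x => F (a *: x + b)) /\
  rint (fun x => F (a *: x + b)) = a ^- n * rint F.
Proof.
move=> a0 iF.
pose g := affine_tuple a (unvec b) : n.-tuple (measurableTypeR R) -> _.
have mg : measurable_fun setT g by exact: measurable_affine_tuple.
have an : 0 <= a ^- n by rewrite invr_ge0 exprn_ge0// ltW.
have E A : measurable A -> A `<=` setT -> pushforward (mu n) g A = mscale (NngNum an) (mu n) A.
  by move=> mA _; rewrite /pushforward lebesgue_tuple_affine.
have Fg t : F (a *: vec t + b) = F (vec (g t)) by rewrite vec_affine unvecK.
have mF : measurable_fun setT (fun t : n.-tuple (measurableTypeR R) => (F (vec t))%:E).
  exact: (measurable_int _ iF).
have maF : measurable_fun setT (fun t : n.-tuple (measurableTypeR R) => `|(F (vec t))%:E|%E).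
  exact: measurableT_comp.
have iFg : rinteg (fun x => F (a *: x + b)).
  rewrite /rinteg; under eq_fun do rewrite Fg.
  apply/integrableP; split; first exact: (measurableT_comp mF).
  have := @ge0_integral_pushforward _ _ _ _ R _ mg (mu n) setT _ measurableT maF (fun y _ => abse_ge0 _).
  move=> /= <-.
  rewrite (eq_measure_integral (mscale (NngNum an) (mu n)))//.
  rewrite ge0_integral_mscale//.
  move/integrableP : iF => [_ iF]; rewrite -ge0_fin_numE; last by rewrite mule_ge0// integral_ge0.
  by rewrite fin_numM// ge0_fin_numE// integral_ge0.
split=> //; rewrite /rint /Rintegral -[a ^- n]/(fine (a ^- n)%:E) -fineM//.
  congr fine.
  under eq_integral do rewrite Fg.
  have := @integral_pushforward _ _ _ _ R _ mg (mu n) setT _ mF.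
  rewrite preimage_setT => /(_ _ measurableT) /= <-; last first.
    by move: iFg; rewrite /rinteg; under eq_fun do rewrite Fg.
  rewrite (eq_measure_integral (mscale (NngNum an) (mu n)))//.
  rewrite [in LHS]integralE [in RHS]integralE.
  have ip := integrable_fin_num measurableT (integrable_funepos measurableT iF).
  have in_ := integrable_fin_num measurableT (integrable_funeneg measurableT iF).
  rewrite ge0_integral_mscale//; last exact: measurable_funepos.
  rewrite ge0_integral_mscale//; last exact: measurable_funeneg.
  by apply/esym; apply: muleBr => //; exact: fin_num_adde_defr.
exact: integrable_fin_num.
Qed.

(** Tonelli shows that the kernel is integrable on the product, since it is
    dominated by the product of two integrable weights; Fubini then applies. *)
Lemma fubini_wt n (K : 'rV[R]_n -> 'rV[R]_n -> R) (C : R) :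
  measurable_fun setT (fun p : n.-tuple (measurableTypeR R) * n.-tuple (measurableTypeR R) => K (vec p.1) (vec p.2)) ->
  (forall x y, `|K x y| <= C * (wt x * wt y)) ->
  rint (fun x => rint (fun y => K x y)) = rint (fun y => rint (fun x => K x y)).
Proof.
move=> mK KC.
pose f (p : n.-tuple (measurableTypeR R) * n.-tuple (measurableTypeR R)) := (K (vec p.1) (vec p.2))%:E.
have mf : measurable_fun setT f by exact/measurable_EFinP.
have maf : measurable_fun setT (abse \o f) by exact: measurableT_comp.
have mw : measurable_fun setT (fun t : n.-tuple (measurableTypeR R) => (wt (vec t))%:E).
  by apply/measurable_EFinP; apply: cont_measurable_vec; exact: wt_continuous.
have w0 (t : n.-tuple R) : (0 <= (wt (vec t))%:E)%E by rewrite lee_fin ltW// wt_gt0.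
have C0 : 0 <= C.
  have := KC 0 0; move=> /(le_trans (normr_ge0 _)).
  by rewrite pmulr_lge0// mulr_gt0// wt_gt0.
have W0 : (0 <= \int[mu n]_t (wt (vec t))%:E)%E by exact: integral_ge0.
have Wf : (\int[mu n]_t (wt (vec t))%:E)%E \is a fin_num by rewrite ge0_fin_numE// integral_wt_lty.
have iF : (mu n \x mu n)%E.-integrable setT f.
  apply/integrable12ltyP => //.
  apply: (@le_lt_trans _ _ (\int[mu n]_x (C%:E * (wt (vec x))%:E * \int[mu n]_y (wt (vec y))%:E))%E).
    apply: ge0_le_integral => //.
    - by move=> x _; exact: integral_ge0.
    - have := measurable_fun_fubini_tonelli_F (m2 := mu n) (abse \o f); apply => // p; exact: abse_ge0.
    - by apply: emeasurable_funM => //; apply: emeasurable_funM.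
    - move=> x _; rewrite -ge0_integralZl// ?mule_ge0//.
      apply: ge0_le_integral => //.
      + exact: (measurableT_comp maf (pair1_measurable _)).
      + by apply: emeasurable_funM.
      + by move=> y _; rewrite -!EFinM lee_fin -mulrA.
  rewrite ge0_integralZr//; last 2 first.
  - by apply: emeasurable_funM.
  - by move=> x _; rewrite mule_ge0.
  rewrite ge0_integralZl// -ge0_fin_numE ?fin_numM//.
  by rewrite !mule_ge0.
have fin x : rinteg (fun y => K (vec x) y) .
  apply/integrableP; split; first exact: (measurableT_comp mf (pair1_measurable _)).
  apply: (@le_lt_trans _ _ (\int[mu n]_y ((C * wt (vec x))%:E * (wt (vec y))%:E))%E).
    apply: ge0_le_integral => //.
    + exact: (measurableT_comp maf (pair1_measurable _)).
    + by apply: emeasurable_funM.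
    + by move=> y _; rewrite -!EFinM lee_fin -mulrA.
  rewrite ge0_integralZl// ?lee_fin ?mulr_ge0// ?ltW ?wt_gt0//.
  by rewrite -ge0_fin_numE ?fin_numM// mule_ge0// lee_fin mulr_ge0// ltW// wt_gt0.
have fin' y : rinteg (fun x => K x (vec y)).
  apply/integrableP; split; first exact: (measurableT_comp mf (pair2_measurable _)).
  apply: (@le_lt_trans _ _ (\int[mu n]_x ((C * wt (vec y))%:E * (wt (vec x))%:E))%E).
    apply: ge0_le_integral => //.
    + exact: (measurableT_comp maf (pair2_measurable _)).
    + by apply: emeasurable_funM.
    + by move=> x _; rewrite -!EFinM lee_fin -mulrA (mulrC (wt (vec y))).
  rewrite ge0_integralZl// ?lee_fin ?mulr_ge0// ?ltW ?wt_gt0//.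
  by rewrite -ge0_fin_numE ?fin_numM// mule_ge0// lee_fin mulr_ge0// ltW// wt_gt0.
have E1 x : (rint (fun y => K (vec x) y))%:E = (\int[mu n]_y f (x, y))%E.
  by rewrite /rint /Rintegral fineK//; exact: (integrable_fin_num measurableT (fin x)).
have E2 y : (rint (fun x => K x (vec y)))%:E = (\int[mu n]_x f (x, y))%E.
  by rewrite /rint /Rintegral fineK//; exact: (integrable_fin_num measurableT (fin' y)).
rewrite [LHS]/rint [RHS]/rint /Rintegral; congr fine.
under eq_integral do rewrite E1.
under [RHS]eq_integral do rewrite E2.
exact: Fubini.
Qed.
End integral_Rn.

(** * Volumes of cubes, and positivity of integrals *)

Section volumes.
Context (R : realType).
Local Notation mu := (lebesgue_tuple R).

(** Balls of the sup norm are cubes, whose volumes are exact. *)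
Definition cube n (b : 'rV[R]_n) (r : R) : set 'rV[R]_n := [set x | `|x - b| < r].

Lemma lebesgue_itvball (b r : R) : 0 < r ->
  lebesgue_measure [set x : R | `|x - b| < r] = (2 * r)%:E.
Proof.
move=> r0.
have -> : [set x : R | `|x - b| < r] = ball b r.
  by rewrite -ball_normE; apply/seteqP; split=> x /=; rewrite distrC.
by rewrite lebesgue_measure_ball ?ltW// mulr_natl.
Qed.

Lemma volume_cube n (b : 'rV[R]_n) (r : R) : 0 < r ->
  volume (cube b r) = ((2 * r) ^+ n)%:E.
Proof.
move=> r0; rewrite /volume.
have -> : @vec R n @^-1` cube b r = [set t | forall i, `|tnth t i - b 0 i| < r].
  apply/seteqP; split => t /=; rewrite /cube /= rV_norm_ltP// => h i;
  by have := h i; rewrite !mxE.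
elim: n b => [|n IH] b.
  rewrite (_ : mkset _ = setT) ?expr0; first by rewrite /= diracT.
  by apply/seteqP; split => // t _ [].
rewrite lebesgue_tupleS.
have E x : [set t : n.-tuple (measurableTypeR R) | forall i, `|tnth (tcons (x, t)) i - b 0 i| < r] =
   if `|x - b 0 ord0| < r then [set t | forall i, `|tnth t i - (\row_j b 0 (lift ord0 j)) 0 i| < r] else set0.
  case: ifPn => xr.
    apply/seteqP; split => t /= h i.
      by have := h (lift ord0 i); rewrite tnthS !mxE.
    case: (unliftP ord0 i) => [j ->|->]; last by rewrite tnth0.
    by have := h j; rewrite tnthS !mxE.
  apply/seteqP; split => t //= h; have := h ord0; rewrite tnth0 => xr'.
  by rewrite xr' in xr.
transitivity (\int[@lebesgue_measure R]_x (((2 * r) ^+ n)%:E * (\1_[set x : R | `|x - b 0 ord0| < r] x)%:E))%E.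
  apply: eq_integral => x _; rewrite E indicE.
  case: ifPn => xr; first by rewrite IH mem_set// mule1.
  by rewrite measure0 memNset// ?mule0//=; exact/negP.
have mB : measurable [set x : measurableTypeR R | `|x - b 0 ord0| < r].
  rewrite (_ : mkset _ = ball (b 0 ord0) r); first exact: measurable_ball.
  by rewrite -ball_normE; apply/seteqP; split=> x /=; rewrite distrC.
rewrite ge0_integralZl//; last by rewrite lee_fin exprn_ge0// mulr_ge0// ltW.
  rewrite integral_indic// setIT exprSr EFinM; congr (_ * _)%E.
  exact: lebesgue_itvball.
by apply/measurable_EFinP; exact: measurable_indic.
Qed.

Lemma open_cube n (b : 'rV[R]_n) (r : R) : open (cube b r).
Proof.
rewrite (_ : cube b r = ball b r); first exact: ball_open.
by rewrite -ball_normE; apply/seteqP; split=> x /=; rewrite /cube /= distrC.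
Qed.

(** The function is bounded below by half its value at x0 on a cube of positive
    volume. *)
Lemma rint_gt0 n (F : 'rV[R]_n -> R) x0 : continuous F -> rinteg F ->
  (forall x, 0 <= F x) -> 0 < F x0 -> 0 < rint F.
Proof.
move=> cF iF F0 Fx0.
have [r r0 hr] : exists2 r : R, 0 < r & forall x, cube x0 r x -> F x0 / 2 < F x.
  have : \forall x \near x0, F x0 / 2 < F x.
    have /cvgr_gt : F y @[y --> x0] --> F x0 by exact: cF.
    apply; by rewrite ltr_pdivrMr// ltr_pMr// ltr1n.
  case/nbhs_ballP => r /= r0 h; exists r => // x xr; apply: h.
  by rewrite -ball_normE /= distrC.
have mB : measurable (@vec R n @^-1` cube x0 r).
  by apply: open_measurable_vec; exact: open_cube.
suff : ((F x0 / 2 * (2 * r) ^+ n)%:E <= (rint F)%:E)%E.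
  rewrite lee_fin; apply: lt_le_trans.
  by rewrite mulr_gt0// ?divr_gt0// exprn_gt0// mulr_gt0.
rewrite /rint /Rintegral fineK; last exact: (integrable_fin_num _ iF).
rewrite EFinM -(volume_cube x0 r0) /volume.
have F20 : (0 <= (F x0 / 2)%:E)%E by rewrite lee_fin divr_ge0// ltW.
rewrite -[X in mu n X]setIT -integral_indic// -ge0_integralZl//; last first.
  by apply/measurable_EFinP; exact: measurable_indic.
apply: ge0_le_integral => //.
- by move=> t _; rewrite mule_ge0// lee_fin.
- by apply: emeasurable_funM => //; apply/measurable_EFinP; exact: measurable_indic.
- exact: (measurable_int _ iF).
- move=> t _; rewrite -EFinM lee_fin indicE.
  have [/set_mem tB|] := boolP (t \in _); last by rewrite mulr0.
  by rewrite mulr1 ltW// hr.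
Qed.
End volumes.

(** * Complex integrals and the Fourier transform *)

Section complex_integral.
Context (R : realType).
Implicit Types (z : R[i]).

Lemma ReM (a b : R[i]) : complex.Re (a * b) = complex.Re a * complex.Re b - complex.Im a * complex.Im b.
Proof. by case: a; case: b. Qed.
Lemma ImM (a b : R[i]) : complex.Im (a * b) = complex.Re a * complex.Im b + complex.Im a * complex.Re b.
Proof. by case: a; case: b. Qed.
Lemma ReD (a b : R[i]) : complex.Re (a + b) = complex.Re a + complex.Re b.
Proof. by case: a; case: b. Qed.
Lemma ImD (a b : R[i]) : complex.Im (a + b) = complex.Im a + complex.Im b.
Proof. by case: a; case: b. Qed.

Lemma normc_Re z : `|complex.Re z| <= normc z.
Proof. by case: z => a b; rewrite -sqrtr_sqr /normc/= ler_wsqrtr// lerDl sqr_ge0. Qed.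
Lemma normc_Im z : `|complex.Im z| <= normc z.
Proof. by case: z => a b; rewrite -sqrtr_sqr /normc/= ler_wsqrtr// lerDr sqr_ge0. Qed.
Lemma normc_ge0 z : 0 <= normc z.
Proof. by case: z => a b; exact: sqrtr_ge0. Qed.
Lemma normc_le z : normc z <= `|complex.Re z| + `|complex.Im z|.
Proof.
case: z => a b /=; rewrite /normc /= -[leRHS]ger0_norm ?addr_ge0// -sqrtr_sqr ler_wsqrtr//.
rewrite sqrrD !real_normK ?num_real// lerD2r lerDl. by rewrite mulrn_wge0// mulr_ge0.
Qed.
Lemma normc_real (a : R) : normc (a%:C%C) = `|a|.
Proof. by rewrite /normc/= expr0n addr0 sqrtr_sqr. Qed.
Lemma normc_cis (t : R) : normc (cis t) = 1.
Proof. by rewrite /normc/= cos2Dsin2 sqrtr1. Qed.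
Lemma cisD (s t : R) : cis (s + t) = cis s * cis t.
Proof. by rewrite /cis cosD sinD; apply/eqP; rewrite eq_complex /= eqxx /= addrC mulrC [X in _ + X]mulrC. Qed.
Lemma cis0 : cis (0 : R) = 1.
Proof. by rewrite /cis cos0 sin0. Qed.
Lemma eq_cplx (a b : R[i]) : complex.Re a = complex.Re b -> complex.Im a = complex.Im b -> a = b.
Proof. by case: a; case: b => /= ? ? ? ? -> ->. Qed.
Lemma normc_eq0 z : normc z = 0 <-> z = 0.
Proof. by split=> [/eq0_normc//|->]; rewrite normc0. Qed.

Section top.
Context (T : topologicalType).
Definition ccont (f : T -> R[i]) := continuous (fun x => complex.Re (f x)) /\ continuous (fun x => complex.Im (f x)).
Lemma ccontM f g : ccont f -> ccont g -> ccont (fun x => f x * g x).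
Proof.
move=> [rf jf] [rg ig]; split=> x.
  under eq_fun do rewrite ReM; apply: cvgB; apply: cvgM; by [exact: rf|exact: jf|exact: rg|exact:ig].
under eq_fun do rewrite ImM; apply: cvgD; apply: cvgM; by [exact: rf|exact: jf|exact: rg|exact:ig].
Qed.
Lemma ccontD f g : ccont f -> ccont g -> ccont (fun x => f x + g x).
Proof.
move=> [rf jf] [rg ig]; split=> x.
  under eq_fun do rewrite ReD; apply: cvgD; by [exact: rf|exact: rg].
under eq_fun do rewrite ImD; apply: cvgD; by [exact: jf|exact: ig].
Qed.
Lemma ccont_cst z : ccont (fun=> z).
Proof. by split => x; exact: cvg_cst. Qed.
Lemma ccont_cis (f : T -> R) : continuous f -> ccont (fun x => cis (f x)).
Proof.
move=> cf; split=> x; apply: continuous_comp; try exact: cf.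
  exact: continuous_cos.
exact: continuous_sin.
Qed.
Lemma ccont_real (f : T -> R) : continuous f -> ccont (fun x => (f x)%:C%C).
Proof. by move=> cf; split=> // x; exact: cvg_cst. Qed.
Lemma ccont_normc f : ccont f -> continuous (fun x => normc (f x)).
Proof.
move=> [rf jf] x.
have E y : normc (f y) = Num.sqrt (complex.Re (f y) ^+ 2 + complex.Im (f y) ^+ 2) by case: (f y).
under eq_fun do rewrite E.
apply: continuous_comp; last exact: sqrt_continuous.
by apply: cvgD; rewrite !expr2; apply: cvgM; by [exact: rf|exact: jf].
Qed.
End top.
Lemma ccont_comp (T U : topologicalType) (h : T -> U) (f : U -> R[i]) :
  continuous h -> ccont f -> ccont (fun x => f (h x)).
Proof.
move=> ch [rf jf]; split=> x.
  exact: (@continuous_comp _ _ _ h (fun u => complex.Re (f u)) x (ch x) (rf (h x))).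
exact: (@continuous_comp _ _ _ h (fun u => complex.Im (f u)) x (ch x) (jf (h x))).
Qed.

Context (n : nat).
Implicit Types (f g : cfun R n).

(** Membership in wdom 1 suffices to integrate, in wdom 2 to make the Fourier
    transform continuous and differentiable; rapid replaces the Schwartz class
    where derivatives do not matter. *)
Definition wdom (k : nat) f := ccont f /\ exists C : R, forall x, normc (f x) <= C * wt x ^+ k.
Definition rapid f := forall k, wdom k f.

Lemma wdom_le k l f : (k <= l)%N -> wdom l f -> wdom k f.
Proof.
move=> kl [cf [C hC]]; split=> //; exists C => x.
have C0 : 0 <= C by rewrite -(pmulr_lge0 _ (exprn_gt0 l (wt_gt0 x))) (le_trans (normc_ge0 _) (hC x)).
rewrite (le_trans (hC x))// ler_wpM2l//.
by rewrite ler_wiXn2l// ?wt_le1// ltW// wt_gt0.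
Qed.

Lemma wdom_cst_ge0 k f C : (forall x, normc (f x) <= C * wt x ^+ k) -> 0 <= C.
Proof.
move=> hC.
have h := exprn_gt0 k (wt_gt0 (0 : 'rV[R]_n)).
by rewrite -(pmulr_lge0 _ h) (le_trans (normc_ge0 _) (hC 0)).
Qed.

Lemma wdomD k f g : wdom k f -> wdom k g -> wdom k (fun x => f x + g x).
Proof.
move=> [cf [C hC]] [cg [D hD]]; split; first exact: ccontD.
exists (C + D) => x; rewrite mulrDl (le_trans (le_normcD _ _))//; exact: lerD.
Qed.

Lemma wdomM k l f g : wdom k f -> wdom l g -> wdom (k + l) (fun x => f x * g x).
Proof.
move=> [cf [C hC]] [cg [D hD]]; split; first exact: ccontM.
exists (C * D) => x; rewrite normcM exprD mulrACA.
by rewrite ler_pM// normc_ge0.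
Qed.

Lemma wdom_cst z : wdom 0 (fun=> z).
Proof. by split; [exact: ccont_cst|exists (normc z) => x; rewrite expr0 mulr1]. Qed.

Lemma wdomZ k z f : wdom k f -> wdom k (fun x => z * f x).
Proof. exact: wdomM (wdom_cst z). Qed.

Definition cinteg f := rinteg (ReF f) /\ rinteg (ImF f).

Lemma wdom_cinteg f : wdom 1 f -> cinteg f.
Proof.
move=> [[rf jf] [C hC]]; split.
  apply: (@rinteg_le _ _ _ C) => // x; rewrite -[wt x]expr1.
  exact: le_trans (normc_Re _) (hC x).
apply: (@rinteg_le _ _ _ C) => // x; rewrite -[wt x]expr1.
exact: le_trans (normc_Im _) (hC x).
Qed.

Lemma cintegralE f : cintegral f = (rint (ReF f) +i* rint (ImF f))%C.
Proof. by []. Qed.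

Lemma cintegralD f g : cinteg f -> cinteg g ->
  cintegral (fun x => f x + g x) = cintegral f + cintegral g.
Proof.
move=> [rf jf] [rg ig]; rewrite !cintegralE; apply: eq_cplx => /=.
  by rewrite -rintD//; congr rint; apply/funext => x; rewrite /ReF ReD.
by rewrite -rintD//; congr rint; apply/funext => x; rewrite /ImF ImD.
Qed.

Lemma cintegralZ z f : cinteg f -> cintegral (fun x => z * f x) = z * cintegral f.
Proof.
move=> [rf jf]; rewrite !cintegralE; apply: eq_cplx; rewrite ?ReM ?ImM /=.
  rewrite -!rintZ// -rintB; first by congr rint; apply/funext => x; rewrite /ReF ReM.
    by rewrite /rinteg; under eq_fun do rewrite EFinM; exact: integrableZl.
  by rewrite /rinteg; under eq_fun do rewrite EFinM; exact: integrableZl.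
rewrite -!rintZ// -rintD; first by congr rint; apply/funext => x; rewrite /ImF ImM.
  by rewrite /rinteg; under eq_fun do rewrite EFinM; exact: integrableZl.
by rewrite /rinteg; under eq_fun do rewrite EFinM; exact: integrableZl.
Qed.

Lemma cintegral_bound f C : ccont f -> (forall x, normc (f x) <= C * wt x) ->
  normc (cintegral f) <= 2 * C * rint (@wt R n).
Proof.
move=> [rf jf] hC; rewrite cintegralE (le_trans (normc_le _))//=.
rewrite -mulrA mulrDl !mul1r.
apply: lerD; apply: rint_bound => // x; apply: le_trans (hC x).
  exact: normc_Re.
exact: normc_Im.
Qed.

Lemma cintegral_affine f a (b : 'rV[R]_n) : 0 < a -> cinteg f ->
  cinteg (fun x => f (a *: x + b)) /\
  cintegral (fun x => f (a *: x + b)) = (a ^- n)%:C%C * cintegral f.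
Proof.
move=> a0 [rf jf]; have [i1 e1] := rint_affine b a0 rf; have [i2 e2] := rint_affine b a0 jf.
split; first by split.
rewrite !cintegralE; apply: eq_cplx; rewrite ?ReM ?ImM /= mul0r ?subr0 ?addr0.
  exact: e1.
by rewrite mulrC -mulrC; exact: e2.
Qed.

Lemma rint_cvg (F : ('rV[R]_n -> R) ^nat) (G : 'rV[R]_n -> R) C :
  (forall k, continuous (F k)) -> continuous G ->
  (forall k x, `|F k x| <= C * wt x) ->
  (forall x, F k x @[k --> \oo] --> G x) -> rint (F k) @[k --> \oo] --> rint G.
Proof.
move=> cF cG FC FG.
have mF k : measurable_fun setT (fun t : n.-tuple (measurableTypeR R) => (F k (vec t))%:E).
  by apply/measurable_EFinP; exact: cont_measurable_vec.
have mG : measurable_fun setT (fun t : n.-tuple (measurableTypeR R) => (G (vec t))%:E).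
  by apply/measurable_EFinP; exact: cont_measurable_vec.
have iW : (lebesgue_tuple R n).-integrable setT (fun t => (C * wt (vec t))%:E).
  by under eq_fun do rewrite EFinM; exact: integrableZl (rinteg_wt _ _).
have [||iG _ h] := @dominated_convergence _ _ R (lebesgue_tuple R n) setT measurableT
  (fun k t => (F k (vec t))%:E) (fun t => (G (vec t))%:E) (fun t => (C * wt (vec t))%:E) mF mG _ iW.
- by apply: aeW => t _; apply: cvg_EFin; [exact: nearW|exact: FG].
- by apply: aeW => t k _; rewrite lee_fin.
rewrite /rint /Rintegral.
apply: fine_cvg; rewrite fineK//; exact: (integrable_fin_num _ iG).
Qed.

(** Dominated convergence, applied to the real and imaginary parts. *)
Lemma cintegral_cvg0 (f : (cfun R n) ^nat) g C :
  (forall k, ccont (f k)) -> ccont g ->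
  (forall k x, normc (f k x) <= C * wt x) ->
  (forall x, normc (f k x - g x) @[k --> \oo] --> 0) ->
  normc (cintegral (f k) - cintegral g) @[k --> \oo] --> 0.
Proof.
move=> cf cg fC fg.
have H1 x : complex.Re (f k x) @[k --> \oo] --> complex.Re (g x).
  apply/cvgrPdist_le => e e0; have /cvgrPdist_le/(_ e e0) := fg x.
  apply: filterS => k; rewrite sub0r normrN ger0_norm ?normc_ge0//.
  apply: le_trans; rewrite distrC; apply: le_trans (normc_Re _).
  by rewrite ReD; case: (g x).
have H2 x : complex.Im (f k x) @[k --> \oo] --> complex.Im (g x).
  apply/cvgrPdist_le => e e0; have /cvgrPdist_le/(_ e e0) := fg x.
  apply: filterS => k; rewrite sub0r normrN ger0_norm ?normc_ge0//.
  apply: le_trans; rewrite distrC; apply: le_trans (normc_Im _).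
  by rewrite ImD; case: (g x).
have I1 : rint (ReF (f k)) @[k --> \oo] --> rint (ReF g).
  apply: (@rint_cvg _ _ C) => //; first by move=> k; case: (cf k).
    by case: cg.
  by move=> k x; exact: le_trans (normc_Re _) (fC k x).
have I2 : rint (ImF (f k)) @[k --> \oo] --> rint (ImF g).
  apply: (@rint_cvg _ _ C) => //; first by move=> k; case: (cf k).
    by case: cg.
  by move=> k x; exact: le_trans (normc_Im _) (fC k x).
apply: (@squeeze_cvgr _ _ _ _ (fun=> 0) (fun k => `|rint (ReF (f k)) - rint (ReF g)| + `|rint (ImF (f k)) - rint (ImF g)|)).
- by apply: nearW => k; rewrite normc_ge0 (le_trans (normc_le _)).
- exact: cvg_cst.
- rewrite -[0]addr0; apply: cvgD.
    by rewrite -(normr0 R) -(subrr (rint (ReF g))); apply: cvg_norm; apply: cvgB => //; exact: cvg_cst.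
  by rewrite -(normr0 R) -(subrr (rint (ImF g))); apply: cvg_norm; apply: cvgB => //; exact: cvg_cst.
Qed.

(** One transform for both signs: sg = -1 is the direct transform and sg = 1 the
    inverse one. *)
Lemma dotC (x y : 'rV[R]_n) : dot x y = dot y x.
Proof. by apply: eq_bigr => i _; rewrite mulrC. Qed.
Lemma dotDl (x y z : 'rV[R]_n) : dot (x + y) z = dot x z + dot y z.
Proof. by rewrite -big_split; apply: eq_bigr => i _; rewrite mxE mulrDl. Qed.
Lemma dotZl a (x z : 'rV[R]_n) : dot (a *: x) z = a * dot x z.
Proof. by rewrite /dot mulr_sumr; apply: eq_bigr => i _; rewrite mxE mulrA. Qed.
Lemma dotDr (x y z : 'rV[R]_n) : dot z (x + y) = dot z x + dot z y.
Proof. by rewrite dotC dotDl !(dotC _ z). Qed.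
Lemma dotZr a (x z : 'rV[R]_n) : dot z (a *: x) = a * dot z x.
Proof. by rewrite dotC dotZl (dotC _ z). Qed.
Lemma dot_delta i (x : 'rV[R]_n) : dot x (delta_mx 0 i) = x 0 i.
Proof.
rewrite /dot (bigD1 i)//= mxE !eqxx mulr1 big1 ?addr0// => j ji.
by rewrite mxE (negbTE ji) andbF mulr0.
Qed.
Lemma dot_continuous (y : 'rV[R]_n) : continuous (fun x => dot x y).
Proof.
apply: continuous_big_sum => i x.
exact: (continuousM (@coord_continuous _ _ _ 0 i x) (@cst_continuous _ _ (y 0 i) x)).
Qed.

Definition FT (sg : R) f : cfun R n :=
  fun xi => cintegral (fun x => cis (sg * (2 * pi * dot x xi)) * f x).

Lemma fourierE f : fourier f = FT (-1) f.
Proof. by apply/funext => xi; rewrite /fourier /FT; under eq_fun do rewrite -mulN1r. Qed.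
Lemma inv_fourierE f : inv_fourier f = FT 1 f.
Proof. by apply/funext => xi; rewrite /inv_fourier /FT; congr cintegral; apply/funext => x; rewrite mul1r dotC. Qed.

Lemma ccont_phase sg (xi : 'rV[R]_n) : ccont (fun x => cis (sg * (2 * pi * dot x xi))).
Proof.
apply: ccont_cis => x.
exact: (continuousM (@cst_continuous _ _ sg x)
  (continuousM (@cst_continuous _ _ (2 * pi : R) x) (@dot_continuous xi x))).
Qed.

Lemma wdom_phase sg (xi : 'rV[R]_n) k f : wdom k f ->
  wdom k (fun x => cis (sg * (2 * pi * dot x xi)) * f x).
Proof.
apply: (@wdomM 0 k); split; first exact: ccont_phase.
by exists 1 => x; rewrite normc_cis expr0 mulr1.
Qed.

Lemma FT_bound sg f C : ccont f -> (forall x, normc (f x) <= C * wt x) ->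
  forall xi, normc (FT sg f xi) <= 2 * C * rint (@wt R n).
Proof.
move=> cf hC xi; apply: cintegral_bound => [|x].
  by apply: ccontM => //; exact: ccont_phase.
by rewrite normcM normc_cis mul1r.
Qed.

Lemma FTD sg f g : wdom 1 f -> wdom 1 g ->
  FT sg (fun x => f x + g x) = (fun xi => FT sg f xi + FT sg g xi).
Proof.
move=> df dg; apply/funext => xi; rewrite /FT -cintegralD.
- by congr cintegral; apply/funext => x; rewrite mulrDr.
- by apply: wdom_cinteg; exact: wdom_phase.
- by apply: wdom_cinteg; exact: wdom_phase.
Qed.

Lemma FTZ sg z f : wdom 1 f -> FT sg (fun x => z * f x) = (fun xi => z * FT sg f xi).
Proof.
move=> df; apply/funext => xi; rewrite /FT -cintegralZ.
  by congr cintegral; apply/funext => x; rewrite mulrCA.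
by apply: wdom_cinteg; exact: wdom_phase.
Qed.

Local Notation TT := (n.-tuple (measurableTypeR R)).

Lemma measurable_dot2 : measurable_fun setT (fun p : TT * TT => dot (vec p.1) (vec p.2)).
Proof.
under eq_fun do rewrite /dot.
apply: measurable_sum => i; under eq_fun do rewrite !mxE.
apply: measurable_funM.
  exact: (measurableT_comp (measurable_tnth i) measurable_fst).
exact: (measurableT_comp (measurable_tnth i) measurable_snd).
Qed.

Lemma measurable_phase2 sg : measurable_fun setT (fun p : TT * TT => cos (sg * (2 * pi * dot (vec p.1) (vec p.2)))) /\
  measurable_fun setT (fun p : TT * TT => sin (sg * (2 * pi * dot (vec p.1) (vec p.2)))).
Proof.
have m : measurable_fun setT (fun p : TT * TT => sg * (2 * pi * dot (vec p.1) (vec p.2)) : R).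
  by do 2 apply: measurable_funM => //; exact: measurable_dot2.
by split; apply: measurableT_comp m; apply: continuous_measurable_fun;
  [exact: continuous_cos|exact: continuous_sin].
Qed.

(** Fubini for the kernel e^(2 pi i sg x.xi) f(x) g(xi).  All manipulations
    of double Fourier integrals reduce to this identity. *)
Lemma mult_formula sg f g : wdom 1 f -> wdom 1 g ->
  cintegral (fun xi => FT sg f xi * g xi) = cintegral (fun x => f x * FT sg g x).
Proof.
move=> df dg.
pose K (x y : 'rV[R]_n) : R[i] := cis (sg * (2 * pi * dot x y)) * (f x * g y).
have E1 xi : FT sg f xi * g xi = cintegral (fun x => K x xi).
  rewrite mulrC /FT -cintegralZ; last by apply: wdom_cinteg; exact: wdom_phase.
  by congr cintegral; apply/funext => x; rewrite /K; ring.
have E2 x : f x * FT sg g x = cintegral (fun y => K x y).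
  rewrite /FT -cintegralZ; last by apply: wdom_cinteg; exact: wdom_phase.
  by congr cintegral; apply/funext => y; rewrite /K (dotC y); ring.
under eq_fun do rewrite E1.
under [in RHS]eq_fun do rewrite E2.
have [mc ms] := measurable_phase2 sg.
move: df dg => [[rf jf] [C hC]] [[rg ig] [D hD]].
have mfst (h : 'rV[R]_n -> R) : continuous h -> measurable_fun setT (fun p : TT * TT => h (vec p.1)).
  by move=> ch; exact: (measurableT_comp (cont_measurable_vec ch) measurable_fst).
have msnd (h : 'rV[R]_n -> R) : continuous h -> measurable_fun setT (fun p : TT * TT => h (vec p.2)).
  by move=> ch; exact: (measurableT_comp (cont_measurable_vec ch) measurable_snd).
have mrf := mfst _ rf; have mjf := mfst _ jf; have mrg := msnd _ rg; have mig := msnd _ ig.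
have KC x y : normc (K x y) <= (C * D) * (wt x * wt y).
  rewrite /K !normcM normc_cis mul1r mulrACA.
  have := hC x; have := hD y; rewrite !expr1 => h1 h2.
  by rewrite ler_pM// normc_ge0.
rewrite !cintegralE; apply: eq_cplx => /=.
  apply/esym; apply: (@fubini_wt _ n (fun x y => complex.Re (K x y)) (C * D)); last first.
    by move=> x y; exact: le_trans (normc_Re _) (KC x y).
  under eq_fun do rewrite /K !ReM ImM /=.
  by apply: measurable_funB; apply: measurable_funM => //; [apply: measurable_funB|apply: measurable_funD]; exact: measurable_funM.
apply/esym; apply: (@fubini_wt _ n (fun x y => complex.Im (K x y)) (C * D)); last first.
  by move=> x y; exact: le_trans (normc_Im _) (KC x y).
under eq_fun do rewrite /K !ImM ReM /=.
by apply: measurable_funD; apply: measurable_funM => //; [apply: measurable_funD|apply: measurable_funB]; exact: measurable_funM.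
Qed.

End complex_integral.

(** * Smooth functions *)

Section smooth_functions.
Context (R : realType) (n : nat).
Implicit Types (f g : cfun R n) (F G : 'rV[R]_n -> R).
Local Notation e_ i := (delta_mx 0 i : 'rV[R]_n).

Let line_quotient F (a v : 'rV[R]_n) (t : R) :
  (fun h : R => h^-1 *: ((F \o shift (t *: v + a)) (h *: v) - F (t *: v + a))) =
  (fun h : R => h^-1 *: (((fun s : R => F (s *: v + a)) \o shift t) (h *: 1) - F (t *: v + a))).
Proof.
by apply/funext => h; rewrite /= scalerDl addrA (_ : h%:A = h)//; exact: mulr1.
Qed.

Lemma line_derivable F (a v : 'rV[R]_n) (t : R) :
  derivable F (t *: v + a) v = derivable (fun s : R => F (s *: v + a)) t 1.
Proof. by rewrite /derivable line_quotient. Qed.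

Lemma line_derive F (a v : 'rV[R]_n) (t : R) :
  'D_v F (t *: v + a) = 'D_1 (fun s : R => F (s *: v + a)) t.
Proof. by rewrite /derive line_quotient. Qed.

Lemma is_derive_line F (a v : 'rV[R]_n) (t l : R) :
  is_derive (t *: v + a) v F l <-> is_derive t 1 (fun s : R => F (s *: v + a)) l.
Proof.
split=> -[h1 h2]; apply: DeriveDef.
- by rewrite -line_derivable.
- by rewrite -line_derive.
- by rewrite line_derivable.
- by rewrite line_derive.
Qed.

Lemma is_derive_line0 F (a v : 'rV[R]_n) (l : R) :
  is_derive a v F l <-> is_derive (0 : R) 1 (fun s : R => F (s *: v + a)) l.
Proof. by rewrite -is_derive_line scale0r add0r. Qed.

(** A relational form of partial, which carries differentiability along. *)
Definition has_partial i f g := forall x,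
  is_derive x (e_ i) (ReF f) (ReF g x) /\ is_derive x (e_ i) (ImF f) (ImF g x).

Lemma has_partialE i f g : has_partial i f g -> partial i f = g.
Proof.
move=> h; apply/funext => x; rewrite /partial.
by have [[_ ->] [_ ->]] := h x; apply: eq_cplx.
Qed.

Lemma has_partial_derivable i f g x : has_partial i f g ->
  derivable (ReF f) x (e_ i) /\ derivable (ImF f) x (e_ i).
Proof. by move=> h; have [[? _] [? _]] := h x. Qed.

Lemma partialP i f :
  (forall x, derivable (ReF f) x (e_ i) /\ derivable (ImF f) x (e_ i)) ->
  has_partial i f (partial i f).
Proof. by move=> h x; have [h1 h2] := h x; split; apply: derivableP. Qed.

(** Smoothness quantifies over all iterated derivatives at once.  To prove it
    for a function, it is enough to find a class of continuous functions that
    contains it and is closed under partial derivatives. *)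
Lemma smooth_coind (P : set (cfun R n)) :
  (forall f, P f -> ccont f /\ forall i, exists2 g, has_partial i f g & P g) ->
  forall f, P f -> smooth f.
Proof.
move=> H f Pf l.
have Pl : P (foldr (@partial R n) f l).
  elim: l => //= i l IH; have [_ /(_ i)[g /has_partialE -> //]] := H _ IH.
have [cl hl] := H _ Pl; split=> // i x.
by have [g h _] := hl i; exact: has_partial_derivable h.
Qed.

Lemma smooth_ccont f : smooth f -> ccont f.
Proof. by move=> /(_ [::])[]. Qed.

Lemma smooth_has_partial f i : smooth f -> has_partial i f (partial i f).
Proof. by move=> /(_ [::])[_ h]; apply: partialP => x; exact: h. Qed.

Lemma smooth_partial f i : smooth f -> smooth (partial i f).
Proof. by move=> sf l; have := sf (rcons l i); rewrite foldr_rcons. Qed.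

#[local] Opaque smooth.

Lemma smooth_mderiv f alpha : smooth f -> smooth (mderiv alpha f).
Proof.
move=> sf; rewrite /mderiv; elim: (enum _) => [|i l IH]; first exact: sf.
rewrite [foldr _ _ _]/=; elim: (alpha i) => [|k IHk]; first exact: IH.
exact: (smooth_partial i IHk).
Qed.

Lemma has_partialD i f g f' g' : has_partial i f f' -> has_partial i g g' ->
  has_partial i (fun x => f x + g x) (fun x => f' x + g' x).
Proof.
move=> hf hg x; have [rf jf] := hf x; have [rg ig] := hg x.
rewrite /ReF /ImF /= ReD ImD.
by under eq_fun do rewrite ReD; under [X in _ /\ is_derive _ _ X _]eq_fun do rewrite ImD; split; exact: is_deriveD.
Qed.

Lemma is_deriveM' F G (x v : 'rV[R]_n) a b : is_derive x v F a -> is_derive x v G b ->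
  is_derive x v (fun y => F y * G y) (F x * b + G x * a).
Proof. exact: is_deriveM. Qed.

Lemma is_deriveD' F G (x v : 'rV[R]_n) a b : is_derive x v F a -> is_derive x v G b ->
  is_derive x v (fun y => F y + G y) (a + b).
Proof. exact: is_deriveD. Qed.

Lemma is_deriveB' F G (x v : 'rV[R]_n) a b : is_derive x v F a -> is_derive x v G b ->
  is_derive x v (fun y => F y - G y) (a - b).
Proof. exact: is_deriveB. Qed.

Lemma is_derive_lin (a b t : R) : is_derive t (1 : R) (fun s : R => s * a + b) a.
Proof.
have h := is_deriveD (is_deriveM (is_derive_id t (1 : R)) (is_derive_cst a t (1 : R))) (is_derive_cst b t (1 : R)).
by apply: (is_derive_eq h); rewrite addr0 /GRing.scale /= mulr0 add0r mulr1.
Qed.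

Lemma has_partialM i f g f' g' : has_partial i f f' -> has_partial i g g' ->
  has_partial i (fun x => f x * g x) (fun x => f' x * g x + f x * g' x).
Proof.
move=> hf hg x; have [rf jf] := hf x; have [rg ig] := hg x.
rewrite /ReF /ImF /= ReD ImD !ReM !ImM.
under eq_fun do rewrite ReM; under [X in _ /\ is_derive _ _ X _]eq_fun do rewrite ImM; split.
  apply: (is_derive_eq (is_deriveB' (is_deriveM' rf rg) (is_deriveM' jf ig))).
  by rewrite /ReF /ImF; ring.
apply: (is_derive_eq (is_deriveD' (is_deriveM' rf ig) (is_deriveM' jf rg))).
by rewrite /ReF /ImF; ring.
Qed.

Lemma has_partial_cst i z : has_partial i (fun=> z) (fun=> 0).
Proof. by move=> x; split; exact: is_derive_cst. Qed.

(** Finite sums of products of smooth functions: the class that Leibniz' rule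
    preserves, used for the smoothness of products. *)
Inductive product_span : cfun R n -> Prop :=
| span_mul f g : smooth f -> smooth g -> product_span (fun x => f x * g x)
| span_add f g : product_span f -> product_span g -> product_span (fun x => f x + g x).

Lemma smoothM f g : smooth f -> smooth g -> smooth (fun x => f x * g x).
Proof.
move=> sf sg; apply: (@smooth_coind product_span); last exact: span_mul.
move=> {f g sf sg} k; elim=> {k} [f g sf sg|f g _ [cf hf] _ [cg hg]].
  split; first by apply: ccontM; exact: smooth_ccont.
  move=> i; exists (fun x => partial i f x * g x + f x * partial i g x).
    by apply: has_partialM; exact: smooth_has_partial.
  exact: (span_add (span_mul (smooth_partial i sf) sg) (span_mul sf (smooth_partial i sg))).
split; first exact: ccontD.
move=> i; have [f' pf sf] := hf i; have [g' pg sg] := hg i.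
by exists (fun x => f' x + g' x); [exact: has_partialD|exact: span_add].
Qed.

Lemma smooth_cst z : smooth (fun _ : 'rV[R]_n => z).
Proof.
apply: (@smooth_coind [set f | exists z, f = fun=> z]); last by exists z.
move=> _ [w ->]; split; first exact: ccont_cst.
by move=> i; exists (fun=> 0); [exact: has_partial_cst|exists 0].
Qed.

Lemma has_partial_coord i j : has_partial i (fun x => (x 0 j)%:C%C) (fun=> ((i == j)%:R)%:C%C).
Proof.
move=> x; split; last exact: is_derive_cst.
apply/is_derive_line0; rewrite /ReF /=.
rewrite (_ : (fun _ => _) = (fun s : R => s * (i == j)%:R + x 0 j)); last first.
  by apply/funext => s; rewrite !mxE eqxx eq_sym.
exact: is_derive_lin.
Qed.

Lemma smooth_coord j : smooth (fun x : 'rV[R]_n => (x 0 j)%:C%C).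
Proof.
apply: (@smooth_coind [set f | smooth f \/ f = (fun x : 'rV[R]_n => (x 0 j)%:C%C)]); last by right.
move=> f [sf|->].
  split; first exact: smooth_ccont.
  by move=> i; exists (partial i f); [exact: smooth_has_partial|left; exact: smooth_partial].
split; first by apply: ccont_real; exact: coord_continuous.
move=> i; exists (fun=> ((i == j)%:R)%:C%C); first exact: has_partial_coord.
by left; exact: smooth_cst.
Qed.

Lemma has_partial_conj i f g : has_partial i f g ->
  has_partial i (fun x => (f x)^*%C) (fun x => (g x)^*%C).
Proof.
move=> h x; have [h1 h2] := h x.
have E1 (k : cfun R n) : ReF (fun x => (k x)^*%C) = ReF k.
  by apply/funext => y; rewrite /ReF; case: (k y).
have E2 (k : cfun R n) : ImF (fun x => (k x)^*%C) = - ImF k.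
  by apply/funext => y; rewrite /ImF fctE; case: (k y).
by rewrite !E1 !E2 fctE; split => //; exact: is_deriveN.
Qed.

Lemma smooth_conj f : smooth f -> smooth (fun x => (f x)^*%C).
Proof.
move=> sf; apply: (@smooth_coind [set g | exists2 f, smooth f & g = (fun x => (f x)^*%C)]); last by exists f.
move=> _ [g sg ->]; have [rg ig] := smooth_ccont sg; split.
  split=> x.
    by rewrite (_ : (fun _ => _) = (fun x => complex.Re (g x)))//; apply/funext => y; case: (g y).
  rewrite (_ : (fun _ => _) = (fun x => - complex.Im (g x))); last by apply/funext => y; case: (g y).
  exact: (continuousN (ig x)).
move=> i; exists (fun x => (partial i g x)^*%C).
  by apply: has_partial_conj; exact: smooth_has_partial.
exact: (ex_intro2 _ _ (partial i g) (smooth_partial i sg) erefl).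
Qed.

Lemma is_derive_affine F (x v : 'rV[R]_n) (a : R) b l : is_derive (a *: x + b) v F l ->
  is_derive x v (fun y => F (a *: y + b)) (a * l).
Proof.
move=> h; apply/is_derive_line0.
rewrite (_ : (fun _ => _) = (fun s => F (s *: v + (a *: x + b))) \o (fun s : R => s * a + 0)); last first.
  by apply/funext => s /=; congr F; rewrite addr0 scalerDr scalerA addrA mulrC.
rewrite mulrC; apply: is_derive1_comp; last exact: is_derive_lin.
by rewrite mul0r add0r; apply/is_derive_line0.
Qed.

Lemma smooth_affine f (a : R) b : smooth f -> smooth (fun x => f (a *: x + b)).
Proof.
move=> sf; apply: (@smooth_coind [set g | exists c f, smooth f /\ g = (fun x => c * f (a *: x + b))]); last first.
  by exists 1, f; split=> //; apply/funext => x; rewrite mul1r.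
move=> _ [c [g [sg ->]]]; split.
  apply: ccontM; first exact: ccont_cst.
  apply: (@ccont_comp _ _ _ (fun x : 'rV[R]_n => a *: x + b)); last exact: smooth_ccont.
  by move=> x; exact: (continuousD (@scaler_continuous _ _ a x) (@cst_continuous _ _ b x)).
move=> i; exists (fun x => (c * a%:C%C) * partial i g (a *: x + b)); last first.
  exact: (ex_intro _ (c * a%:C%C) (ex_intro _ (partial i g) (conj (smooth_partial i sg) erefl))).
have : has_partial i (fun x => g (a *: x + b)) (fun x => a%:C%C * partial i g (a *: x + b)).
  move=> x; have [h1 h2] := smooth_has_partial i sg (a *: x + b).
  rewrite /ReF /ImF ReM ImM /= mul0r subr0 mul0r addr0; split; exact: is_derive_affine.
move=> /(has_partialM (has_partial_cst i c)).
by under [X in has_partial _ _ X]eq_fun do rewrite mul0r add0r mulrA.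
Qed.

Lemma has_partial_phase i (sg : R) xi :
  has_partial i (fun x => cis (sg * (2 * pi * dot x xi)))
    (fun x => (0 +i* (sg * (2 * pi * xi 0 i)))%C * cis (sg * (2 * pi * dot x xi))).
Proof.
move=> x; pose th (s : R) : R := s * (sg * (2 * pi * xi 0 i)) + sg * (2 * pi * dot x xi).
have E s : sg * (2 * pi * dot (s *: e_ i + x) xi) = th s.
  by rewrite dotDl dotZl (dotC _ xi) dot_delta /th; ring.
have dth (s : R) : is_derive s (1 : R) th (sg * (2 * pi * xi 0 i)) by exact: is_derive_lin.
have th0 : th 0 = sg * (2 * pi * dot x xi) by rewrite /th mul0r add0r.
split; apply/is_derive_line0; rewrite /ReF /ImF /=.
  rewrite (_ : (fun _ => _) = cos \o th); last by apply/funext => s /=; rewrite E.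
  rewrite mul0r sub0r -th0.
  by apply: (is_derive_eq (is_derive1_comp (is_derive_cos (th 0)) (dth 0))); ring.
rewrite (_ : (fun _ => _) = sin \o th); last by apply/funext => s /=; rewrite E.
rewrite mul0r add0r -th0.
by apply: (is_derive_eq (is_derive1_comp (is_derive_sin (th 0)) (dth 0))); ring.
Qed.

Lemma smooth_phase (sg : R) xi : smooth (fun x : 'rV[R]_n => cis (sg * (2 * pi * dot x xi))).
Proof.
apply: (@smooth_coind [set g | exists c, g = (fun x => c * cis (sg * (2 * pi * dot x xi)))]); last first.
  by exists 1; apply/funext => x; rewrite mul1r.
move=> _ [c ->]; split; first by apply: ccontM; [exact: ccont_cst|exact: ccont_phase].
move=> i; exists (fun x => (c * (0 +i* (sg * (2 * pi * xi 0 i)))%C) * cis (sg * (2 * pi * dot x xi))); last by eexists.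
have := has_partialM (has_partial_cst i c) (has_partial_phase i sg xi).
by under [X in has_partial _ _ X]eq_fun do rewrite mul0r add0r mulrA.
Qed.

End smooth_functions.

(** * Derivatives and Fourier transforms *)

Section fourier_smooth.
Context (R : realType) (n : nat).
Implicit Types (f g k : cfun R n) (F G : 'rV[R]_n -> R).
Local Notation e_ i := (delta_mx 0 i : 'rV[R]_n).
#[local] Opaque smooth.

Lemma wt_ge0 (x : 'rV[R]_n) : 0 <= wt x. Proof. exact/ltW/wt_gt0. Qed.
Lemma wtX_ge0 (x : 'rV[R]_n) m : 0 <= wt x ^+ m. Proof. exact/exprn_ge0/wt_ge0. Qed.
#[local] Hint Resolve wt_ge0 wtX_ge0 : core.

Lemma csupport0 f x : ~ csupport f x -> f x = 0.
Proof. by move=> h; apply/eqP; apply: contra_notT h => fx; exact: subset_closure. Qed.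

Lemma partial_zero_open i f (U : set 'rV[R]_n) : open U -> (forall x, U x -> f x = 0) ->
  forall x, U x -> partial i f x = 0.
Proof.
move=> oU f0 x Ux; rewrite /partial.
have nU : \forall y \near x, f y = 0 by apply: filterS (open_nbhs_nbhs (conj oU Ux)) => y /f0.
have E1 : 'D_(e_ i) (ReF f) x = 0.
  rewrite (@near_eq_derive _ _ _ _ (cst 0)) ?derive_cst//.
  by apply: filterS nU => y; rewrite /ReF => ->.
have E2 : 'D_(e_ i) (ImF f) x = 0.
  rewrite (@near_eq_derive _ _ _ _ (cst 0)) ?derive_cst//.
  by apply: filterS nU => y; rewrite /ImF => ->.
by rewrite E1 E2.
Qed.

Lemma mderiv_zero_open alpha f (U : set 'rV[R]_n) : open U -> (forall x, U x -> f x = 0) ->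
  forall x, U x -> mderiv alpha f x = 0.
Proof.
move=> oU f0; rewrite /mderiv; elim: (enum _) => [//|i l IH].
rewrite [foldr _ _ _]/=; elim: (alpha i) => [//|m IHm].
exact: partial_zero_open oU IHm.
Qed.

Lemma csupport_open f : open (~` csupport f).
Proof. by apply: closed_openC; exact: closed_closure. Qed.

Lemma csupport_sub f (A : set 'rV[R]_n) : closed A -> (forall x, ~ A x -> f x = 0) ->
  csupport f `<=` A.
Proof.
move=> cA h; rewrite /csupport [A](closure_id A).1//; apply: closureS => x /=.
by apply: contraNP => /h ->.
Qed.

Lemma cc_sub f g : smooth g -> Cc_infty f -> (forall x, ~ csupport f x -> g x = 0) ->
  Cc_infty g.
Proof.
move=> sg [sf cf] h; split; first exact: sg.
apply: subclosed_compact cf _; first exact: closed_closure.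
by apply: csupport_sub => //; exact: closed_closure.
Qed.

Lemma cc_smooth f : Cc_infty f -> smooth f. Proof. by case. Qed.

Lemma cc_partial i f : Cc_infty f -> Cc_infty (partial i f).
Proof.
move=> cf; apply: (cc_sub (smooth_partial i (cc_smooth cf)) cf) => x.
by apply: partial_zero_open (@csupport_open f) _ _ => y; exact: csupport0.
Qed.

Lemma cc_mderiv alpha f : Cc_infty f -> Cc_infty (mderiv alpha f).
Proof.
move=> cf; apply: (cc_sub (smooth_mderiv alpha (cc_smooth cf)) cf) => x.
by apply: mderiv_zero_open (@csupport_open f) _ _ => y; exact: csupport0.
Qed.

Lemma cc_mul f g : smooth g -> Cc_infty f -> Cc_infty (fun x => g x * f x).
Proof.
move=> sg cf; apply: (cc_sub (smoothM sg (cc_smooth cf)) cf) => x /csupport0 ->.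
by rewrite mulr0.
Qed.

Lemma compact_wdom m f (A : set 'rV[R]_n) : ccont f -> compact A ->
  (forall x, ~ A x -> f x = 0) -> wdom m f.
Proof.
move=> cf cA f0; split=> //.
have [A0|/set0P A0] := eqVneq A set0.
  by exists 0 => x; rewrite mul0r f0 ?normc0// A0.
have [a aA ha] := EVT_max_rV A0 cA (continuous_subspaceT (ccont_normc cf)).
have [b bA hb] := EVT_min_rV A0 cA (continuous_subspaceT (@wt_continuous R n)).
exists (normc (f a) / wt b ^+ m) => x.
have [Ax|/f0 ->] := pselect (A x); last first.
  by rewrite normc0 mulr_ge0 ?divr_ge0 ?normc_ge0// exprn_ge0// ltW// wt_gt0.
rewrite mulrAC ler_pdivlMr ?exprn_gt0 ?wt_gt0//.
apply: ler_pM; rewrite ?normc_ge0 ?wtX_ge0//.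
  by apply: ha; rewrite inE.
by rewrite lerXn2r ?nnegrE//; apply: hb; rewrite inE.
Qed.

Lemma cc_rapid f : Cc_infty f -> rapid f.
Proof.
move=> cf m; apply: (@compact_wdom m f (csupport f)); last exact: csupport0.
  exact: smooth_ccont (cc_smooth cf).
by case: cf.
Qed.

Lemma coord_wt i (x : 'rV[R]_n) : `|x 0 i| * wt x <= 1.
Proof.
rewrite /wt (bigD1 i)//= mulrA -[leRHS]mulr1 ler_pM//.
- by rewrite mulr_ge0// ltW// wt1_gt0.
- by apply: prodr_ge0 => j _; rewrite ltW// wt1_gt0.
- rewrite ler_pdivrMr ?mul1r ?ltr_wpDr ?sqr_ge0//.
  rewrite -[x 0 i ^+ 2]real_normK ?num_real//; set t := `|_|.
  have : 0 <= (t - 2^-1) ^+ 2 by exact: sqr_ge0.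
  rewrite sqrrB expr2; lra.
- by apply: prodr_ile1 => j _; rewrite wt1_le1 ltW// wt1_gt0.
Qed.

(** Peetre's inequality for the product weight; coordinatewise it reads
    1 + (s + t)^2 <= 2 (1 + s^2) (1 + t^2). *)
Lemma wt_shift (x y : 'rV[R]_n) : wt x * wt y <= 2 ^+ n * wt (x + y).
Proof.
have -> : 2 ^+ n = \prod_(i < n) 2 :> R by rewrite prodr_const card_ord.
rewrite /wt -big_split/= -big_split/=.
apply: ler_prod => i _; rewrite mulr_ge0 ?(ltW (wt1_gt0 _))//= mxE.
set a := x 0 i; set b := y 0 i.
have p (t : R) : 0 < 1 + t ^+ 2 by rewrite ltr_wpDr// sqr_ge0.
rewrite -invfM ler_pdivlMr// ler_pdivrMl ?mulr_gt0//.
have : 0 <= (a - b) ^+ 2 by exact: sqr_ge0.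
have : 0 <= (a * b) ^+ 2 by exact: sqr_ge0.
rewrite sqrrB sqrrD exprMn; nra.
Qed.

Lemma wt_ge (x : 'rV[R]_n) : `|x| <= 1 -> 2 ^- n <= wt x.
Proof.
move=> /rV_norm_leP h; rewrite -exprVn.
have -> : 2^-1 ^+ n = \prod_(i < n) 2^-1 :> R by rewrite prodr_const card_ord.
apply: ler_prod => i _; rewrite invr_ge0 ler0n /= lef_pV2 ?posrE ?ltr_wpDr ?sqr_ge0//.
have := h ler01 i; rewrite -(ler_pXn2r (n:=2)) ?nnegrE//.
rewrite real_normK ?num_real// expr1n; lra.
Qed.

Lemma wdom_coord m i (c : R) f : wdom m.+1 f ->
  wdom m (fun x => (0 +i* (c * x 0 i))%C * f x).
Proof.
move=> [cf [C hC]]; split.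
  apply: ccontM => //; split=> x; first exact: cst_continuous.
  exact: (continuousM (@cst_continuous _ _ c x) (@coord_continuous _ _ _ 0 i x)).
exists (`|c| * C) => x; rewrite normcM.
have -> : normc (0 +i* (c * x 0 i))%C = `|c| * `|x 0 i|.
  by rewrite /normc /= expr0n add0r sqrtr_sqr normrM.
rewrite -!mulrA ler_wpM2l//.
apply: (le_trans (ler_wpM2l _ (hC x))) => //.
have C0 := wdom_cst_ge0 hC.
rewrite exprS mulrCA; apply: ler_wpM2l => //; rewrite mulrA -[leRHS]mul1r.
by apply: ler_wpM2r; [rewrite exprn_ge0// ltW// wt_gt0|exact: coord_wt].
Qed.

Lemma rapid_coord i (c : R) f : rapid f -> rapid (fun x => (0 +i* (c * x 0 i))%C * f x).
Proof. by move=> rf m; exact: wdom_coord. Qed.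

Lemma lipschitz1 (h dh : R -> R) (a b : R) : (forall x, is_derive x (1:R) h (dh x)) ->
  (forall x, `|dh x| <= 1) -> `|h a - h b| <= `|a - b|.
Proof.
move=> hd d1; wlog ab : a b / a <= b.
  move=> H; have [/H//|/ltW/H] := leP a b.
  by rewrite distrC (distrC b).
have ch : {within `[a, b], continuous h}.
  apply: continuous_subspaceT => x.
  by apply: differentiable_continuous; apply/derivable1_diffP; case: (hd x).
have [c _ E] := MVT_segment ab (fun x _ => hd x) ch.
by rewrite distrC (distrC a) E normrM -[leRHS]mul1r ler_wpM2r.
Qed.

Lemma normc_cisB (a b : R) : normc (cis a - cis b) <= 2 * `|a - b|.
Proof.
apply: (le_trans (normc_le _)); rewrite mulr_natl mulr2n /=; apply: lerD.
  apply: (@lipschitz1 cos (fun x => - sin x)) => x.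
  by rewrite normrN sin_max.
by apply: (@lipschitz1 sin cos) => x; rewrite cos_max.
Qed.

Lemma dot_wt (x z : 'rV[R]_n) : `|dot x z| * wt x <= n%:R * `|z|.
Proof.
have -> : n%:R * `|z| = \sum_(i < n) `|z| by rewrite sumr_const card_ord mulr_natl.
apply: (@le_trans _ _ (\sum_(i < n) `|x 0 i * z 0 i| * wt x)).
  rewrite -mulr_suml ler_wpM2r//; exact: ler_norm_sum.
apply: ler_sum => i _; rewrite normrM mulrAC -[leRHS]mul1r.
apply: ler_pM => //; first by rewrite mulr_ge0// ltW// wt_gt0.
  exact: coord_wt.
exact: ((rV_norm_leP z (normr_ge0 z)).1 (lexx _)).
Qed.

(** The phase is Lipschitz in xi with constant O(|x|), and one power of the
    weight absorbs the factor |x|. *)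
Lemma FT_lipschitz sg f : wdom 2 f -> exists K : R, forall xi eta,
  normc (FT sg f xi - FT sg f eta) <= K * `|xi - eta|.
Proof.
move=> df; have [cf [C hC]] := df; have C0 := wdom_cst_ge0 hC.
exists (2 * (2 * `|sg * (2 * pi)| * n%:R * C) * rint (@wt R n)) => xi eta.
have df1 : wdom 1 f by exact: wdom_le df.
rewrite [FT sg f eta]/FT -[- cintegral _]mulN1r -cintegralZ; last first.
  by apply: wdom_cinteg; exact: wdom_phase.
rewrite /FT -cintegralD; last 2 first.
- by apply: wdom_cinteg; exact: wdom_phase.
- by apply: wdom_cinteg; apply: wdomZ; exact: wdom_phase.
rewrite mulrAC -[X in _ <= X * _]mulrA.
apply: cintegral_bound => [|x].
  apply: ccontD; first by apply: ccontM => //; exact: ccont_phase.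
  by apply: ccontM; [exact: ccont_cst|apply: ccontM => //; exact: ccont_phase].
rewrite mulN1r -mulNr -mulrDl normcM.
apply: (@le_trans _ _ (2 * (`|sg * (2 * pi)| * `|dot x (xi - eta)|) * (C * wt x ^+ 2))).
  apply: ler_pM; rewrite ?normc_ge0//.
  apply: (le_trans (normc_cisB _ _)); rewrite ler_wpM2l// -normrM.
  by rewrite dotDr -(scaleN1r eta) dotZr le_eqVlt; apply/orP; left; apply/eqP; congr (`|_|); ring.
have h := dot_wt x (xi - eta).
have w0 := ltW (wt_gt0 x).
rewrite [leLHS](_ : _ = (2 * `|sg * (2 * pi)| * C * wt x) * (`|dot x (xi - eta)| * wt x)); last by ring.
rewrite [leRHS](_ : _ = (2 * `|sg * (2 * pi)| * C * wt x) * (n%:R * `|xi - eta|)); last by ring.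
by rewrite ler_wpM2l// !mulr_ge0.
Qed.

Lemma lipschitz_ccont f (K : R) : (forall x y, normc (f x - f y) <= K * `|x - y|) -> ccont f.
Proof.
move=> h.
have L (F : 'rV[R]_n -> R) : (forall x y, `|F x - F y| <= normc (f x - f y)) -> continuous F.
  move=> hF x; apply/(@cvgrPdist_le _ _ _ (nbhs x)) => e e0.
  have K1 : 0 < `|K| + 1 by rewrite ltr_wpDl.
  have : \forall y \near x, `|x - y| < e / (`|K| + 1).
    have := @nbhsx_ballx _ _ x (e / (`|K| + 1)); rewrite -ball_normE; apply.
    by rewrite divr_gt0.
  apply: filterS => y xy; apply: (le_trans (hF x y)); apply: (le_trans (h x y)).
  apply: (@le_trans _ _ ((`|K| + 1) * `|x - y|)).
    by rewrite ler_wpM2r// (le_trans (ler_norm K))// lerDl.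
  by rewrite mulrC -ler_pdivlMr// ltW.
split; apply: L => x y.
  by apply: le_trans (normc_Re _); rewrite ReD; case: (f y).
by apply: le_trans (normc_Im _); rewrite ImD; case: (f y).
Qed.

Lemma FT_ccont sg f : wdom 2 f -> ccont (FT sg f).
Proof. by move=> /(FT_lipschitz sg)[K /lipschitz_ccont]. Qed.

(** Differentiation under the integral sign, with a common majorant C wt on a
    neighbourhood of the parameter value 0. *)
Lemma rint_derive (F dF : R -> 'rV[R]_n -> R) (C : R) :
  (forall t, continuous (F t)) -> (forall t x, `|t| < 1 -> `|F t x| <= C * wt x) ->
  (forall t x, is_derive t (1:R) (fun s => F s x) (dF t x)) ->
  (forall t x, `|t| < 1 -> `|dF t x| <= C * wt x) ->
  is_derive (0 : R) (1 : R) (fun t => rint (F t)) (rint (dF 0)).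
Proof.
move=> cF FC hd dC.
have C0 : 0 <= C.
  rewrite -(pmulr_lge0 _ (wt_gt0 (0 : 'rV[R]_n))) (le_trans _ (FC 0 0 _))//.
  by rewrite normr0.
have I0 : `]-1, 1[%classic (0 : R) by rewrite /= in_itv/= ltrN10 ltr01.
have It (t : R) : `]-1, 1[%classic t -> `|t| < 1.
  by rewrite /= in_itv/= ltr_norml.
pose f t (y : n.-tuple (measurableTypeR R)) := F t (vec y).
have E t y : partial1of2 f t y = dF t (vec y).
  by rewrite partial1of2E; have [_ <-] := hd t (vec y).
have intf t : `]-1, 1[%classic t -> (lebesgue_tuple R n).-integrable setT (EFin \o f t).
  by move=> /It t1; apply: (@rinteg_le _ _ (F t) C) => // x; exact: FC.
have G0 y : 0 <= C * wt (vec y : 'rV[R]_n) by rewrite mulr_ge0// ltW// wt_gt0.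
have iG : (lebesgue_tuple R n).-integrable setT (EFin \o (fun y => C * wt (vec y : 'rV[R]_n))).
  by rewrite (_ : EFin \o _ = fun t => C%:E * (wt (vec t))%:E)%E//; exact: integrableZl (rinteg_wt _ _).
have df t y : `]-1, 1[%classic t -> [set: n.-tuple (measurableTypeR R)] y -> derivable (f ^~ y) t 1.
  by move=> _ _; case: (hd t (vec y)).
have Gub t y : `]-1, 1[%classic t -> [set: n.-tuple (measurableTypeR R)] y ->
    `|partial1of2 f t y| <= C * wt (vec y : 'rV[R]_n).
  by move=> /It t1 _; rewrite E; exact: dC.
have H := @cvg_differentiation_under_integral R _ _ (lebesgue_tuple R n) f setT
  measurableT 0 (-1) 1 I0 intf df _ G0 iG Gub.
have EL : (\int[lebesgue_tuple R n]_y (partial1of2 f 0 y) = rint (dF 0))%R.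
  by apply: eq_Rintegral => y _; rewrite E.
rewrite EL in H.
have H' : (fun h : R => h^-1 *: (((fun t => rint (F t)) \o shift 0) (h *: 1) - rint (F 0))) @ 0^' --> rint (dF 0).
  by move: H; under eq_fun do rewrite -[X in (X + 0)%R]scaler1.
split; first by apply/cvg_ex; exists (rint (dF 0)).
exact: cvg_lim H'.
Qed.

Lemma has_partial_FT i sg f : wdom 2 f ->
  has_partial i (FT sg f) (FT sg (fun x => (0 +i* (sg * (2 * pi) * x 0 i))%C * f x)).
Proof.
move=> df xi; have df1 : wdom 1 f by exact: wdom_le df.
pose K s x := cis (sg * (2 * pi * dot x (s *: e_ i + xi))) * f x.
pose dK s x := cis (sg * (2 * pi * dot x (s *: e_ i + xi))) * ((0 +i* (sg * (2 * pi) * x 0 i))%C * f x).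
have dg : wdom 1 (fun x => (0 +i* (sg * (2 * pi) * x 0 i))%C * f x) by exact: wdom_coord.
have [_ [C1 hC1]] := df1; have [_ [C2 hC2]] := dg.
pose C := Num.max C1 C2.
have KC s x : normc (K s x) <= C * wt x.
  rewrite /K normcM normc_cis mul1r (le_trans (hC1 x))// expr1 ler_wpM2r//.
  by rewrite /C le_max lexx.
have dKC s x : normc (dK s x) <= C * wt x.
  rewrite /dK normcM normc_cis mul1r (le_trans (hC2 x))// expr1 ler_wpM2r//.
  by rewrite /C le_max lexx orbT.
have cK s : ccont (K s) by apply: ccontM; [exact: ccont_phase|case: df].
have hK x : has_partial i (fun eta => cis (sg * (2 * pi * dot eta x)) * f x)
    (fun eta => ((0 +i* (sg * (2 * pi * x 0 i)))%C * cis (sg * (2 * pi * dot eta x))) * f x + cis (sg * (2 * pi * dot eta x)) * 0).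
  exact: (has_partialM (has_partial_phase i sg x) (has_partial_cst i (f x))).
have E (s : R) (x : 'rV[R]_n) : ((0 +i* (sg * (2 * pi * x 0 i)))%C * cis (sg * (2 * pi * dot (s *: e_ i + xi) x))) * f x + cis (sg * (2 * pi * dot (s *: e_ i + xi) x)) * 0 = dK s x :> R[i].
  rewrite /dK (dotC _ x) mulr0 addr0 -(mulrA sg (2 * pi)).
  by set u := (0 +i* _)%C; ring.
have E0 : (fun x => cis (sg * (2 * pi * dot x xi)) * ((0 +i* (sg * (2 * pi) * x 0 i))%C * f x)) = dK 0.
  by apply/funext => x; rewrite /dK scale0r add0r.
split; apply/is_derive_line0.
  rewrite (_ : ReF (FT sg _) xi = rint (fun x => complex.Re (dK 0 x))); last by rewrite -E0.
  apply: (@rint_derive (fun s x => complex.Re (K s x)) (fun s x => complex.Re (dK s x)) C).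
  - by move=> s; case: (cK s).
  - by move=> s x _; exact: le_trans (normc_Re _) (KC s x).
  - move=> s x; have [+ _] := hK x (s *: e_ i + xi).
    rewrite /ReF E => /is_derive_line; rewrite /K.
    by under [X in _ -> is_derive _ _ X _]eq_fun do rewrite dotC.
  - by move=> s x _; exact: le_trans (normc_Re _) (dKC s x).
rewrite (_ : ImF (FT sg _) xi = rint (fun x => complex.Im (dK 0 x))); last by rewrite -E0.
apply: (@rint_derive (fun s x => complex.Im (K s x)) (fun s x => complex.Im (dK s x)) C).
- by move=> s; case: (cK s).
- by move=> s x _; exact: le_trans (normc_Im _) (KC s x).
- move=> s x; have [_ +] := hK x (s *: e_ i + xi).
  rewrite /ImF E => /is_derive_line; rewrite /K.
  by under [X in _ -> is_derive _ _ X _]eq_fun do rewrite dotC.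
- by move=> s x _; exact: le_trans (normc_Im _) (dKC s x).
Qed.

(** Differentiating FT sg f multiplies f by a coordinate, and the transforms of
    rapidly decreasing functions are closed under this. *)
Lemma FT_smooth sg f : rapid f -> smooth (FT sg f).
Proof.
move=> rf; apply: (@smooth_coind _ _ [set g | exists2 f, rapid f & g = FT sg f]); last by exists f.
move=> _ [g rg ->]; split; first exact: FT_ccont (rg 2).
move=> i; eexists; first exact: has_partial_FT (rg 2).
by eexists; first exact: (rapid_coord i (sg * (2 * pi)) rg).
Qed.

(** The integral of F (x + t e_i) does not depend on t; differentiate it at
    t = 0. *)
Lemma rint_partial0 i F dF C : continuous F -> (forall x, `|F x| <= C * wt x) ->
  (forall x, is_derive x (e_ i) F (dF x)) -> (forall x, `|dF x| <= C * wt x) -> rint dF = 0.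
Proof.
move=> cF FC hd dC.
have C0 : 0 <= C.
  by rewrite -(pmulr_lge0 _ (wt_gt0 (0 : 'rV[R]_n))) (le_trans _ (FC 0)).
have W t x : `|t| < 1 -> C * wt (t *: e_ i + x) <= (C * 4 ^+ n) * wt x.
  move=> t1; rewrite -mulrA ler_wpM2l//.
  have h := wt_shift (t *: e_ i + x) (- (t *: e_ i)).
  rewrite addrAC subrr add0r in h.
  have h2 : 2 ^- n <= wt (- (t *: e_ i)).
    apply: wt_ge; rewrite normrN; apply/rV_norm_leP => // j; rewrite !mxE eqxx /=.
    by case: (j == i); rewrite ?mulr1 ?mulr0 ?normr0// ltW.
  have w0 := ltW (wt_gt0 (t *: e_ i + x)).
  rewrite (_ : 4 ^+ n = 2 ^+ n * 2 ^+ n :> R); last by rewrite -exprMn; congr (_ ^+ n); lra.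
  rewrite -mulrA -ler_pdivrMl ?exprn_gt0// mulrC; apply: le_trans h.
  exact: ler_wpM2l.
have h : is_derive (0 : R) (1 : R) (fun t => rint (fun x => F (t *: e_ i + x))) (rint (fun x => dF (0 *: e_ i + x))).
  apply: (@rint_derive _ (fun t x => dF (t *: e_ i + x)) (C * 4 ^+ n)).
  - move=> t x; apply: (@continuous_comp _ _ _ (fun x : 'rV[R]_n => t *: e_ i + x)); last exact: cF.
    exact: (continuousD (@cst_continuous _ _ (t *: e_ i) x) (fun A : set _ => id : nbhs x A -> nbhs x A)).
  - by move=> t x t1; exact: le_trans (FC _) (W t x t1).
  - by move=> t x; apply/is_derive_line; exact: hd.
  - by move=> t x t1; exact: le_trans (dC _) (W t x t1).
have E0 : (fun x => dF (0 *: e_ i + x)) = dF by apply/funext => x; rewrite scale0r add0r.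
have E1 : (fun t : R => rint (fun x => F (t *: e_ i + x))) = cst (rint F).
  apply/funext => t; have [_ /=] := rint_affine (t *: e_ i) (@ltr01 R) (rinteg_le cF FC).
  by rewrite expr1n invr1 mul1r => <-; congr rint; apply/funext => x; rewrite scale1r addrC.
rewrite E0 E1 in h.
by case: h => _ <-; rewrite derive_cst.
Qed.

Lemma cintegral_partial0 i f : Cc_infty f -> cintegral (partial i f) = 0.
Proof.
move=> cf; have [[c1 c2] [C1 h1]] := cc_rapid cf 1; have [_ [C2 h2]] := cc_rapid (cc_partial i cf) 1.
pose C := Num.max C1 C2.
have hC x : normc (f x) <= C * wt x.
  by rewrite (le_trans (h1 x))// expr1 ler_wpM2r// /C le_max lexx.
have hD x : normc (partial i f x) <= C * wt x.
  by rewrite (le_trans (h2 x))// expr1 ler_wpM2r// /C le_max lexx orbT.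
have hp := smooth_has_partial i (cc_smooth cf).
rewrite cintegralE; apply: eq_cplx => /=.
  apply: (@rint_partial0 i (ReF f) _ C) => // x.
  - exact: le_trans (normc_Re _) (hC x).
  - by case: (hp x).
  - exact: le_trans (normc_Re _) (hD x).
apply: (@rint_partial0 i (ImF f) _ C) => // x.
- exact: le_trans (normc_Im _) (hC x).
- by case: (hp x).
- exact: le_trans (normc_Im _) (hD x).
Qed.

(** Integration by parts: the integral of the i-th derivative of phase * f
    vanishes. *)
Lemma FT_partial i sg f : Cc_infty f ->
  FT sg (partial i f) = (fun xi => - (0 +i* (sg * (2 * pi) * xi 0 i))%C * FT sg f xi).
Proof.
move=> cf; apply/funext => xi.
have cg := cc_mul (smooth_phase sg xi) cf.
have := cintegral_partial0 i cg.
rewrite (has_partialE (has_partialM (has_partial_phase i sg xi) (smooth_has_partial i (cc_smooth cf)))).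
have d1 : wdom 1 (fun x => cis (sg * (2 * pi * dot x xi)) * f x) by exact: wdom_phase (cc_rapid cf 1).
rewrite cintegralD; last 2 first.
- apply: wdom_cinteg; under eq_fun do rewrite -mulrA; exact: wdomZ.
- by apply: wdom_cinteg; exact: wdom_phase (cc_rapid (cc_partial i cf) 1).
under [X in cintegral X + _]eq_fun do rewrite -mulrA.
rewrite cintegralZ; last exact: wdom_cinteg.
move/eqP; rewrite addrC addr_eq0 -/(FT sg (partial i f) xi) -/(FT sg f xi) => /eqP ->.
by rewrite mulNr; congr (- (_ * _)); congr (_ +i* _)%C; rewrite mulrA.
Qed.

End fourier_smooth.

(** * Schwartz functions and Fourier inversion up to a constant *)

Section inversion.
Context (R : realType) (n : nat).
Implicit Types (f g h : cfun R n) (F G : 'rV[R]_n -> R).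
Local Notation e_ i := (delta_mx 0 i : 'rV[R]_n).
#[local] Opaque smooth.
#[local] Hint Resolve wt_ge0 wtX_ge0 : core.

(** Expanding the product of the 1 + x_i^(2m) gives the monomials with exponent
    2m on a set J of coordinates and 0 elsewhere. *)
Definition even_index (m : nat) (J : {set 'I_n}) : multi_index n :=
  fun i => if i \in J then (2 * m)%N else 0%N.

Lemma onePsqrX_le (t : R) m : (1 + t ^+ 2) ^+ m <= 2 ^+ m * (1 + t ^+ (2 * m)).
Proof.
rewrite exprM; set u := t ^+ 2; have u0 : 0 <= u by exact: sqr_ge0.
have [u1|/ltW u1] := leP u 1.
  apply: (@le_trans _ _ (2 ^+ m)).
    by rewrite lerXn2r ?nnegrE ?addr_ge0//; lra.
  by rewrite ler_peMr ?exprn_ge0// lerDl exprn_ge0.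
apply: (@le_trans _ _ ((2 * u) ^+ m)).
  have u2 : 1 + u <= 2 * u by lra.
  by apply: lerXn2r => //; rewrite nnegrE; lra.
by rewrite exprMn ler_wpM2l ?exprn_ge0// lerDr.
Qed.

(** Bounds on finitely many monomials times f amount to a bound of f by a power
    of the weight. *)
Lemma monomials_wt f m (C : {set 'I_n} -> R) :
  (forall J x, `|monomial (even_index m J) x| * normc (f x) <= C J) ->
  forall x, normc (f x) <= (2 ^+ m) ^+ n * (\sum_J C J) * wt x ^+ m.
Proof.
move=> hC x.
have w0 : 0 < wt x ^+ m by rewrite exprn_gt0// wt_gt0.
rewrite -ler_pdivrMr//.
have E : (wt x ^+ m)^-1 <= (2 ^+ m) ^+ n * \sum_J `|monomial (even_index m J) x|.
  rewrite /wt -exprVn -prodfV -prodrXl.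
  under eq_bigr do rewrite invrK.
  apply: (@le_trans _ _ (\prod_(i < n) (2 ^+ m * (1 + x 0 i ^+ (2 * m))))).
    apply: ler_prod => i _; rewrite onePsqrX_le exprn_ge0//.
    by rewrite addr_ge0// sqr_ge0.
  rewrite big_split/= prodr_const card_ord; apply: ler_wpM2l; first by rewrite !exprn_ge0.
  under eq_bigr do rewrite addrC.
  rewrite bigA_distr; apply: ler_sum => J _.
  apply: (le_trans (ler_norm _)); rewrite le_eqVlt; apply/orP; left; apply/eqP; congr (`|_|).
  apply: eq_bigr => i _; rewrite /even_index; by case: (i \in J); rewrite /= ?expr0.
apply: (le_trans (ler_wpM2l (normc_ge0 _) E)).
rewrite mulrCA; apply: ler_wpM2l; first by rewrite !exprn_ge0.
rewrite mulr_sumr; apply: ler_sum => J _; rewrite mulrC; exact: hC.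
Qed.

Lemma mderiv0 f : mderiv (fun=> 0%N) f = f.
Proof. by rewrite /mderiv; elim: (enum _) => [//|i l IH]; rewrite [foldr _ _ _]/=. Qed.

Lemma schwartz_rapid f : schwartz f -> rapid f.
Proof.
move=> [sf hf] m; split; first exact: smooth_ccont sf.
pose C J := fine (seminorm (even_index m J) (fun=> 0%N) f).
exists ((2 ^+ m) ^+ n * (\sum_J C J)); apply: monomials_wt => J x.
have S : ((`|monomial (even_index m J) x| * normc (f x))%:E <= seminorm (even_index m J) (fun=> 0%N) f)%E.
  by apply: ereal_sup_ubound; exists x => //; rewrite mderiv0.
rewrite -lee_fin /C fineK//.
rewrite fin_real// (lt_le_trans _ S) ?ltNyr//=; exact: hf.
Qed.

Lemma seminorm_lty alpha beta f B :
  (forall x, `|monomial alpha x| * normc (mderiv beta f x) <= B) ->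
  (seminorm alpha beta f < +oo)%E.
Proof.
move=> hB; apply: (@le_lt_trans _ _ B%:E); last exact: ltry.
by apply: ub_ereal_sup => _ [x _ <-]; rewrite lee_fin.
Qed.

Lemma smooth_monomial alpha : smooth (fun x : 'rV[R]_n => (monomial alpha x)%:C%C).
Proof.
rewrite /monomial; elim: (index_enum _) => [|i l IH].
  rewrite (_ : (fun _ => _) = fun=> 1); first exact: (smooth_cst 1).
  by apply/funext => x; rewrite big_nil.
have X m : smooth (fun x : 'rV[R]_n => (x 0 i ^+ m)%:C%C).
  elim: m => [|m IHm]; first exact: (smooth_cst 1).
  rewrite (_ : (fun _ => _) = fun x : 'rV[R]_n => (x 0 i)%:C%C * (x 0 i ^+ m)%:C%C).
    exact (smoothM (@smooth_coord R n i) IHm).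
  by apply/funext => x; rewrite exprS rmorphM.
rewrite (_ : (fun _ => _) = fun x : 'rV[R]_n => (x 0 i ^+ alpha i)%:C%C * (\prod_(j <- l) x 0 j ^+ alpha j)%:C%C).
  exact (smoothM (X _) IH).
by apply/funext => x; rewrite big_cons rmorphM.
Qed.

Lemma rapid_bounded f : rapid f -> exists B, forall x, normc (f x) <= B.
Proof. by move=> /(_ 0%N)[_ [C hC]]; exists C => x; have := hC x; rewrite expr0 mulr1. Qed.

Lemma cc_schwartz f : Cc_infty f -> schwartz f.
Proof.
move=> cf; split; first exact: cc_smooth cf.
move=> alpha beta.
have [B hB] := rapid_bounded (cc_rapid (cc_mul (smooth_monomial alpha) (cc_mderiv beta cf))).
apply: (@seminorm_lty _ _ _ B) => x; have := hB x.
by rewrite normcM normc_real.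
Qed.

(** The class of transforms of test functions is closed under derivatives and
    under multiplication by coordinates, which makes all seminorms finite. *)
Definition FTcc (sg : R) : set (cfun R n) := [set g | exists2 k : cfun R n, Cc_infty k & g = FT sg k].

Lemma FTcc_partial sg g i : FTcc sg g -> FTcc sg (partial i g).
Proof.
move=> [k ck ->]; rewrite (has_partialE (has_partial_FT i sg (cc_rapid ck 2))).
eexists; last reflexivity.
apply: (cc_mul _ ck).
rewrite (_ : (fun _ => _) = fun x : 'rV[R]_n => (0 +i* (sg * (2 * pi)))%C * (x 0 i)%:C%C).
  exact (smoothM (smooth_cst _) (@smooth_coord R n i)).
by apply/funext => x; apply: eq_cplx; rewrite ?ReM ?ImM /= ?mul0r ?mulr0 ?subrr ?add0r ?addr0.
Qed.

Lemma FTcc_coord sg g i : sg != 0 -> FTcc sg g -> FTcc sg (fun x => (x 0 i)%:C%C * g x).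
Proof.
move=> sg0 [k ck ->].
pose c : R[i] := (0 +i* (sg * (2 * pi))^-1)%C.
exists (fun x => c * partial i k x).
  by apply: (cc_mul (smooth_cst c)); exact: cc_partial.
rewrite FTZ; last exact: cc_rapid (cc_partial i ck) 1.
rewrite FT_partial//; apply/funext => x; rewrite [RHS]mulrA; congr (_ * _).
have p0 : sg * (2 * pi) != 0 by rewrite mulf_neq0// mulf_neq0// ?gt_eqF// pi_gt0.
apply: eq_cplx; rewrite ?ReM ?ImM /=; last by ring.
move: p0; set u := sg * (2 * pi) => p0.
by rewrite mul0r sub0r mulrN opprK mulKf.
Qed.

Lemma FTcc_mderiv sg g beta : FTcc sg g -> FTcc sg (mderiv beta g).
Proof.
move=> h; rewrite /mderiv; elim: (enum _) => [//|i l IH].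
rewrite [foldr _ _ _]/=; elim: (beta i) => [//|m IHm].
exact: (FTcc_partial i IHm).
Qed.

Lemma FTcc_monomial sg g alpha : sg != 0 -> FTcc sg g -> FTcc sg (fun x => (monomial alpha x)%:C%C * g x).
Proof.
move=> sg0 h; rewrite /monomial; elim: (index_enum _) => [|i l IH].
  by under eq_fun do rewrite big_nil mul1r.
have X m g' : FTcc sg g' -> FTcc sg (fun x : 'rV[R]_n => (x 0 i ^+ m)%:C%C * g' x).
  move=> h'; elim: m => [|m IHm]; first by under eq_fun do rewrite expr0 mul1r.
  under eq_fun do rewrite exprS rmorphM -mulrA.
  exact: (FTcc_coord i sg0 IHm).
under eq_fun do rewrite big_cons rmorphM -mulrA.
exact: (X _ _ IH).
Qed.

Lemma FT_schwartz sg (k : cfun R n) : sg != 0 -> Cc_infty k -> schwartz (FT sg k).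
Proof.
move=> sg0 ck; split; first exact: FT_smooth (cc_rapid ck).
move=> alpha beta.
have h : FTcc sg (FT sg k) by exists k.
have [l cl E] := FTcc_monomial alpha sg0 (FTcc_mderiv beta h).
have [cl1 [C hC]] := cc_rapid cl 1.
have hC' x : normc (l x) <= C * wt x by have := hC x; rewrite expr1.
apply: (@seminorm_lty _ _ _ (2 * C * rint (@wt R n))) => x.
have := FT_bound sg cl1 hC' x.
by rewrite -E normcM normc_real.
Qed.

Lemma FT_rapid sg (k : cfun R n) : sg != 0 -> Cc_infty k -> rapid (FT sg k).
Proof. by move=> sg0 ck; exact/schwartz_rapid/FT_schwartz. Qed.

Lemma FT_dilate sg f (a : R) (z : 'rV[R]_n) : 0 < a -> wdom 1 f ->
  FT sg (fun x => f (a *: x)) (a *: z) = (a ^- n)%:C%C * FT sg f z.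
Proof.
move=> a0 df.
pose H x := cis (sg * (2 * pi * dot x z)) * f x.
have iH : cinteg H by apply: wdom_cinteg; exact: wdom_phase.
have [_ E] := cintegral_affine 0 a0 iH.
rewrite /FT -E; congr cintegral; apply/funext => x.
by rewrite /H addr0 dotZl dotZr.
Qed.

Lemma FT_modulate sg f (z y : 'rV[R]_n) :
  FT sg (fun x => cis (- sg * (2 * pi * dot x z)) * f x) y = FT sg f (y - z).
Proof.
rewrite /FT; congr cintegral; apply/funext => x; rewrite mulrA -cisD; congr (cis _ * _).
by rewrite dotDr -(scaleN1r z) dotZr; ring.
Qed.

Lemma wdom_bounded (m : nat) f g : ccont g -> (exists B, forall x, normc (g x) <= B) -> wdom m f -> wdom m (fun x => g x * f x).
Proof.
move=> cg [B hB]; apply: (@wdomM R n 0 m); split=> //.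
by exists B => x; rewrite expr0 mulr1.
Qed.

Lemma cc_bounded f : Cc_infty f -> exists2 M : R, 0 < M & forall x, M <= `|x| -> f x = 0.
Proof.
move=> [_ /compact_bounded [M [_ hM]]].
exists (`|M| + 2); first by rewrite ltr_wpDl.
move=> x Mx; apply: csupport0 => fx.
have M1 : M < `|M| + 1 by rewrite (le_lt_trans (ler_norm M))// ltrDl.
have := le_trans Mx (hM _ M1 _ fx).
by rewrite lerD2l => ?; lra.
Qed.

Lemma cc_of_bounded f M : smooth f -> (forall x, M <= `|x| -> f x = 0) -> Cc_infty f.
Proof.
move=> sf hM; split; first exact: sf.
apply: bounded_closed_compact; last exact: closed_closure.
exists M; split; first exact: num_real.
move=> N MN x fx; apply: contrapT => /negP; rewrite -ltNge => Nx.
have : csupport f `<=` ~` [set y | N < `|y|].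
  apply: csupport_sub.
    apply: open_closedC.
    rewrite (_ : [set y | _] = (fun y : 'rV[R]_n => `|y|) @^-1` [set t | N < t]); last by [].
    by apply: open_comp => [y _|]; [exact: norm_continuous|exact: open_gt].
  by move=> y /contrapT /ltW Ny; apply: hM; rewrite (le_trans _ Ny)// ltW.
by move=> /(_ _ fx).
Qed.

Lemma cc_affine f (a : R) (b : 'rV[R]_n) : 0 < a -> Cc_infty f -> Cc_infty (fun x => f (a *: x + b)).
Proof.
move=> a0 cf; have [M M0 hM] := cc_bounded cf.
apply: (@cc_of_bounded _ ((M + `|b|) / a)); first exact: smooth_affine a b (cc_smooth cf).
move=> x; rewrite ler_pdivrMr// => h; apply: hM.
rewrite -lerBrDr in h.
have : `|a *: x| - `|b| <= `|a *: x + b|.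
  by have := ler_normB (a *: x + b) b; rewrite addrK lerBlDr.
apply: le_trans; rewrite normrZ gtr0_norm//; lra.
Qed.

(* smoothed inversion formula *)
(** Both sides are the integral of h against the transform of
    e^(-2 pi i sg xi.x) gam (eps xi), which concentrates at x as eps tends
    to 0. *)
Lemma inversion_eps sg (gam h : cfun R n) (eps : R) x : sg != 0 -> 0 < eps ->
  Cc_infty gam -> wdom 1 h ->
  cintegral (fun xi => FT sg h xi * (cis (- sg * (2 * pi * dot xi x)) * gam (eps *: xi))) =
  cintegral (fun z => h (eps *: z + x) * FT sg gam z).
Proof.
move=> sg0 e0 cg dh.
have cge : Cc_infty (fun xi => gam (eps *: xi)).
  have -> : (fun xi => gam (eps *: xi)) = (fun xi => gam (eps *: xi + 0)) by apply/funext => xi; rewrite addr0.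
  exact: cc_affine.
have dge := cc_rapid cge 1.
rewrite (mult_formula sg dh); last exact: wdom_phase.
under eq_fun do rewrite FT_modulate.
have E y : FT sg (fun xi => gam (eps *: xi)) (y - x) = (eps ^- n)%:C%C * FT sg gam (eps^-1 *: (y - x)).
  rewrite -[in LHS](scale1r (y - x)) -[1](mulfV (lt0r_neq0 e0)) -scalerA FT_dilate//.
  exact: cc_rapid.
pose G y := h y * FT sg gam (eps^-1 *: (y - x)).
have dG : wdom 1 G.
  rewrite /G; have := @wdomM R n 1 0; apply; first exact: dh.
  have [cF [C hC]] := FT_rapid sg0 cg 0.
  split; last by exists C => y; have := hC (eps^-1 *: (y - x)); rewrite !expr0.
  have -> : (fun y => FT sg gam (eps^-1 *: (y - x))) = (fun y => FT sg gam (eps^-1 *: y + (eps^-1 *: - x))).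
    by apply/funext => y; rewrite scalerDr.
  apply: (ccont_comp _ cF) => y.
  exact: (continuousD (@scaler_continuous _ _ _ y) (@cst_continuous _ _ _ y)).
have [_ EG] := cintegral_affine x e0 (wdom_cinteg dG).
transitivity (cintegral (fun y => (eps ^- n)%:C%C * G y)).
  by congr cintegral; apply/funext => y; rewrite E /G mulrCA.
rewrite cintegralZ; last exact: wdom_cinteg.
rewrite -EG; congr cintegral; apply/funext => z.
by rewrite /G addrK scalerA mulVf ?gt_eqF// scale1r.
Qed.

Lemma normc_cvg_unique (u : (R[i]) ^nat) a b :
  normc (u k - a) @[k --> \oo] --> 0 -> normc (u k - b) @[k --> \oo] --> 0 -> a = b.
Proof.
move=> ha hb; apply/eqP; rewrite -subr_eq0; apply/eqP/normc_eq0/eqP.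
rewrite eq_le normc_ge0 andbT.
have h : normc (u k - a) + normc (u k - b) @[k --> \oo] --> 0 by rewrite -[0]addr0; exact: cvgD.
rewrite -(cvg_lim (@Rhausdorff R) h); apply: limr_ge; first exact: cvgP h.
apply: nearW => k; rewrite (_ : a - b = - (u k - a) + (u k - b)).
  by rewrite (le_trans (le_normcD _ _))// normcN.
by rewrite opprB addrA subrK.
Qed.

(** The limit eps -> 0 of the previous identity, along eps = 1/(k+1). *)
Lemma inversion_gam sg (gam h : cfun R n) x : sg != 0 -> Cc_infty gam -> wdom 1 h -> wdom 1 (FT sg h) ->
  gam 0 * FT (- sg) (FT sg h) x = h x * cintegral (FT sg gam).
Proof.
move=> sg0 cg dh dF.
pose e_ (k : nat) : R := k.+1%:R^-1.
have e0 k : 0 < e_ k by rewrite invr_gt0.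
have e1 k : e_ k <= 1 by rewrite invf_le1// ler1n.
have ecv : e_ k @[k --> \oo] --> 0 by exact: cvg_harmonic.
have zcv (z b : 'rV[R]_n) : e_ k *: z + b @[k --> \oo] --> b.
  rewrite -[X in _ --> X]add0r -[X in X + b](scale0r z).
  by apply: cvgD; [exact: cvgZl|exact: cvg_cst].
have ccv (f : cfun R n) (z b : 'rV[R]_n) (a : R[i]) : ccont f -> normc (a * f (e_ k *: z + b) - a * f b) @[k --> \oo] --> 0.
  move=> cf.
  have cB : ccont (fun y => a * f y - a * f b).
    apply: ccontD; first by apply: ccontM => //; exact: ccont_cst.
    exact: ccont_cst.
  have h1 : normc (a * f y - a * f b) @[y --> b] --> normc (a * f b - a * f b) by exact: (ccont_normc cB).
  have := cvg_comp _ _ (zcv z b) h1.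
  by rewrite subrr normc0.
pose f k xi := FT sg h xi * (cis (- sg * (2 * pi * dot xi x)) * gam (e_ k *: xi)).
pose g k z := h (e_ k *: z + x) * FT sg gam z.
have fg k : cintegral (f k) = cintegral (g k) by exact: inversion_eps.
have [Bg hBg] := rapid_bounded (cc_rapid cg).
have dG := FT_rapid sg0 cg.
have [cF [CF hCF]] := dF; have [ch [Ch hCh]] := dh; have [cG [CG hCG]] := dG 1%N.
have cgam : ccont gam := smooth_ccont (cc_smooth cg).
have L1 : normc (cintegral (f k) - gam 0 * FT (- sg) (FT sg h) x) @[k --> \oo] --> 0.
  rewrite [FT (- sg) _ _]/FT -cintegralZ; last by apply: wdom_cinteg; exact: wdom_phase.
  apply: (@cintegral_cvg0 R n _ _ (CF * Bg + normc (gam 0) * CF)).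
  - move=> k; apply: ccontM => //; apply: ccontM; first exact: ccont_phase.
    by apply: (ccont_comp _ cgam); exact: scaler_continuous.
  - by apply: ccontM; [exact: ccont_cst|apply: ccontM => //; exact: ccont_phase].
  - move=> k xi; rewrite /f !normcM normc_cis mul1r.
    have := hCF xi; rewrite expr1 => h1.
    have C0 := wdom_cst_ge0 hCF.
    apply: (@le_trans _ _ (CF * wt xi * Bg)).
      by apply: ler_pM; rewrite ?normc_ge0.
    rewrite mulrDl mulrAC lerDl !mulr_ge0 ?normc_ge0 ?wt_ge0//.
  - move=> xi; have := ccv gam xi 0 (FT sg h xi * cis (- sg * (2 * pi * dot xi x))) cgam.
    apply: cvg_trans; apply: near_eq_cvg; apply: nearW => k.
    by rewrite /f addr0; congr normc; ring.
have L2 : normc (cintegral (g k) - h x * cintegral (FT sg gam)) @[k --> \oo] --> 0.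
  rewrite -cintegralZ; last exact: wdom_cinteg.
  apply: (@cintegral_cvg0 R n _ _ (Ch * CG)).
  - move=> k; apply: ccontM => //; apply: (ccont_comp _ ch) => z.
    exact: (continuousD (@scaler_continuous _ _ _ z) (@cst_continuous _ _ _ z)).
  - by apply: ccontM => //; exact: ccont_cst.
  - move=> k z; rewrite /g normcM -mulrA; have := hCG z; rewrite expr1 => h1.
    apply: ler_pM; rewrite ?normc_ge0//.
    have C0 := wdom_cst_ge0 hCh.
    by apply: (le_trans (hCh _)); rewrite expr1 ler_piMr// wt_le1.
  - move=> z; have := ccv h z x (FT sg gam z) ch.
    by apply: cvg_trans; apply: near_eq_cvg; apply: nearW => k; rewrite /g !(mulrC (FT sg gam z)).
apply: (@normc_cvg_unique (fun k => cintegral (f k))) => //.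
by under eq_fun do rewrite fg.
Qed.

(** Some function of the dyadic partition is nonzero at some point; its squared
    modulus, recentred at that point and rescaled, is a bump. *)
Lemma bump_exists (phi : int -> cfun R n) (delta : R) : (0 < n)%N -> dyadic_partition phi -> 0 < delta ->
  exists gam : cfun R n, [/\ Cc_infty gam, forall x, delta <= `|x| -> gam x = 0,
    forall x, exists2 r : R, 0 <= r & gam x = r%:C%C & 0 < complex.Re (gam 0)].
Proof.
move=> n0 [cphi _ _ sumphi] d0.
pose xi : 'rV[R]_n := const_mx 1.
have xi0 : xi != 0.
  apply/eqP => /rowP/(_ (Ordinal n0)); rewrite !mxE => /eqP; exact/negP/oner_neq0.
have [j hj] : exists j, phi j xi != 0.
  apply: contrapT => H; have := sumphi xi xi0.
  rewrite fsbig1 => [/esym/eqP|j _]; first by exact/negP/oner_neq0.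
  by apply/eqP; apply: contrapT => /negP h; apply: H; exists j.
have cf := cphi j; set f := phi j in hj cf.
have [M M0 hM] := cc_bounded cf.
pose a := (M + `|xi|) / delta.
have a0 : 0 < a by rewrite divr_gt0// ltr_wpDr.
pose g x := (f (a *: x + xi))^*%C * f (a *: x + xi).
have sf := smooth_affine a xi (cc_smooth cf).
have cg : Cc_infty g.
  exact (cc_mul (smooth_conj sf) (cc_affine xi a0 cf)).
exists g; split => //.
- move=> x dx; rewrite /g hM ?mulr0//.
  have := ler_normB (a *: x + xi) xi; rewrite addrK normrZ gtr0_norm//.
  have : M + `|xi| <= a * `|x|.
    by rewrite -[leLHS](divfK (lt0r_neq0 d0)) ler_wpM2l// ltW.
  by move=> h1 h2; have := le_trans h1 h2; rewrite lerD2r.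
- move=> x; exists (normc (f (a *: x + xi)) ^+ 2); first by rewrite sqr_ge0.
  rewrite /g; case: (f _) => u v; rewrite /normc/= sqr_sqrtr ?addr_ge0 ?sqr_ge0//.
  by apply: eq_cplx; rewrite ?ReM ?ImM /=; ring.
- rewrite /g scaler0 add0r; move: hj; case: (f xi) => u v; rewrite eq_complex negb_and ReM /=.
  rewrite mulNr opprK -!expr2; case/orP => h.
    by rewrite ltr_pwDl ?sqr_ge0// lt_neqAle sqr_ge0 eq_sym sqrf_eq0 h.
  by rewrite ltr_wpDl ?sqr_ge0// lt_neqAle sqr_ge0 eq_sym sqrf_eq0 h.
Qed.

(** The constant of inversion is the integral of the transform of a bump gam
    divided by gam 0.  It does not vanish: if it
    did, the multiplication formula for gam and its transform would make the
    L^2 norm of the transform zero, whereas the transform at 0 is the integral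
    of gam, a positive number. *)
Lemma inversion (phi : int -> cfun R n) sg : (0 < n)%N -> dyadic_partition phi -> sg != 0 ->
  exists2 c : R[i], c != 0 & forall h, wdom 1 h -> wdom 1 (FT sg h) ->
    FT (- sg) (FT sg h) = (fun x => c * h x).
Proof.
move=> n0 hphi sg0.
have [gam [cg _ gr g0]] := bump_exists n0 hphi (@ltr01 R).
have gam0 : gam 0 != 0 by apply: contraTneq g0 => ->; rewrite ltxx.
pose c := cintegral (FT sg gam) / gam 0.
have dg := cc_rapid cg 1; have dG := FT_rapid sg0 cg 1.
have H h : wdom 1 h -> wdom 1 (FT sg h) -> FT (- sg) (FT sg h) = (fun x => c * h x).
  move=> dh dF; apply/funext => x; apply: (mulfI gam0).
  by rewrite inversion_gam// /c mulrA mulrC [in RHS]mulrCA mulfV// mulr1.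
exists c => //; apply/eqP => c0.
have gIm x : complex.Im (gam x) = 0 by have [r _ ->] := gr x.
have FTE xi : FT (- sg) gam xi = (FT sg gam xi)^*%C.
  have i1 : rinteg (ImF (fun x => cis (sg * (2 * pi * dot x xi)) * gam x)).
    by have [] := wdom_cinteg (wdom_phase sg xi dg).
  rewrite /FT /cintegral; apply: eq_cplx => /=.
    congr rint; apply/funext => x; rewrite /ReF !ReM gIm !mulr0 !subr0 /=.
    by rewrite mulNr cosN.
  rewrite -[RHS]mulN1r -rintZ//.
  congr rint; apply/funext => x; rewrite /ImF !ImM gIm !mulr0 !add0r /=.
  by rewrite mulNr sinN; ring.
have E := mult_formula (- sg) dG dg.
have L0 : cintegral (fun xi => FT (- sg) (FT sg gam) xi * gam xi) = 0.
  rewrite H// c0; under eq_fun do rewrite mul0r mul0r.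
  have := @cintegralZ R n 0 gam (wdom_cinteg dg); rewrite mul0r.
  by under eq_fun do rewrite mul0r.
rewrite L0 in E.
have [cG [CG hCG]] := dG.
have R0 : rint (fun x => normc (FT sg gam x) ^+ 2) = 0.
  transitivity (complex.Re (cintegral (fun x => FT sg gam x * FT (- sg) gam x))); last by rewrite -E.
  congr rint; apply/funext => x; rewrite /ReF FTE; case: (FT sg gam x) => u v.
  by rewrite /normc/= sqr_sqrtr ?addr_ge0 ?sqr_ge0//; ring.
have G0 : FT sg gam 0 = cintegral gam.
  rewrite /FT; congr cintegral; apply/funext => x.
  by rewrite -(scale0r x) dotZr mul0r !mulr0 cis0 mul1r.
have gpos : 0 < complex.Re (FT sg gam 0).
  rewrite G0 /=; apply: (@rint_gt0 R n (ReF gam) 0).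
  - by case: (dg) => -[].
  - by have [] := wdom_cinteg dg.
  - by move=> x; have [r r0 E1] := gr x; rewrite /ReF E1.
  - exact: g0.
have : 0 < rint (fun x => normc (FT sg gam x) ^+ 2).
  have cn := ccont_normc cG.
  have C2 : continuous (fun x => normc (FT sg gam x) ^+ 2).
    by move=> x; under eq_fun do rewrite expr2; exact: (continuousM (cn x) (cn x)).
  apply: (@rint_gt0 R n _ 0) => //.
  - apply: (@rinteg_le _ _ _ (CG ^+ 2)) => // x.
    rewrite ger0_norm ?sqr_ge0//; have := hCG x; rewrite expr1 => h.
    apply: (@le_trans _ _ ((CG * wt x) ^+ 2)).
      by rewrite lerXn2r ?nnegrE ?normc_ge0// (le_trans _ h) ?normc_ge0.
    by rewrite exprMn ler_wpM2l ?sqr_ge0// expr2 ler_piMr ?wt_ge0// wt_le1.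
  - by move=> x; rewrite exprn_ge0// normc_ge0.
  - by rewrite exprn_gt0// (lt_le_trans gpos)// (le_trans (ler_norm _))// normc_Re.
by rewrite R0 ltxx.
Qed.

End inversion.

(** * Dyadic blocks of regular distributions *)

Section blocks.
Context (R : realType) (n : nat).
Implicit Types (f g h psi : cfun R n).
#[local] Opaque smooth.
#[local] Hint Resolve wt_ge0 wtX_ge0 : core.

Definition regular h : functional R n := fun psi => cintegral (fun x => h x * psi x).

Lemma regular_dual h (X : set (cfun R n)) : X `<=` @schwartz R n -> wdom 1 h ->
  dual X (regular h).
Proof.
move=> Xs dh.
have dX psi : X psi -> wdom 1 (fun x => h x * psi x).
  by move=> /Xs/schwartz_rapid rpsi; exact: (@wdomM R n 1 0 _ _ dh (rpsi 0%N)).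
have lin (a : R[i]) psi chi : X psi -> X chi ->
    regular h (fun x => a * psi x + chi x) = a * regular h psi + regular h chi.
  move=> Xp Xc; rewrite /regular -cintegralZ; last exact/wdom_cinteg/dX.
  rewrite -cintegralD; last 2 first.
  - by apply: wdom_cinteg; apply: wdomZ; exact: dX.
  - exact/wdom_cinteg/dX.
  by congr cintegral; apply/funext => x; ring.
split=> // psi Xpsi e e0.
have [ch [C hC]] := dh; have C0 := wdom_cst_ge0 hC.
pose W := rint (@wt R n).
have W0 : 0 <= W by apply: rint_ge0.
have K0 : 0 < 2 * C * W + 1 by rewrite ltr_wpDl// !mulr_ge0.
exists 0%N, (e / (2 * C * W + 1)); split; first by rewrite divr_gt0.
move=> chi Xchi sc.
have := sc (fun=> 0%N) (fun=> 0%N).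
have md0 : (mdeg (fun _ : 'I_n => 0%N) <= 0)%N by rewrite /mdeg big1.
move=> /(_ md0 md0) slt.
have D x : normc (chi x - psi x) <= e / (2 * C * W + 1).
  rewrite -lee_fin; apply: (le_trans _ (ltW slt)).
  apply: ereal_sup_ubound; exists x => //.
  by rewrite mderiv0 /monomial big1 ?normr1 ?mul1r// => i _; rewrite expr0.
have -> : regular h chi - regular h psi = cintegral (fun x => h x * (chi x - psi x)).
  rewrite /regular -[- cintegral _]mulN1r -cintegralZ; last exact/wdom_cinteg/dX.
  rewrite -cintegralD; last 2 first.
  - exact/wdom_cinteg/dX.
  - by apply: wdom_cinteg; apply: wdomZ; exact: dX.
  by congr cintegral; apply/funext => x; ring.
apply: (@le_lt_trans _ _ (2 * (C * (e / (2 * C * W + 1))) * W)).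
  apply: cintegral_bound => [|x].
    apply: ccontM => //; apply: ccontD.
      by have [] := schwartz_rapid (Xs _ Xchi) 0.
    have := wdomZ (-1) (schwartz_rapid (Xs _ Xpsi) 0); move=> [+ _].
    by under eq_fun do rewrite mulN1r.
  rewrite normcM mulrAC; have := hC x; rewrite expr1 => h1.
  by apply: ler_pM; rewrite ?normc_ge0.
rewrite (_ : _ * W = e * ((2 * C * W) / (2 * C * W + 1))); last by ring.
by rewrite gtr_pMr// ltr_pdivrMr// mul1r ltrDl.
Qed.

Lemma regular_tempered h : wdom 1 h -> tempered (regular h).
Proof. by move=> dh; exact: regular_dual. Qed.

Lemma regular_tempered0 h : wdom 1 h -> tempered0 (regular h).
Proof. by move=> dh; apply: regular_dual => // psi []. Qed.

Definition Blk (phi h : cfun R n) : cfun R n := FT 1 (fun xi => phi xi * FT (-1) h xi).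

Let wdom_cc_FT sg phi f : Cc_infty phi -> wdom 2 f -> wdom 1 (fun xi => phi xi * FT sg f xi).
Proof.
move=> cphi df; have [cf [C hC]] := wdom_le (isT : (1 <= 2)%N) df.
have h := (cc_rapid cphi) 1%N.
rewrite (_ : (fun _ => _) = (fun xi => FT sg f xi * phi xi)); last by apply/funext => x; rewrite mulrC.
apply: wdom_bounded => //; first exact: FT_ccont.
exists (2 * C * rint (@wt R n)); exact: FT_bound.
Qed.

Lemma Blk_ccont phi h : Cc_infty phi -> rapid h -> ccont (Blk phi h).
Proof.
move=> cphi rh; apply: FT_ccont.
have [cf [C hC]] := rh 1%N.
rewrite (_ : (fun _ => _) = (fun xi => FT (-1) h xi * phi xi)); last by apply/funext => x; rewrite mulrC.
apply: wdom_bounded; [exact: FT_ccont (rh 2)| |exact: (cc_rapid cphi) 2%N].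
exists (2 * C * rint (@wt R n)); exact: FT_bound.
Qed.

Lemma Blk_bounded phi h : Cc_infty phi -> rapid h -> exists B, forall x, normc (Blk phi h x) <= B.
Proof.
move=> cphi rh; have [cf [C hC]] := wdom_cc_FT (-1) cphi (rh 2).
exists (2 * C * rint (@wt R n)) => y; exact: FT_bound.
Qed.

(** Two applications of the multiplication formula move both transforms from
    the test function to h. *)
Lemma Blk_pairing phi h psi : Cc_infty phi -> rapid h -> schwartz psi ->
  wdom 1 (fun x => Blk phi h x * psi x) /\
  inv_fourier_dist (mul_dist phi (fourier_dist (regular h))) psi =
    cintegral (fun x => Blk phi h x * psi x).
Proof.
move=> cphi rh /schwartz_rapid rpsi; split.
  by apply: wdom_bounded; [exact: Blk_ccont|exact: Blk_bounded|exact: rpsi].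
rewrite /inv_fourier_dist /mul_dist /fourier_dist /regular inv_fourierE fourierE.
rewrite -(mult_formula (-1) (rh 1)); last exact: wdom_cc_FT.
transitivity (cintegral (fun xi => (phi xi * FT (-1) h xi) * FT 1 psi xi)).
  by congr cintegral; apply/funext => x; ring.
by rewrite /Blk -(mult_formula 1)//; exact: wdom_cc_FT.
Qed.

(** If z f x0 had positive real part for some complex z, then so would its
    integral against a bump supported near x0.  Take z = 1, -1,
    i and -i. *)
Lemma du_bois_reymond (phi : int -> cfun R n) f : (0 < n)%N -> dyadic_partition phi ->
  ccont f -> (forall psi, Cc_infty psi -> cintegral (fun x => f x * psi x) = 0) ->
  forall x, f x = 0.
Proof.
move=> n0 hphi cf H x0.
suff K z : ~ (0 < complex.Re (z * f x0)).
  have k1 := K 1; have k2 := K (-1); have k3 := K (0 +i* -1)%C; have k4 := K (0 +i* 1)%C.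
  move: k1 k2 k3 k4; rewrite mulN1r mul1r; case: (f x0) => u v /=.
  rewrite /= !mul0r !sub0r !mulN1r !opprK !mul1r.
  by move=> a1 a2 a3 a4; apply: eq_cplx => /=; lra.
move=> zpos; pose G x := complex.Re (z * f x).
have cG : continuous G by have [] := ccontM (ccont_cst _ z) cf.
have [r r0 hr] : exists2 r : R, 0 < r & forall x, cube x0 r x -> 0 < G x.
  have /cvgr_gt h1 : G y @[y --> x0] --> G x0 by exact: cG.
  have /nbhs_ballP[r /= r0 hr] := h1 0 zpos.
  by exists r => // x xr; apply: hr; rewrite -ball_normE /= distrC.
have [gam [cg gs gr g0]] := bump_exists n0 hphi r0.
pose psi x := gam (1 *: x + - x0).
have cpsi : Cc_infty psi by exact: cc_affine.
have E : rint (fun x => G x * complex.Re (psi x)) = 0.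
  have dpsi : wdom 1 (fun x => f x * psi x).
    apply: (@compact_wdom _ _ _ _ (csupport psi)); last by move=> x /csupport0 ->; rewrite mulr0.
      by apply: ccontM => //; exact: smooth_ccont (cc_smooth cpsi).
    by case: cpsi.
  have := cintegralZ z (wdom_cinteg dpsi); rewrite H// mulr0 => /(congr1 (@complex.Re R)) /=.
  move=> <-; congr rint; apply/funext => x; rewrite /ReF mulrA [in RHS]ReM.
  by have [s _ Es] := gr (1 *: x + - x0); rewrite /psi Es /= mulr0 subr0.
have cP : ccont psi := smooth_ccont (cc_smooth cpsi).
have pE x : complex.Re (psi x) = 0 \/ (0 <= complex.Re (psi x) /\ 0 < G x).
  have [xr|xr] := ltP (`|x - x0|) r.
    right; split; last exact: hr.
    by have [s s0 Es] := gr (1 *: x + - x0); rewrite /psi Es.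
  by left; rewrite /psi scale1r gs.
have C2 : continuous (fun x => G x * complex.Re (psi x)).
  by move=> x; exact: (continuousM (cG x) (cP.1 x)).
suff : 0 < rint (fun x => G x * complex.Re (psi x)) by rewrite E ltxx.
apply: (@rint_gt0 R n _ x0) => //.
- have dG : wdom 1 (fun x => (G x)%:C%C * psi x).
    apply: (@compact_wdom _ _ _ _ (csupport psi)); last by move=> x /csupport0 ->; rewrite mulr0.
      by apply: ccontM; [exact: ccont_real|].
    by case: cpsi.
  have [+ _] := wdom_cinteg dG; congr rinteg; apply/funext => x.
  by rewrite /ReF ReM /= mul0r subr0.
- by move=> x; have [->|[p0 /ltW g0']] := pE x; rewrite ?mulr0// mulr_ge0.
- by rewrite mulr_gt0// /psi scale1r subrr.
Qed.

Lemma FT_opp sg f xi : FT (- sg) f xi = FT sg f (- xi).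
Proof.
rewrite /FT; congr cintegral; apply/funext => x.
by rewrite -(scaleN1r xi) dotZr; congr (cis _ * _); ring.
Qed.

(** The block of a distribution is chosen among the continuous functions that
    represent phi times its transform, for any tempered extension F.  Blk phi h
    is one of them.  Any two agree: for a test function psi, the function that
    F is applied to has a transform that vanishes near 0, as phi does; it lies in
    schwartz0, where F is prescribed; so their difference is orthogonal to
    all test functions. *)
Lemma LP_blockE (Phi : int -> cfun R n) phi h (r : R) : (0 < n)%N -> dyadic_partition Phi ->
  0 < r -> (forall x, `|x| < r -> phi x = 0) -> Cc_infty phi -> rapid h ->
  LP_block phi (regular h) = Blk phi h.
Proof.
move=> n0 hPhi r0 phi0 cphi rh.
rewrite /LP_block; set S := [set g | _].
have SB : S (Blk phi h).
  split; first exact: Blk_ccont.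
  exists (regular h); split=> //; first exact: regular_tempered.
  move=> psi spsi; have [d ->] := Blk_pairing cphi rh spsi.
  by split => //; have [] := wdom_cinteg d.
have [cg [F [tF eF fF]]] : S (xget (fun=> 0) S) by apply: (@xgetPex _ _ S); exists (Blk phi h).
set g := xget _ _ in cg fF *.
have N1 : (-1 : R) != 0 by rewrite oppr_eq0 oner_neq0.
have [c' c'0 inv'] := inversion n0 hPhi N1.
have D psi : Cc_infty psi -> cintegral (fun x => (g x - Blk phi h x) * psi x) = 0.
  move=> cpsi; have spsi := cc_schwartz cpsi.
  have [ig Eg] := fF psi spsi; have [dB EB] := Blk_pairing cphi rh spsi.
  have E : cintegral (fun x => g x * psi x) = cintegral (fun x => Blk phi h x * psi x).
    rewrite -Eg -EB /inv_fourier_dist /mul_dist /fourier_dist; apply: eF.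
    rewrite inv_fourierE fourierE.
    pose k xi := phi xi * FT 1 psi xi.
    have ck : Cc_infty k.
      have := cc_mul (FT_smooth 1 (cc_rapid cpsi)) cphi.
      by rewrite (_ : (fun _ => _) = k)//; apply/funext => x; rewrite mulrC.
    split; first exact: FT_schwartz.
    move=> alpha; rewrite fourierE.
    apply: (@mderiv_zero_open R n alpha _ (cube 0 r)); first exact: open_cube.
      move=> xi; rewrite /cube /= subr0 => xir.
      rewrite FT_opp -[FT 1 _ _]/(FT 1 (FT (-1) k) (- xi)).
      have := inv' k (cc_rapid ck 1) (FT_rapid N1 ck 1); rewrite opprK => ->.
      by rewrite /k phi0 ?normrN// mul0r mulr0.
    by rewrite /cube /= subr0 normr0.
  have d1 : cinteg (fun x => g x * psi x) by [].
  transitivity (cintegral (fun x => g x * psi x + (-1) * (Blk phi h x * psi x))).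
    by congr cintegral; apply/funext => x; ring.
  rewrite cintegralD//; last by apply: wdom_cinteg; exact: wdomZ.
  rewrite cintegralZ; last exact: wdom_cinteg.
  by rewrite E mulN1r subrr.
apply/funext => x; apply/eqP; rewrite -subr_eq0; apply/eqP.
apply: (du_bois_reymond n0 hPhi) D x; apply: ccontD => //.
have := ccontM (ccont_cst _ (-1)) (Blk_ccont cphi rh).
by under eq_fun do rewrite mulN1r.
Qed.

End blocks.

(** * Decay of the blocks *)

Section kernels.
Context (R : realType) (n : nat).
Implicit Types (f g h psi : cfun R n).
#[local] Opaque smooth.
#[local] Hint Resolve wt_ge0 wtX_ge0 : core.

(** The factor 2 pi |sg| is at least 1, and discarding it keeps the iteration
    over multi-indices free of constants. *)
Lemma FT_partial_ge i sg f (xi : 'rV[R]_n) : 1 <= `|sg| -> Cc_infty f ->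
  `|xi 0 i| * normc (FT sg f xi) <= normc (FT sg (partial i f) xi).
Proof.
move=> sg1 cf; rewrite FT_partial// normcM normcN.
have -> : normc (0 +i* (sg * (2 * pi) * xi 0 i))%C = `|sg * (2 * pi)| * `|xi 0 i|.
  by rewrite /normc /= expr0n add0r sqrtr_sqr normrM.
apply: ler_wpM2r; first exact: normc_ge0.
rewrite ler_peMl// normrM.
have p2 := pi_ge2 R.
have : 1 <= `|2 * pi : R| by rewrite ger0_norm; lra.
by move=> h; rewrite -[leLHS]mulr1; apply: ler_pM.
Qed.

Lemma FT_mderiv_ge alpha sg f xi : 1 <= `|sg| -> Cc_infty f ->
  `|monomial alpha xi| * normc (FT sg f xi) <= normc (FT sg (mderiv alpha f) xi).
Proof.
move=> sg1 cf; rewrite /monomial /mderiv -[\prod_(i < n) _](big_enum _ _ _ (fun i => xi 0 i ^+ alpha i)) /=.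
suff H (l : seq 'I_n) : Cc_infty (foldr (fun i g => iter (alpha i) (partial i) g) f l) /\
   `|\prod_(i <- l) xi 0 i ^+ alpha i| * normc (FT sg f xi) <=
    normc (FT sg (foldr (fun i g => iter (alpha i) (partial i) g) f l) xi).
  exact: (H _).2.
elim: l => [|i l [cl IH]]; first by rewrite big_nil normr1 mul1r.
rewrite big_cons [foldr _ _ _]/=.
elim: (alpha i) => [|m [cm IHm]]; first by rewrite expr0 mul1r.
split; first exact (cc_partial i cm).
apply: le_trans (FT_partial_ge i xi sg1 cm).
by rewrite exprS -mulrA normrM -mulrA ler_wpM2l.
Qed.

Lemma coord_euclid i (x : 'rV[R]_n) : `|x 0 i| <= euclid x.
Proof.
rewrite /euclid -sqrtr_sqr ler_wsqrtr// /dot (bigD1 i)//= -expr2 lerDl.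
by apply: sumr_ge0 => j _; rewrite -expr2 sqr_ge0.
Qed.

Lemma norm_euclid (x : 'rV[R]_n) : `|x| <= euclid x.
Proof. by apply/rV_norm_leP => [|i]; [exact: sqrtr_ge0|exact: coord_euclid]. Qed.

Lemma monomialZ alpha a (x : 'rV[R]_n) : monomial alpha (a *: x) = a ^+ mdeg alpha * monomial alpha x.
Proof.
rewrite /monomial /mdeg -prodrXr -big_split/=; apply: eq_bigr => i _.
by rewrite mxE exprMn.
Qed.

Lemma wt_ge5 (x : 'rV[R]_n) : `|x| <= 2 -> 5 ^- n <= wt x.
Proof.
move=> /rV_norm_leP h; rewrite -exprVn.
have -> : 5^-1 ^+ n = \prod_(i < n) 5^-1 :> R by rewrite prodr_const card_ord.
apply: ler_prod => i _; rewrite invr_ge0 ler0n /= lef_pV2 ?posrE ?ltr_wpDr ?sqr_ge0//.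
have := h ltac:(by []) i; rewrite -(ler_pXn2r (n:=2)) ?nnegrE//.
rewrite real_normK ?num_real//; lra.
Qed.

Lemma wtN (x : 'rV[R]_n) : wt (- x) = wt x.
Proof. by apply: eq_bigr => i _; rewrite mxE sqrrN. Qed.

(** The rescaled multiplier x |-> phi j (2^j x) is supported in |x| <= 2 and its
    derivatives are bounded uniformly in j, hence so are the monomials times
    its transform. *)
Lemma kernel_bound (phi : int -> cfun R n) m : dyadic_partition phi ->
  exists2 C : R, 0 <= C & forall j z,
    normc (FT (-1) (phi j) z) <= C * ((2 : R) ^ j) ^+ n * wt ((2 : R) ^ j *: z) ^+ m.
Proof.
move=> [cphi sphi dphi _].
pose W := rint (@wt R n).
have W0 : 0 <= W by exact: rint_ge0.
pose Mof alpha := sval (cid (dphi alpha)).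
have MP alpha j xi : (2 : R) ^ (j *+ mdeg alpha) * normc (mderiv alpha (phi j) xi) <= `|Mof alpha|.
  exact: le_trans (svalP (cid (dphi alpha)) j xi) (ler_norm _).
pose Cof J := 2 * (`|Mof (even_index m J)| * 5 ^+ n) * W.
exists ((2 ^+ m) ^+ n * (\sum_J Cof J)).
  by rewrite mulr_ge0 ?exprn_ge0// sumr_ge0// => J _; rewrite !mulr_ge0 ?exprn_ge0.
move=> j z; set a : R := 2 ^ j.
have a0 : 0 < a by rewrite exprz_gt0.
have a0' : 0 <= a := ltW a0.
have D alpha (y : 'rV[R]_n) : normc (FT (-1) (mderiv alpha (phi j)) y) <=
    a ^+ n * (2 * (`|Mof alpha| * 5 ^+ n / a ^+ mdeg alpha) * W).
  have cD := cc_mderiv alpha (cphi j).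
  have E := FT_dilate (-1) y a0 (cc_rapid cD 1).
  have -> : FT (-1) (mderiv alpha (phi j)) y = (a ^+ n)%:C%C * FT (-1) (fun x => mderiv alpha (phi j) (a *: x)) (a *: y).
    by rewrite E mulrA -rmorphM mulfV ?mul1r// expf_neq0// gt_eqF.
  rewrite normcM normc_real ger0_norm ?exprn_ge0//.
  apply: ler_wpM2l; first by rewrite exprn_ge0.
  apply: FT_bound => [|x].
    by apply: (ccont_comp _ (smooth_ccont (cc_smooth cD))); exact: scaler_continuous.
  have [xs|xs] := pselect (csupport (phi j) (a *: x)); last first.
    rewrite (@mderiv_zero_open R n alpha (phi j) _ (@csupport_open R n (phi j)))//.
      have nn : 0 <= `|Mof alpha| * 5 ^+ n / a ^+ mdeg alpha.
        by rewrite divr_ge0// ?mulr_ge0// exprn_ge0.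
      by rewrite normc0 mulr_ge0 ?wt_ge0.
    by move=> v; exact: csupport0.
  have /andP[_ x2] := sphi j _ xs.
  have x2' : `|x| <= 2.
    rewrite -(ler_pM2l a0) -[a in leLHS](ger0_norm a0') -normrZ (le_trans (norm_euclid _))//.
    by rewrite (le_trans x2)// expfzDr ?expr1z ?pnatr_eq0.
  (* the constant 5^n turns a bound on the support into a multiple of wt *)
  have w5 := wt_ge5 x2'.
  have h1 : normc (mderiv alpha (phi j) (a *: x)) <= `|Mof alpha| / a ^+ mdeg alpha.
    rewrite ler_pdivlMr ?exprn_gt0// mulrC; apply: le_trans (MP alpha j (a *: x)).
    rewrite le_eqVlt; apply/orP; left; apply/eqP; congr (_ * _).
    by rewrite -[j *+ _]mulr_natr natz -exprz_exp.
  apply: (le_trans h1).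
  rewrite -[leLHS]mulr1 [leRHS](_ : _ = `|Mof alpha| / a ^+ mdeg alpha * (5 ^+ n * wt x)); last by ring.
  apply: ler_wpM2l; first by rewrite mulr_ge0// invr_ge0 exprn_ge0.
  by rewrite mulrC -ler_pdivrMr ?exprn_gt0// mul1r.
have N1 : 1 <= `|-1 : R| by rewrite normrN1.
pose f y := (a ^- n)%:C%C * FT (-1) (phi j) (a^-1 *: y).
have Ef J y : `|monomial (even_index m J) y| * normc (f y) <= Cof J.
  have -> : y = a *: (a^-1 *: y) by rewrite scalerA mulfV ?scale1r ?gt_eqF.
  move: (a^-1 *: y) => u.
  rewrite /f scalerA mulVf ?gt_eqF// scale1r monomialZ normrM (ger0_norm (exprn_ge0 _ a0')).
  have an0 : 0 <= a ^- n by rewrite invr_ge0 exprn_ge0.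
  rewrite normcM normc_real (ger0_norm an0).
  have h1 := le_trans (FT_mderiv_ge (even_index m J) u N1 (cphi j)) (D (even_index m J) u).
  rewrite [leLHS](_ : _ = a ^+ mdeg (even_index m J) * a ^- n * (`|monomial (even_index m J) u| * normc (FT (-1) (phi j) u))); last by ring.
  apply: (le_trans (ler_wpM2l _ h1)); first by rewrite mulr_ge0 ?invr_ge0 ?exprn_ge0.
  rewrite /Cof le_eqVlt; apply/orP; left; apply/eqP.
  have an : a ^+ n != 0 by rewrite expf_neq0// gt_eqF.
  have am : a ^+ mdeg (even_index m J) != 0 by rewrite expf_neq0// gt_eqF.
  by field; rewrite an am.
have := monomials_wt Ef (a *: z).
rewrite /f scalerA mulVf ?gt_eqF// scale1r normcM normc_real ger0_norm ?invr_ge0 ?exprn_ge0//.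
by rewrite ler_pdivrMl ?exprn_gt0// => h; rewrite (le_trans h)// mulrA (mulrC (a ^+ n)).
Qed.

Lemma cintegral_bound_gen f (B : 'rV[R]_n -> R) : ccont f -> rinteg B ->
  (forall x, normc (f x) <= B x) -> normc (cintegral f) <= 2 * rint B.
Proof.
move=> [rf jf] iB hB.
have K (F : 'rV[R]_n -> R) : continuous F -> (forall x, `|F x| <= B x) -> `|rint F| <= rint B.
  move=> cF FB.
  have iF : rinteg F.
    apply: le_integrable iB => //.
      by apply/measurable_EFinP; exact: cont_measurable_vec.
    by move=> t _; rewrite /= lee_fin (le_trans (FB _))// ler_norm.
  apply: (le_trans (le_normr_Rintegral _ iF)) => //.
  by apply: le_Rintegral => //; exact: (integrable_norm iF).
rewrite cintegralE (le_trans (normc_le _))//= mulr_natl mulr2n.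
apply: lerD; apply: K => // x; apply: le_trans (hB x).
  exact: normc_Re.
exact: normc_Im.
Qed.

(** By the multiplication formula the block is a convolution with the transform
    of phi. *)
Lemma Blk_conv phi h x : Cc_infty phi -> wdom 1 h ->
  Blk phi h x = cintegral (fun y => h y * FT (-1) phi (y - x)).
Proof.
move=> cphi dh.
have d : wdom 1 (fun xi => cis (- (-1) * (2 * pi * dot xi x)) * phi xi).
  by apply: wdom_phase; exact: (cc_rapid cphi 1%N).
under eq_fun do rewrite -FT_modulate.
rewrite -(mult_formula (-1) dh d) /Blk /FT; congr cintegral; apply/funext => xi.
by rewrite opprK; set F := cintegral _; ring.
Qed.

Lemma wt_dilate_le (a b : R) (x : 'rV[R]_n) : 0 <= a -> a <= 2 * b -> wt (b *: x) <= 4 ^+ n * wt (a *: x).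
Proof.
move=> a0 ab.
have -> : 4 ^+ n = \prod_(i < n) 4 :> R by rewrite prodr_const card_ord.
rewrite /wt -big_split/=; apply: ler_prod => i _; rewrite (ltW (wt1_gt0 _))//= !mxE.
have p (t : R) : 0 < 1 + t ^+ 2 by rewrite ltr_wpDr// sqr_ge0.
rewrite ler_pdivlMr// ler_pdivrMl// !exprMn.
have : a ^+ 2 <= (2 * b) ^+ 2 by rewrite lerXn2r ?nnegrE// (le_trans a0).
have : 0 <= x 0 i ^+ 2 by exact: sqr_ge0.
rewrite exprMn; nra.
Qed.

(** Convolving a bump of width 1/A with a kernel of width 1/a, where A <= 2 a,
    yields a bump of width 1/A again, by Peetre's inequality. *)
Lemma Blk_bound m (phi h : cfun R n) (C1 C2 A a : R) x : Cc_infty phi -> rapid h ->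
  0 <= C1 -> 0 <= C2 -> 0 < A -> 0 < a -> A <= 2 * a ->
  (forall y, normc (h y) <= C1 * wt (A *: y) ^+ m) ->
  (forall z, normc (FT (-1) phi z) <= C2 * a ^+ n * wt (a *: z) ^+ m.+1) ->
  normc (Blk phi h x) <= 2 * (C1 * C2 * (8 ^+ n) ^+ m * rint (@wt R n)) * wt (A *: x) ^+ m.
Proof.
move=> cphi rh C10 C20 A0 a0 Aa hh hphi.
rewrite Blk_conv//.
have [iw Ew] := rint_affine (- (a *: x)) a0 (rinteg_wt R n).
pose D := C1 * C2 * (8 ^+ n) ^+ m * wt (A *: x) ^+ m * a ^+ n.
have iB : rinteg (fun y => D * wt (a *: y - a *: x)).
  by rewrite /rinteg; under eq_fun do rewrite EFinM; exact: integrableZl.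
have := @cintegral_bound_gen (fun y => h y * FT (-1) phi (y - x)) _ _ iB.
rewrite rintZ// Ew.
have -> : 2 * (C1 * C2 * (8 ^+ n) ^+ m * rint (wt (n:=n))) * wt (A *: x) ^+ m = 2 * (D * (a ^- n * rint (wt (n:=n)))).
  by rewrite /D; field; rewrite expf_neq0// gt_eqF.
apply.
  apply: ccontM; first by case: (rh 0%N).
  have cF : ccont (FT (-1) phi) := FT_ccont (-1) (cc_rapid cphi 2).
  by apply: (ccont_comp _ cF) => y; exact: (continuousD (fun A : set _ => id : nbhs y A -> nbhs y A) (@cst_continuous _ _ (- x) y)).
move=> y; rewrite normcM.
apply: (le_trans (ler_pM (normc_ge0 _) (normc_ge0 _) (hh y) (hphi (y - x)))).
have w1 : wt (A *: y) * wt (a *: (y - x)) <= 8 ^+ n * wt (A *: x).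
  have s := wt_shift (A *: y) (- (A *: (y - x))).
  have e : A *: y - A *: (y - x) = A *: x by rewrite -scalerBr opprB addrC subrK.
  rewrite e wtN in s.
  have dl := wt_dilate_le (y - x) (ltW A0) Aa.
  apply: (le_trans (ler_wpM2l (wt_ge0 _) dl)).
  rewrite mulrCA (_ : 8 ^+ n = 4 ^+ n * 2 ^+ n :> R); last by rewrite -exprMn; congr (_ ^+ n); lra.
  by rewrite -mulrA; apply: ler_wpM2l; first by rewrite exprn_ge0.
rewrite -scalerBr exprSr.
rewrite [leLHS](_ : _ = C1 * C2 * a ^+ n * wt (a *: (y - x)) * (wt (A *: y) * wt (a *: (y - x))) ^+ m); last by rewrite exprMn; ring.
rewrite [leRHS](_ : _ = C1 * C2 * a ^+ n * wt (a *: (y - x)) * (8 ^+ n * wt (A *: x)) ^+ m); last by rewrite /D exprMn; ring.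
apply: ler_wpM2l; first by rewrite !mulr_ge0 ?wt_ge0 ?exprn_ge0// ltW.
by rewrite lerXn2r ?nnegrE ?mulr_ge0 ?wt_ge0 ?exprn_ge0.
Qed.

(** * Functions with spectrum in a dyadic annulus *)

Section localized.
Variable (phi : int -> cfun R n).
Hypotheses (n0 : (0 < n)%N) (hphi : dyadic_partition phi).

Let cphi j : Cc_infty (phi j). Proof. by case: hphi. Qed.

(** The annulus is chosen so that it misses the supports of all phi j with
    j < l - 1 or j > l + 1. *)
Definition localized (l : int) h := [/\ rapid h, wdom 1 (FT (-1) h) &
  forall xi, FT (-1) h xi != 0 -> 3 / 4 * (2 : R) ^ l < euclid xi < 3 / 2 * (2 : R) ^ l].

Lemma dyadic_support j xi : phi j xi != 0 -> (2 : R) ^ (j - 1) <= euclid xi <= 2 ^ (j + 1).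
Proof. by case: hphi => _ sp _ _ h; apply: sp; exact: subset_closure. Qed.

Let exp2D (i j : int) : (2 : R) ^ (i + j) = 2 ^ i * 2 ^ j.
Proof. by rewrite expfzDr ?pnatr_eq0. Qed.

Lemma localized_support l h j xi : localized l h -> FT (-1) h xi != 0 -> phi j xi != 0 ->
  (l - 1 <= j <= l + 1)%R.
Proof.
move=> [_ _ H] /H/andP[h1 h2] /dyadic_support/andP[p1 p2].
have two : (1 : R) < 2 by rewrite ltr1n.
have l0 : 0 < (2 : R) ^ l by rewrite exprz_gt0.
apply/andP; split.
  have : (2 : R) ^ (l - 1) < 2 ^ (j + 1).
    apply: lt_le_trans p2; apply: lt_trans h1.
    by rewrite exp2D [X in _ * X](_ : _ = 2^-1)//; lra.
  by rewrite ltr_eXz2l//; lia.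
have : (2 : R) ^ (j - 1) < 2 ^ (l + 1).
  apply: le_lt_trans p1 _; apply: lt_trans h2 _.
  by rewrite exp2D expr1z; lra.
by rewrite ltr_eXz2l//; lia.
Qed.

Lemma Blk_far l h j : localized l h -> ~~ (l - 1 <= j <= l + 1)%R -> Blk (phi j) h = fun=> 0.
Proof.
move=> lh jl; rewrite /Blk.
have -> : (fun xi => phi j xi * FT (-1) h xi) = (fun xi => 0 * phi j xi).
  apply/funext => xi; apply/eqP; rewrite mul0r mulf_eq0; apply: contraT; rewrite negb_or => /andP[a b].
  by move: jl; rewrite (localized_support lh b a).
rewrite FTZ; last exact: (cc_rapid (cphi j) 1%N).
by apply/funext => x; rewrite mul0r.
Qed.

Lemma wdom_phi_FT j h : wdom 1 (FT (-1) h) -> wdom 1 (fun xi => phi j xi * FT (-1) h xi).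
Proof. by move=> d; exact: (@wdomM R n 0 1 _ _ (cc_rapid (cphi j) 0%N) d). Qed.

(** At most three terms of the partition of unity survive on the annulus. *)
Lemma dyadic_sum l xi : xi != 0 -> (forall j, phi j xi != 0 -> (l - 1 <= j <= l + 1)%R) ->
  phi (l - 1) xi + (phi l xi + phi (l + 1) xi) = 1.
Proof.
move=> xi0 H; case: hphi => _ _ _ /(_ xi xi0) <-.
have u : uniq [:: l - 1; l; l + 1] by rewrite /= !inE; lia.
rewrite (fsbigE [:: l - 1; l; l + 1] _ u) => [|//|j _ jr].
  by rewrite !big_cons big_nil !mem_setT /= addr0.
apply/eqP; apply: contraNT jr => /H; rewrite !inE; lia.
Qed.

(** The blocks add up to h, up to the constant of Fourier inversion. *)
Lemma reproducing : exists2 c : R[i], c != 0 & forall l h, localized l h -> forall x,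
   Blk (phi (l - 1)) h x + (Blk (phi l) h x + Blk (phi (l + 1)) h x) = c * h x.
Proof.
have N1 : (-1 : R) != 0 by rewrite oppr_eq0 oner_neq0.
have [c c0 inv] := inversion n0 hphi N1.
exists c => // l h lh x; have [rh dF _] := lh.
have := inv h (rh 1%N) dF; rewrite opprK => /(congr1 (fun f => f x)) <-.
have d j := wdom_phi_FT j dF.
have -> : FT 1 (FT (-1) h) x = FT 1 (fun xi => phi (l - 1) xi * FT (-1) h xi + (phi l xi * FT (-1) h xi + phi (l + 1) xi * FT (-1) h xi)) x.
  congr (FT 1 _ x); apply/funext => xi; rewrite -!mulrDl.
  have [->|Fxi] := eqVneq (FT (-1) h xi) 0; first by rewrite mulr0.
  rewrite dyadic_sum ?mul1r//.
    apply: contraNneq Fxi => xi0; have [_ _ H] := lh.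
    apply/eqP; apply: contrapT => /eqP /H /andP[+ _].
    have -> : euclid xi = 0.
      by rewrite xi0 /euclid /dot big1 ?sqrtr0// => i _; rewrite mxE mul0r.
    by rewrite ltNge mulr_ge0// exprz_ge0.
  by move=> j; exact: localized_support lh Fxi.
rewrite FTD//; last exact: wdomD.
by congr (_ + _); rewrite FTD.
Qed.

Lemma localizedD l f h : localized l f -> localized l h -> localized l (fun x => f x + h x).
Proof.
move=> [rf df Hf] [rh dh Hh]; split.
- by move=> m; exact: wdomD.
- by rewrite FTD//; exact: wdomD.
- move=> xi; rewrite FTD// => S.
  have [F0|/Hf//] := eqVneq (FT (-1) f xi) 0.
  by apply: Hh; move: S; rewrite F0 add0r.
Qed.

Lemma localizedZ l z h : localized l h -> localized l (fun x => z * h x).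
Proof.
move=> [rh dh Hh]; split.
- by move=> m; exact: wdomZ.
- by rewrite FTZ//; exact: wdomZ.
- move=> xi; rewrite FTZ// => S; apply: Hh.
  by apply: contraNneq S => ->; rewrite mulr0.
Qed.

Lemma BlkD j f h : rapid f -> rapid h -> wdom 1 (FT (-1) f) -> wdom 1 (FT (-1) h) ->
  Blk (phi j) (fun x => f x + h x) = (fun x => Blk (phi j) f x + Blk (phi j) h x).
Proof.
move=> rf rh df dh; rewrite /Blk FTD; [|exact: rf|exact: rh].
have d1 := wdom_phi_FT j df; have d2 := wdom_phi_FT j dh.
by rewrite -FTD//; congr FT; apply/funext => xi; rewrite mulrDr.
Qed.

Lemma BlkZ j z h : rapid h -> wdom 1 (FT (-1) h) ->
  Blk (phi j) (fun x => z * h x) = (fun x => z * Blk (phi j) h x).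
Proof.
move=> rh dh; rewrite /Blk FTZ; last exact: rh.
have d2 := wdom_phi_FT j dh.
by rewrite -FTZ//; congr FT; apply/funext => xi; rewrite mulrCA.
Qed.

End localized.

(** * Modulated dilates of a band-limited profile *)

Section atoms.
Variable (phi : int -> cfun R n).
Hypotheses (n0 : (0 < n)%N) (hphi : dyadic_partition phi).
Variable gam : cfun R n.
Hypotheses (cgam : Cc_infty gam) (gam_small : forall x, (4 * n%:R)^-1 <= `|x| -> gam x = 0).

Let i0 : 'I_n := Ordinal n0.
Definition profile : cfun R n := FT 1 gam.

(** Width 1/A, frequency L along the first axis.  The factor 1 keeps the phase
    in the form that occurs in FT. *)
Definition atom (A L : R) : cfun R n :=
  fun x => cis (1 * (2 * pi * dot x (L *: delta_mx 0 i0))) * profile (A *: x).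

Lemma profile_rapid : rapid profile.
Proof. by apply: FT_rapid => //; exact: oner_neq0. Qed.

Lemma wt_dilate_gen A (x : 'rV[R]_n) : 0 < A -> wt (A *: x) <= (1 + A ^- 2) ^+ n * wt x.
Proof.
move=> A0.
have -> : (1 + A ^- 2) ^+ n = \prod_(i < n) (1 + A ^- 2) :> R by rewrite prodr_const card_ord.
rewrite /wt -big_split/=; apply: ler_prod => i _; rewrite (ltW (wt1_gt0 _))//= !mxE.
have p (t : R) : 0 < 1 + t ^+ 2 by rewrite ltr_wpDr// sqr_ge0.
rewrite ler_pdivlMr// ler_pdivrMl// exprMn.
rewrite [leRHS](_ : _ = 1 + x 0 i ^+ 2 + A ^+ 2 * x 0 i ^+ 2 + A ^- 2); last by field; rewrite gt_eqF.
have a2 := sqr_ge0 A; have x2 := sqr_ge0 (x 0 i).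
have ai : 0 <= A ^- 2 by rewrite invr_ge0.
by rewrite -addrA lerDl; apply: addr_ge0 => //; exact: mulr_ge0.
Qed.

Lemma rapid_dilate A f : 0 < A -> rapid f -> rapid (fun x => f (A *: x)).
Proof.
move=> A0 rf m; have [cf [C hC]] := rf m; split.
  by apply: (ccont_comp _ cf); exact: scaler_continuous.
exists (C * ((1 + A ^- 2) ^+ n) ^+ m) => x.
have C0 := wdom_cst_ge0 hC.
have A2 : 0 <= 1 + A ^- 2 by rewrite addr_ge0// invr_ge0 sqr_ge0.
rewrite (le_trans (hC _))// -mulrA ler_wpM2l// -exprMn lerXn2r ?nnegrE ?wt_ge0//.
  by rewrite mulr_ge0 ?wt_ge0 ?exprn_ge0.
exact: wt_dilate_gen.
Qed.

Lemma atom_rapid A L : 0 < A -> rapid (atom A L).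
Proof. by move=> A0 m; apply: wdom_phase; exact: rapid_dilate A0 profile_rapid m. Qed.

Lemma atom_normc A L x : normc (atom A L x) = normc (profile (A *: x)).
Proof. by rewrite /atom normcM normc_cis mul1r. Qed.

(** A bump of width A around L e_1, up to the constant of inversion. *)
Lemma atom_FT : exists c : R[i], forall A L xi, 0 < A ->
  FT (-1) (atom A L) xi = (A ^- n)%:C%C * (c * gam (A^-1 *: (xi - L *: delta_mx 0 i0))).
Proof.
have o : (1 : R) != 0 by exact: oner_neq0.
have [c c0 inv] := inversion n0 hphi o.
exists c => A L xi A0.
have := FT_modulate (-1) (fun x => profile (A *: x)) (L *: delta_mx 0 i0) xi.
rewrite opprK -/(atom A L) => ->.
have -> : xi - L *: delta_mx 0 i0 = A *: (A^-1 *: (xi - L *: delta_mx 0 i0)).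
  by rewrite scalerA mulfV ?scale1r ?gt_eqF.
rewrite FT_dilate//; last exact: profile_rapid 1%N.
rewrite scalerA mulVf ?gt_eqF// scale1r /profile.
by rewrite (inv _ (cc_rapid cgam 1%N) (profile_rapid 1%N)).
Qed.

(** The bump has radius at most A / (4 n) <= 2^l / (4 n) in the sup norm, which
    keeps the Euclidean length between 3/4 2^l and 3/2 2^l. *)
Lemma atom_localized A l : 0 < A -> A <= (2 : R) ^ l -> localized l (atom A (2 ^ l)).
Proof.
move=> A0 Al; set L : R := 2 ^ l; have L0 : 0 < L by rewrite exprz_gt0.
have [c hc] := atom_FT.
have Ai : 0 < A^-1 by rewrite invr_gt0.
split; first exact: atom_rapid.
- have -> : FT (-1) (atom A L) = (fun xi => (A ^- n)%:C%C * (c * gam (A^-1 *: xi + A^-1 *: (- (L *: delta_mx 0 i0))))).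
    by apply/funext => xi; rewrite hc// scalerDr.
  by do 2 apply: wdomZ; exact: cc_rapid (cc_affine _ Ai cgam) 1%N.
move=> xi; rewrite -/L hc// => S.
set z := xi - L *: delta_mx 0 i0.
pose d : R := (4 * n%:R)^-1.
have nR : (1 : R) <= n%:R by rewrite ler1n.
have d0 : 0 < d by rewrite invr_gt0; lra.
have zd : `|z| < L * d.
  have : `|A^-1 *: z| < d.
    rewrite ltNge; apply: contraNN S => /gam_small ->; rewrite !mulr0; exact: eqxx.
  rewrite normrZ gtr0_norm// ltr_pdivrMl// => h; apply: (lt_le_trans h).
  by rewrite ler_wpM2r// ltW.
have zi i : `|xi 0 i - L * (i == i0)%:R| < L * d.
  have := (rV_norm_ltP z (le_lt_trans (normr_ge0 z) zd)).1 zd i.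
  by rewrite !mxE eqxx.
have d4 : d <= 4^-1 by rewrite lef_pV2 ?posrE; lra.
have nd : n%:R * d = 4^-1 by rewrite /d; field; rewrite gt_eqF// ltr0n.
have Ld : L * d <= L * 4^-1 by rewrite ler_wpM2l// ltW.
apply/andP; split.
  have h := zi i0; rewrite eqxx mulr1 in h.
  apply: lt_le_trans (coord_euclid i0 xi); apply: lt_le_trans (ler_norm _).
  move: h; rewrite ltr_norml => /andP[h _]; lra.
have b0 : 0 <= 3 / 2 * L by rewrite mulr_ge0// ltW.
rewrite /euclid -[ltRHS](ger0_norm b0) -sqrtr_sqr ltr_sqrt; last by rewrite exprn_gt0// mulr_gt0.
apply: (@le_lt_trans _ _ (\sum_(i < n) (L ^+ 2 * ((i == i0)%:R * (1 + 2 * d) + d ^+ 2)))).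
  apply: ler_sum => i _; rewrite -expr2 -real_normK ?num_real//.
  have hi : `|xi 0 i| <= L * ((i == i0)%:R + d).
    rewrite mulrDr -[xi 0 i](subrK (L * (i == i0)%:R)) (le_trans (ler_normD _ _))// addrC.
    rewrite lerD ?(ltW (zi i))// ger0_norm// mulr_ge0// ltW//.
  apply: (@le_trans _ _ ((L * ((i == i0)%:R + d)) ^+ 2)).
    by rewrite lerXn2r ?nnegrE// mulr_ge0 ?addr_ge0// ltW.
  by rewrite le_eqVlt; apply/orP; left; apply/eqP; case: (i == i0) => /=; ring.
rewrite -mulr_sumr big_split/= sumr_const card_ord -mulr_suml.
have -> : \sum_(i < n) (i == i0)%:R = 1 :> R.
  rewrite (bigD1 i0)//= [X in _ + X]big1; last by move=> i /negbTE ->.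
  exact: addr0.
have -> : d ^+ 2 *+ n = d * 4^-1 by rewrite -mulr_natl expr2 mulrA nd mulrC.
rewrite mul1r [ltRHS](_ : _ = L ^+ 2 * (9 / 4)); last by field.
by rewrite ltr_pM2l ?exprn_gt0//; lra.
Qed.

Lemma atom_Blk_bound m : exists2 C : R, 0 <= C & forall A l j x,
  0 < A -> A <= (2 : R) ^ l -> (l - 1 <= j <= l + 1)%R ->
  normc (Blk (phi j) (atom A (2 ^ l)) x) <= C * wt (A *: x) ^+ m.
Proof.
have [_ [C1 hC1]] := profile_rapid m.
have C10 := wdom_cst_ge0 hC1.
have [C2 C20 hC2] := kernel_bound m.+1 hphi.
exists (2 * (C1 * C2 * (8 ^+ n) ^+ m * rint (@wt R n))).
  rewrite !mulr_ge0 ?exprn_ge0//; apply: rint_ge0 => x; exact: wt_ge0.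
move=> A l j x A0 Al /andP[lj _].
have cphi : Cc_infty (phi j) by case: hphi.
have a0 : 0 < (2 : R) ^ j by rewrite exprz_gt0.
have Aj : A <= 2 * (2 : R) ^ j.
  apply: (le_trans Al); rewrite -[2 in leRHS]expr1z -expfzDr ?pnatr_eq0//.
  by rewrite ler_eXz2l ?ltr1n//; lia.
apply: (@Blk_bound m _ _ C1 C2 A _ x cphi (atom_rapid _ A0) C10 C20 A0 a0 Aj) => [y|z]; last exact: hC2.
by rewrite atom_normc.
Qed.

End atoms.
End kernels.

(** * Bounds for Lorentz norms *)

Section lorentz.
Context (R : realType) (n : nat).
Implicit Types (f g h : cfun R n) (u : 'rV[R]_n -> \bar R).
#[local] Opaque smooth.
Hypothesis n0 : (0 < n)%N.

Lemma volume_le (A B : set 'rV[R]_n) : open A -> open B -> A `<=` B -> (volume A <= volume B)%E.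
Proof.
move=> oA oB AB; apply: le_measure; rewrite ?inE; [exact: open_measurable_vec|exact: open_measurable_vec|].
by move=> t; exact: AB.
Qed.

(** The set where |u| exceeds a is contained in the cube of half-side
    (A / a)^(p / n), whose volume is exact. *)
Lemma lorentz_weak_upper u p A : 0 < p -> 0 < A ->
  (forall a : R, open [set x | (a%:E < `|u x|)%E]) ->
  (forall x, x != 0 -> (`|u x| <= (A * `|x| `^ (- (n%:R / p)))%:E)%E) ->
  (lorentz_norm p +oo u <= (2 `^ (n%:R / p) * A)%:E)%E.
Proof.
move=> p0 A0 ou hu; apply: ge_ereal_sup => _ [a /= + <-].
rewrite in_itv/= andbT => a0.
have nR : 0 < n%:R :> R by rewrite ltr0n.
have np0 : 0 < n%:R / p by rewrite divr_gt0.
have pn : p / n%:R * (n%:R / p) = 1 by rewrite mulrA divfK ?divff// gt_eqF.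
pose rho := (A / a) `^ (p / n%:R).
have Aa : 0 < A / a by rewrite divr_gt0.
have rho0 : 0 < rho by rewrite powR_gt0.
have rhop : rho `^ (n%:R / p) = A / a by rewrite /rho -powRrM pn powRr1// ltW.
have S : [set x | (a%:E < `|u x|)%E] `<=` cube 0 rho.
  move=> x /= ax; rewrite /cube /= subr0 ltNge; apply/negP => rx.
  have x0 : x != 0 by rewrite -normr_gt0 (lt_le_trans rho0).
  have := lt_le_trans ax (hu x x0); rewrite lte_fin ltNge => /negP; apply.
  have : `|x| `^ (- (n%:R / p)) <= rho `^ (- (n%:R / p)).
    rewrite !powRN lef_pV2 ?posrE ?powR_gt0 ?normr_gt0//.
    by apply: ge0_ler_powR; rewrite ?nnegrE//; exact: ltW.
  rewrite -(ler_pM2l A0) => /le_trans; apply.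
  by rewrite powRN rhop invf_div mulrCA divff ?mulr1// gt_eqF.
have V := volume_le (ou a) (@open_cube R n 0 rho) S.
rewrite volume_cube// in V.
apply: (@le_trans _ _ (a%:E * (((2 * rho) ^+ n)%:E `^ p^-1))%E).
  apply: lee_wpmul2l; first by rewrite lee_fin ltW.
  apply: gt0_ler_poweR => //; first by rewrite invr_ge0 ltW.
    by rewrite in_itv/= leey measure_ge0.
  by rewrite in_itv/= leey lee_fin exprn_ge0// mulr_ge0// ltW.
rewrite poweR_EFin -EFinM lee_fin -powR_mulrn; last by rewrite mulr_ge0// ltW.
rewrite -powRrM powRM//; last exact: ltW.
rewrite rhop mulrCA; apply: ler_wpM2l; first exact: powR_ge0.
by rewrite mulrCA divff ?mulr1// gt_eqF.
Qed.

(** Both sides are suprema over simple functions lying below the integrand.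
    Distribution functions are compared in this way, without any study of their
    measurability. *)
Lemma le_integral_nomeas d (T : measurableType d) (mu : {measure set T -> \bar R}) (D : set T) (f g : T -> \bar R) :
  (forall x, D x -> 0 <= f x)%E -> (forall x, D x -> f x <= g x)%E ->
  (\int[mu]_(x in D) f x <= \int[mu]_(x in D) g x)%E.
Proof.
move=> f0 fg.
have g0 x : D x -> (0 <= g x)%E by move=> Dx; exact: le_trans (f0 x Dx) (fg x Dx).
rewrite ge0_integralE// ge0_integralE//.
apply: ereal_sup_le => _ [h /= hf <-]; exists h => //= x.
apply: (le_trans (hf x)); rewrite !patchE; case: ifP => // xD.
by apply: fg; move: xD; rewrite inE.
Qed.

(** The integrand of the L^(p,1) norm is the distribution function to the power
    1/p, which the V_i bound below by a step function; each step contributes at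
    least eta. *)
Lemma lorentz_lower u p (N : nat) (lev V : nat -> R) eta :
  0 < p -> lev 0%N = 0 -> (forall i, lev i <= lev i.+1) -> (forall i, 0 <= V i) ->
  (forall i a, (i < N)%N -> lev i < a < lev i.+1 -> ((V i)%:E <= distr_fun u a)%E) ->
  (forall i, (i < N)%N -> eta <= (lev i.+1 - lev i) * V i `^ p^-1) ->
  ((p * (N%:R * eta))%:E <= lorentz_norm p 1%:E u)%E.
Proof.
move=> p0 l0 lS V0 hV he.
have lev_le i j : (i <= j)%N -> lev i <= lev j.
  by elim: j => [|j IH]; [rewrite leqn0 => /eqP ->|rewrite leq_eqVlt => /predU1P[-> //|/IH h]; exact: le_trans h (lS j)].
have lev0 i : 0 <= lev i by rewrite -l0 lev_le.
rewrite /lorentz_norm invr1 poweRe1; last first.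
  by apply: mule_ge0; [rewrite lee_fin ltW|apply: integral_ge0 => a; rewrite /= in_itv/= andbT => a0; rewrite mule_ge0 ?poweR_ge0// lee_fin invr_ge0 ltW].
rewrite EFinM; apply: lee_wpmul2l; first by rewrite lee_fin ltW.
pose w i := V i `^ p^-1.
have w0 i : 0 <= w i by exact: powR_ge0.
pose I i : set R := `]lev i, lev i.+1[%classic.
apply: (@le_trans _ _ (\int[lebesgue_measure]_(a in `]0%R, +oo[) (\sum_(i < N) (w i)%:E * (\1_(I i) a)%:E))%E); last first.
  apply: le_integral_nomeas => a /=; rewrite in_itv/= andbT => a0.
    by apply: sume_ge0 => i _; rewrite mule_ge0 ?lee_fin.
  have R0 : (0 <= (a%:E * distr_fun u a `^ p^-1) `^ 1 * (a^-1)%:E)%E.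
    by rewrite mule_ge0 ?poweR_ge0// lee_fin invr_ge0 ltW.
  have [[i Ii]|NI] := pselect (exists i : 'I_N, I i a); last first.
    rewrite big1// => i _; rewrite indicE memNset ?mule0// => Ii; apply: NI; by exists i.
  rewrite (bigD1 i)//= big1 => [|j ji]; last first.
    rewrite indicE memNset ?mule0// => Ij; move: Ii Ij; rewrite /I/= !in_itv/= => /andP[h1 h2] /andP[h3 h4].
    have : (i < j)%N || (j < i)%N by rewrite -neq_ltn eq_sym.
    case/orP => ij; have := lev_le _ _ ij => h; [move: (lt_trans h3 (lt_le_trans h2 h))|move: (lt_trans h1 (lt_le_trans h4 h))]; by rewrite ltxx.
  rewrite adde0 indicE mem_set// mule1 poweRe1; last by rewrite mule_ge0 ?poweR_ge0// lee_fin ltW.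
  rewrite muleAC -EFinM divff ?mul1e ?gt_eqF// /w -poweR_EFin.
  have hd : ((V i)%:E <= distr_fun u a)%E by apply: hV => //; move: Ii; rewrite /I/= in_itv.
  apply: gt0_ler_poweR => //; first by rewrite invr_ge0 ltW.
    by rewrite in_itv/= leey andbT lee_fin; exact: V0.
  by rewrite in_itv/= leey andbT (le_trans _ hd)// lee_fin.
rewrite ge0_integral_sum//; last first.
- by move=> i a _; rewrite mule_ge0 ?lee_fin.
- move=> i; apply: measurable_funeM; apply/measurable_EFinP; apply: measurable_indic; exact: measurable_itv.
rewrite mulr_natl -[N in X in (X <= _)%E]card_ord -sumr_const -sumEFin.
apply: lee_sum => i _.
rewrite ge0_integralZl_EFin//; last first.
- apply/measurable_EFinP; apply: measurable_indic; exact: measurable_itv.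
rewrite integral_indic//; last exact: measurable_itv.
have -> : I i `&` `]0%R, +oo[%classic = I i.
  apply/seteqP; split=> a; first by case.
  move=> Ia; split => //; move: Ia; rewrite /I/= !in_itv/= andbT => /andP[h _].
  exact: le_lt_trans (lev0 i) h.
have mI : (@lebesgue_measure R (I i) = if (lev i < lev i.+1)%R then (lev i.+1)%:E - (lev i)%:E else 0)%E.
  by rewrite /I lebesgue_measure_itv/= lte_fin.
rewrite [X in (_ * X)%E](_ : _ = if (lev i < lev i.+1)%R then (lev i.+1)%:E - (lev i)%:E else 0)%E; last exact: mI.
case: ifPn => [_|].
  by rewrite -EFinB -EFinM lee_fin mulrC; exact: he.
rewrite -leNgt => h; have e : lev i.+1 = lev i by apply/eqP; rewrite eq_le h lS.
by rewrite mule0 (le_trans (_ : (_ <= ((lev i.+1 - lev i) * w i)%:E)%E) _) ?lee_fin ?he// e subrr mul0r.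
Qed.

Lemma open_ereal_sup (I : Type) (F : I -> 'rV[R]_n -> \bar R) (a : R) :
  (forall i, open [set x | (a%:E < F i x)%E]) ->
  open [set x | (a%:E < ereal_sup (range (fun i => F i x)))%E].
Proof.
move=> oF; rewrite (_ : mkset _ = \bigcup_i [set x | (a%:E < F i x)%E]); first exact: bigcup_open.
apply/seteqP; split=> x /=.
  by move=> /ereal_sup_gt[_ [i _ <-]] h; exists i.
move=> [i _ h]; apply: (lt_le_trans h); apply: ereal_sup_ubound; by exists i.
Qed.

Lemma esum_ge_seq (T : choiceType) (b : T -> R) (r : seq T) : uniq r -> (forall j, 0 <= b j) ->
  ((\sum_(j <- r) b j)%:E <= \esum_(j in [set: T]) (b j)%:E)%E.
Proof.
move=> ur b0; rewrite -sumEFin; apply: ereal_sup_ubound.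
exists [set` r]; first by split => //; exact: finite_seq.
by rewrite -fsbig_seq.
Qed.
End lorentz.

(** * Triebel-Lizorkin-Lorentz norms of regular distributions *)

Section TLLregular.
Context (R : realType) (n : nat).
Implicit Types (f g h : cfun R n).
#[local] Opaque smooth.
Variables (phi : int -> cfun R n).
Hypothesis n0 : (0 < n)%N.
Hypothesis hphi : dyadic_partition phi.

(** The support of phi j lies in |x| >= 2^(j-1), and the Euclidean length is at
    most n times the sup norm. *)
Lemma dyadic_near0 j : exists2 r : R, 0 < r & forall x, `|x| < r -> phi j x = 0.
Proof.
have nR : 0 < n%:R :> R by rewrite ltr0n.
exists ((2 : R) ^ (j - 1) / n%:R); first by rewrite divr_gt0// exprz_gt0.
move=> x; rewrite ltr_pdivlMr// => hx; apply/eqP; apply: contraLR hx => /(dyadic_support hphi)/andP[h _].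
rewrite -leNgt (le_trans h)//.
have xn : 0 <= `|x| * n%:R by rewrite mulr_ge0// ltW.
rewrite /euclid -[leRHS](ger0_norm xn) -sqrtr_sqr ler_wsqrtr//.
apply: (@le_trans _ _ (\sum_(i < n) `|x| ^+ 2)).
  apply: ler_sum => i _; rewrite -expr2 -real_normK ?num_real// lerXn2r ?nnegrE//.
  exact: ((rV_norm_leP x (normr_ge0 x)).1 (lexx _) i).
rewrite sumr_const card_ord -[leLHS]mulr_natr exprMn; apply: ler_wpM2l; first exact: sqr_ge0.
by rewrite expr2 ler_peMl// ?ler1n// ltW.
Qed.

Lemma LP_block_regular j h : rapid h -> LP_block (phi j) (regular h) = Blk (phi j) h.
Proof.
by move=> rh; have [r r0 hr] := dyadic_near0 j; apply: (LP_blockE n0 hphi r0 hr _ rh); case: hphi.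
Qed.

Definition wblk (s : R) h (j : int) (x : 'rV[R]_n) : R :=
  2 `^ (j%:~R * s) * normc (Blk (phi j) h x).

Lemma wblk_ge0 s h j x : 0 <= wblk s h j x.
Proof. by rewrite mulr_ge0 ?powR_ge0// normc_ge0. Qed.

Lemma wblkE s h j x : normc ((2 `^ (j%:~R * s))%:C%C * Blk (phi j) h x) = wblk s h j x.
Proof. by rewrite normcM normc_real ger0_norm// powR_ge0. Qed.

Lemma wblk_continuous s h j : rapid h -> continuous (wblk s h j).
Proof.
move=> rh x; have cphi : Cc_infty (phi j) by case: hphi.
have cB := ccont_normc (Blk_ccont cphi rh).
exact: (continuousM (@cst_continuous _ _ (2 `^ (j%:~R * s)) x) (cB x)).
Qed.

Lemma TLL_norm_supE s p q h : rapid h -> TLL_norm phi s +oo p q (regular h) =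
  lorentz_norm p q (fun x => ereal_sup (range (fun j => (wblk s h j x)%:E))).
Proof.
move=> rh; rewrite /TLL_norm; congr lorentz_norm; apply/funext => x /=.
congr (ereal_sup _); apply: eq_imagel => j _; by rewrite LP_block_regular// wblkE.
Qed.

Lemma TLL_norm_sumE s p q h : rapid h -> TLL_norm phi s 1%:E p q (regular h) =
  lorentz_norm p q (fun x => \esum_(j in [set: int]) (wblk s h j x)%:E).
Proof.
move=> rh; rewrite /TLL_norm; congr lorentz_norm; apply/funext => x /=.
rewrite invr1 poweRe1; last by apply: esum_ge0 => j _; rewrite lee_fin powR_ge0.
by apply: eq_esum => j _; rewrite LP_block_regular// wblkE powRr1// wblk_ge0.
Qed.

Lemma open_gt_wblk s h j (a : R) : rapid h -> open [set x | (a%:E < (wblk s h j x)%:E)%E].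
Proof.
move=> rh; rewrite (_ : mkset _ = wblk s h j @^-1` [set y | a < y]); last by apply/funext => x; rewrite /= lte_fin.
by apply: open_comp; [move=> x _; exact: wblk_continuous|exact: open_gt].
Qed.

Lemma open_gt_sum_wblk s h (r : seq int) (a : R) : rapid h ->
  open [set x | (a%:E < (\sum_(j <- r) wblk s h j x)%:E)%E].
Proof.
move=> rh; rewrite (_ : mkset _ = (fun x => \sum_(j <- r) wblk s h j x) @^-1` [set y | a < y]); last by apply/funext => x; rewrite /= lte_fin.
apply: open_comp; last exact: open_gt.
by move=> x _; apply: continuous_big_sum => j; exact: wblk_continuous.
Qed.

Lemma open_gt_esum_wblk s h (a : R) : rapid h ->
  open [set x | (a%:E < \esum_(j in [set: int]) (wblk s h j x)%:E)%E].
Proof.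
move=> rh; rewrite (_ : mkset _ = \bigcup_(r in [set r : seq int | uniq r])
   [set x | (a%:E < (\sum_(j <- r) wblk s h j x)%:E)%E]).
  by apply: bigcup_open => r _; exact: open_gt_sum_wblk.
apply/seteqP; split=> x /=.
  move=> /ereal_sup_gt[_ [A [fA _] <-]]; rewrite fsbig_finite// sumEFin => h1.
  by exists (finmap.enum_fset (fset_set A)) => //=; exact: finmap.fset_uniq.
move=> [r ur h1]; apply: (lt_le_trans h1); apply: esum_ge_seq => // j; exact: wblk_ge0.
Qed.

Lemma TLL_upper s p A h : rapid h -> 0 < p -> 0 < A ->
  (forall j x, x != 0 -> wblk s h j x <= A * `|x| `^ (- (n%:R / p))) ->
  (TLL_norm phi s +oo p +oo (regular h) <= (2 `^ (n%:R / p) * A)%:E)%E.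
Proof.
move=> rh p0 A0 hA; rewrite TLL_norm_supE//.
have u0 x : (0 <= ereal_sup (range (fun j => (wblk s h j x)%:E)))%E.
  apply: (@le_trans _ _ (wblk s h 0 x)%:E); first by rewrite lee_fin wblk_ge0.
  by apply: ereal_sup_ubound; exists 0.
apply: lorentz_weak_upper => //.
- move=> a; under eq_set do rewrite gee0_abs//.
  by apply: open_ereal_sup => j; exact: open_gt_wblk.
- move=> x x0; rewrite gee0_abs//; apply: ge_ereal_sup => _ [j _ <-].
  by rewrite lee_fin hA.
Qed.

(** The form in which lower bounds are used: on N cubes of arbitrary position
    the blocks sum to kappa lam_i, where the lam_i at least double and the
    volumes are such that lam_i |cube_i|^(1/p) >= V.  Doubling makes
    lam_i - lam_(i-1) comparable to lam_i, so every level contributes the same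
    amount to the L^(p,1) norm, however the cubes overlap. *)
Lemma TLL_lower s p h (N : nat) (lam rho : nat -> R) (b : nat -> 'rV[R]_n) (V kappa : R) :
  rapid h -> 0 < p -> 0 <= kappa -> 0 <= V -> (forall i, 0 < lam i) -> (forall i, 2 * lam i <= lam i.+1) ->
  (forall i, 0 < rho i) -> (forall i, V <= lam i * ((2 * rho i) ^+ n) `^ p^-1) ->
  (forall i x, (i < N)%N -> cube (b i) (rho i) x ->
     exists2 r : seq int, uniq r & kappa * lam i <= \sum_(j <- r) wblk s h j x) ->
  ((p * (N%:R * (kappa * V / 2)))%:E <= TLL_norm phi s 1%:E p 1%:E (regular h))%E.
Proof.
move=> rh p0 k0 V0 lam0 lamS rho0 hV hx; rewrite TLL_norm_sumE//.
have l2 i : lam i <= lam i.+1 by have := lamS i; have := lam0 i; lra.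
have u0 x : (0 <= \esum_(j in [set: int]) (wblk s h j x)%:E)%E.
  by apply: esum_ge0 => j _; rewrite lee_fin wblk_ge0.
pose lev (i : nat) : R := if i is i'.+1 then kappa * lam i' else 0.
apply: (@lorentz_lower _ _ _ _ N lev (fun i => (2 * rho i) ^+ n)) => //.
- case=> [|i] /=; first by rewrite mulr_ge0// ltW.
  by rewrite ler_wpM2l.
- by move=> i; rewrite exprn_ge0// mulr_ge0// ltW.
- move=> i a iN /andP[_ ai]; rewrite -(volume_cube (b i) (rho0 i)).
  rewrite /distr_fun; apply: volume_le => //; first exact: open_cube.
    by under eq_set do rewrite gee0_abs//; exact: open_gt_esum_wblk.
  move=> x bx /=; rewrite gee0_abs//; have [r ur hr] := hx _ _ iN bx.
  apply: (@lt_le_trans _ _ (\sum_(j <- r) wblk s h j x)%:E); first by rewrite lte_fin (lt_le_trans ai).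
  by apply: esum_ge_seq => // j; exact: wblk_ge0.
- move=> i iN; have hi : kappa * lam i / 2 <= lev i.+1 - lev i.
    case: i {iN} => [|i] /=; first by rewrite subr0; have := mulr_ge0 k0 (ltW (lam0 0%N)); lra.
    have := ler_wpM2l k0 (lamS i); lra.
  apply: le_trans (ler_wpM2r (powR_ge0 _ _) hi).
  have := ler_wpM2l k0 (hV i); rewrite mulrA => h1.
  rewrite mulrAC; lra.
Qed.

Let sum0E (H : nat -> cfun R n) : (fun x => \sum_(i < 0) H i x) = (fun x => 0 * H 0%N x).
Proof. by apply/funext => x; rewrite big_ord0 mul0r. Qed.

Let sumSE (N : nat) (H : nat -> cfun R n) :
  (fun x => \sum_(i < N.+1) H i x) = (fun x => \sum_(i < N) H i x + H N x).
Proof. by apply/funext => x; rewrite big_ord_recr. Qed.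

Lemma rapid_sum (N : nat) (H : nat -> cfun R n) : (forall i, rapid (H i)) ->
  rapid (fun x => \sum_(i < N) H i x).
Proof.
move=> rH; elim: N => [|N IH] m.
  rewrite sum0E.
  exact: (wdomZ 0 (rH 0%N m)).
rewrite sumSE.
exact: wdomD (IH m) (rH N m).
Qed.

Lemma FT_sum_wdom (N : nat) (H : nat -> cfun R n) : (forall i, rapid (H i)) ->
  (forall i, wdom 1 (FT (-1) (H i))) -> wdom 1 (FT (-1) (fun x => \sum_(i < N) H i x)).
Proof.
move=> rH dH; elim: N => [|N IH].
  rewrite sum0E.
  by rewrite FTZ; [exact: wdomZ|exact: rH].
rewrite sumSE.
by rewrite FTD; [exact: wdomD IH (dH N)|exact: rapid_sum|exact: rH].
Qed.

Lemma Blk_sum (N : nat) (H : nat -> cfun R n) j : (forall i, rapid (H i)) ->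
  (forall i, wdom 1 (FT (-1) (H i))) ->
  Blk (phi j) (fun x => \sum_(i < N) H i x) = (fun x => \sum_(i < N) Blk (phi j) (H i) x).
Proof.
move=> rH dH; elim: N => [|N IH].
  rewrite sum0E.
  by rewrite (BlkZ hphi)//; apply/funext => x; rewrite big_ord0 mul0r.
rewrite sumSE.
rewrite (BlkD hphi)//; [|exact: rapid_sum|exact: FT_sum_wdom].
by apply/funext => x; rewrite IH big_ord_recr.
Qed.

Lemma localized_sum l (N : nat) (H : nat -> cfun R n) : (forall i, localized l (H i)) ->
  localized l (fun x => \sum_(i < N) H i x).
Proof.
move=> lH; elim: N => [|N IH].
  rewrite sum0E.
  exact: localizedZ.
rewrite sumSE.
exact: localizedD.
Qed.

Lemma weight_near (s : R) (l j : int) : l - 1 <= j <= l + 1 ->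
  2 `^ (- `|s|) * 2 `^ (l%:~R * s) <= 2 `^ (j%:~R * s) <= 2 `^ `|s| * 2 `^ (l%:~R * s).
Proof.
move=> /andP[h1 h2].
have P (a b : R) : 2 `^ a * 2 `^ b = 2 `^ (a + b) by rewrite powRD// pnatr_eq0 implybT.
have hd : `|(j%:~R - l%:~R) * s| <= `|s|.
  rewrite normrM ler_piMl// -intrB -intr_norm -[leRHS]/(1%:~R) ler_int; move: h1 h2; clear; lia.
move: hd; rewrite ler_norml => /andP[d1 d2].
rewrite mulrBl in d1 d2; rewrite !P; apply/andP; split; apply: ler_powR; rewrite ?ler1n//; lra.
Qed.

(** The reproducing identity and the triangle inequality. *)
Lemma wblk_lower s : exists2 kappa : R, 0 < kappa & forall l h x, localized l h ->
  kappa * 2 `^ (l%:~R * s) * normc (h x) <= \sum_(d <- [:: -1; 0; 1]) wblk s h (l + d) x.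
Proof.
have [c c0 hc] := reproducing n0 hphi.
have nc : 0 < normc c.
  by rewrite lt_neqAle normc_ge0 andbT eq_sym; apply: contra c0 => /eqP/normc_eq0 ->.
exists (2 `^ (- `|s|) * normc c); first by rewrite mulr_gt0// powR_gt0.
move=> l h x lh; rewrite (_ : _ * normc (h x) = (2 `^ (- `|s|) * 2 `^ (l%:~R * s)) * normc (c * h x)); last by rewrite normcM; ring.
rewrite -(hc l h lh x).
set w := 2 `^ _ * 2 `^ _ ; have w0 : 0 <= w by rewrite mulr_ge0 ?powR_ge0.
apply: (@le_trans _ _ (w * \sum_(d <- [:: -1; 0; 1]) normc (Blk (phi (l + d)) h x))).
  rewrite !big_cons big_nil !addr0 ler_wpM2l//.
  apply: (le_trans (le_normcD _ _)); rewrite lerD2l; exact: le_normcD.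
rewrite mulr_sumr !big_cons !big_nil.
have D d : (d == -1) || (d == 0) || (d == 1) -> w * normc (Blk (phi (l + d)) h x) <= wblk s h (l + d) x.
  move=> hd; apply: ler_wpM2r; first exact: normc_ge0.
  have /(weight_near s)/andP[] // : l - 1 <= l + d <= l + 1.
  by case/orP: hd => [/orP[]|] /eqP ->; apply/andP; split; lia.
by rewrite !lerD// D.
Qed.

End TLLregular.

(** * Sums over lacunary sequences *)

Section lacunary.
Context (R : realType).

Lemma lorentzian_le (z : R) : 0 < z -> 4 / (1 + z) ^+ 2 <= z^-1.
Proof.
move=> z0; rewrite ler_pdivrMr ?exprn_gt0 ?addr_gt0// mulrC ler_pdivlMr//.
have := sqr_ge0 (1 - z); rewrite !expr2; lra.
Qed.

(** For q >= 2 each term is at most twice the increment of y / (1 + y) from y to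
    q y, so the sum telescopes and is bounded uniformly in N. *)
Lemma telescope_lacunary (q : R) (y : nat -> R) N : 2 <= q -> 0 < y 0%N ->
  (forall i, y i.+1 = q * y i) -> \sum_(i < N) y i / (1 + y i) ^+ 2 <= 2 * (1 - (1 + y N)^-1).
Proof.
move=> q2 y0 yS.
have yp i : 0 < y i by elim: i => // i IH; rewrite yS mulr_gt0//; lra.
elim: N => [|N IH].
  by rewrite big_ord0 mulr_ge0// subr_ge0 invf_le1 ?lerDl ?addr_gt0// ltW.
rewrite big_ord_recr/= (le_trans (lerD IH (lexx _)))// yS.
have a0 : 0 < 1 + y N by rewrite addr_gt0.
have b0 : 0 < 1 + q * y N by rewrite addr_gt0// mulr_gt0//; lra.
rewrite -subr_ge0 (_ : _ - _ = y N * (2 * (q - 1) * (1 + y N) - (1 + q * y N)) / ((1 + y N) ^+ 2 * (1 + q * y N))); last first.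
  by field; rewrite !gt_eqF.
apply: divr_ge0; last by rewrite mulr_ge0 ?exprn_ge0// ltW.
rewrite mulr_ge0 ?(ltW (yp N))//.
have := mulr_ge0 (_ : 0 <= q - 2) (ltW (yp N)); rewrite subr_ge0 => /(_ q2); nra.
Qed.

(** Geometric series on both sides of i.  G is the exact value of the left-hand
    side up to the initial term, which permits an induction on N. *)
Lemma offdiagonal_lacunary (q : R) (i N : nat) : 1 < q ->
  (q - 1) * \sum_(k < N | k != i :> nat) (if (k < i)%N then q ^+ k / q ^+ i else q ^+ i / q ^+ k) <= 2.
Proof.
move=> q1; have q0 : 0 < q by lra.
pose G (m : nat) : R := if (m <= i)%N then q ^+ m / q ^+ i else 2 - q * (q ^+ i / q ^+ m).
apply: (@le_trans _ _ (G N)); last first.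
  rewrite /G; case: leqP => Ni.
    rewrite ler_pdivrMr ?exprn_gt0//.
    have : q ^+ N <= q ^+ i by rewrite ler_weXn2l// ltW.
    have := exprn_gt0 i q0; lra.
  by rewrite lerBlDr lerDl mulr_ge0 ?divr_ge0 ?exprn_ge0// ltW.
rewrite big_mkcond/=.
elim: N => [|N IH]; first by rewrite big_ord0 mulr0 /G leq0n divr_ge0 ?exprn_ge0// ltW.
rewrite big_ord_recr/= mulrDr (le_trans (lerD IH (lexx _)))// /G.
have qi : q ^+ i != 0 by rewrite expf_neq0// gt_eqF.
have qN : q ^+ N != 0 by rewrite expf_neq0// gt_eqF.
have q00 : q != 0 by rewrite gt_eqF.
have [Ni|Ni|->] := ltngtP N i => /=.
- by rewrite le_eqVlt; apply/orP; left; apply/eqP; rewrite exprS; field.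
- by rewrite le_eqVlt; apply/orP; left; apply/eqP; rewrite exprS; field; rewrite q00 qN.
- by rewrite le_eqVlt; apply/orP; left; apply/eqP; rewrite exprS; field; rewrite q00 qi.
Qed.

(** Here u is the ratio of the heights of two bumps, and the left-hand side
    bounds one of them on the cube of the other.  Dropping u zeta or 1 from the
    denominator gives the two bounds. *)
Lemma tail_term (u v zeta zeta1 : R) : 0 < u -> v = u^-1 -> 0 < zeta1 -> zeta1 <= zeta ->
  u * (4 / (1 + u * zeta) ^+ 2) <= 4 * (1 + zeta1 ^- 2) * Num.min u v.
Proof.
move=> u0 -> z10 zz; have z0 : 0 < zeta by exact: lt_le_trans zz.
have uz : 0 < u * zeta by rewrite mulr_gt0.
have D0 : 0 < (1 + u * zeta) ^+ 2 by rewrite exprn_gt0// addr_gt0.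
have zi : 0 <= zeta1 ^- 2 by rewrite invr_ge0 exprn_ge0// ltW.
have b1 : u * (4 / (1 + u * zeta) ^+ 2) <= 4 * u.
  rewrite mulrCA ler_wpM2l// ler_piMr ?(ltW u0)// invf_le1//.
  by rewrite exprn_ege1// lerDl ltW.
have b2 : u * (4 / (1 + u * zeta) ^+ 2) <= 4 * (zeta1 ^- 2 * u^-1).
  apply: (@le_trans _ _ (u * (4 / (u * zeta1) ^+ 2))).
    apply: ler_wpM2l; first exact: ltW.
    apply: ler_wpM2l => //; rewrite lef_pV2 ?posrE ?exprn_gt0 ?mulr_gt0 ?addr_gt0//.
    have h : u * zeta1 <= 1 + u * zeta by rewrite (le_trans (ler_wpM2l (ltW u0) zz))// lerDr.
    have h0 : 0 <= u * zeta1 by rewrite mulr_ge0// ltW.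
    by rewrite lerXn2r ?nnegrE// (le_trans h0).
  rewrite le_eqVlt; apply/orP; left; apply/eqP; field; rewrite !gt_eqF//.
rewrite minEle; case: ifP => _.
  by rewrite (le_trans b1)// mulrDr mulr1 mulrDl lerDl !mulr_ge0// ltW.
have ui : 0 <= u^-1 by rewrite invr_ge0 ltW.
by rewrite (le_trans b2)// mulrA mulrDr mulr1 mulrDl lerDr mulr_ge0.
Qed.

Lemma normc_sum_lower (N : nat) (F : nat -> R[i]) (i : nat) : (i < N)%N ->
  normc (F i) - \sum_(k < N | k != i :> nat) normc (F k) <= normc (\sum_(k < N) F k).
Proof.
move=> iN; rewrite [in leRHS](bigD1 (Ordinal iN))//= lerBlDr.
have le_sum (P : pred 'I_N) : normc (\sum_(k < N | P k) F k) <= \sum_(k < N | P k) normc (F k).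
  elim/big_ind2: _ => //; first by rewrite normc0.
  by move=> a b c d h1 h2; rewrite (le_trans (le_normcD _ _))// lerD.
rewrite -[F i in leLHS](addrK (\sum_(k < N | k != Ordinal iN) F k)).
rewrite (le_trans (le_normcD _ _))// normcN lerD2l; exact: le_sum.
Qed.

End lacunary.

(** * Pointwise decay in terms of the critical power *)

Section decay.
Context (R : realType) (n : nat).
Implicit Types (x : 'rV[R]_n).
Hypothesis n0 : (0 < n)%N.

Lemma norm_attained x : exists i, `|x 0 i| = `|x|.
Proof.
apply: contrapT => H; have hi i : `|x 0 i| < `|x|.
  rewrite lt_neqAle; apply/andP; split; first by apply/eqP => h; apply: H; exists i.
  exact: ((rV_norm_leP x (normr_ge0 x)).1 (lexx _) i).
have x0 : 0 < `|x| by exact: le_lt_trans (normr_ge0 _) (hi (Ordinal n0)).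
by have := (rV_norm_ltP x x0).2 hi; rewrite ltxx.
Qed.

Lemma wt_norm x : wt x <= (1 + `|x| ^+ 2)^-1.
Proof.
have [i hi] := norm_attained x; rewrite /wt (bigD1 i)//= -hi real_normK ?num_real//.
rewrite ler_piMr ?(ltW (wt1_gt0 _))//.
by apply: prodr_ile1 => j; rewrite wt1_le1 (ltW (wt1_gt0 _)).
Qed.

(** Since a <= n, the weight to the power n decays at least as fast as |x|^(-2a).
    The form 1 / (1 + |x|^a)^2 is the one whose dilates sum by telescoping. *)
Lemma wt_powR x (a : R) : 0 <= a -> a <= n%:R -> wt x ^+ n <= 4 / (1 + `|x| `^ a) ^+ 2.
Proof.
move=> a0 an; set t := `|x|; set z := t `^ a.
have t0 : 0 <= t := normr_ge0 x.
have z0 : 0 <= z := powR_ge0 _ _.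
have z1 : 0 < (1 + z) ^+ 2 by rewrite exprn_gt0// ltr_wpDr.
rewrite ler_pdivlMr//; have [t1|/ltW t1] := leP t 1.
  have : z <= 1.
    have <- : 1 `^ a = 1 :> R by rewrite powR1.
    by apply: ge0_ler_powR => //; rewrite nnegrE.
  have w1 : wt x ^+ n <= 1 by rewrite exprn_ile1// ?wt_ge0// wt_le1.
  move=> zz; apply: (@le_trans _ _ (1 * (1 + z) ^+ 2)); first by rewrite ler_wpM2r// ltW.
  by rewrite mul1r (_ : 4 = 2 ^+ 2); [rewrite lerXn2r ?nnegrE//; lra|rewrite expr2; lra].
have tn : z <= t ^+ n by rewrite -powR_mulrn// ler_powR.
have tn1 : 1 <= t ^+ n by rewrite exprn_ege1.
have t00 : 0 < t by rewrite (lt_le_trans ltr01).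
have t2 : 0 < t ^+ 2 by rewrite exprn_gt0.
have wn : wt x ^+ n <= ((t ^+ 2)^-1) ^+ n.
  rewrite lerXn2r ?nnegrE ?wt_ge0 ?invr_ge0 ?sqr_ge0//.
  by apply: (le_trans (wt_norm x)); rewrite lef_pV2 ?posrE ?lerDr// addr_gt0.
have tp : 0 < t ^+ n by rewrite (lt_le_trans ltr01).
rewrite (le_trans (ler_wpM2r (ltW z1) wn))// exprVn -exprM mulnC exprM mulrC ler_pdivrMr ?exprn_gt0//.
rewrite (_ : 4 = 2 ^+ 2); last by rewrite expr2; lra.
by rewrite -exprMn lerXn2r ?nnegrE ?addr_ge0 ?mulr_ge0// ?(ltW tp)//; lra.
Qed.

Lemma wt_powRN x (a : R) : 0 <= a -> a <= n%:R -> x != 0 -> wt x ^+ n <= `|x| `^ (- a).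
Proof.
move=> a0 an x0; rewrite powRN (le_trans (wt_powR x a0 an))// lorentzian_le//.
by rewrite powR_gt0// normr_gt0.
Qed.

(** The profile does not vanish at the origin, by positivity of gam.  The cube is
    placed next to the origin instead of around it, so that narrower
    dilates of the profile are small on it. *)
Lemma profile_big (gam : cfun R n) : Cc_infty gam ->
  (forall x, exists2 r : R, 0 <= r & gam x = r%:C%C) -> 0 < complex.Re (gam 0) ->
  exists (y0 : 'rV[R]_n) (r eta rho : R), [/\ 0 < r, 0 < eta, 0 < rho &
    forall y, cube y0 r y -> eta <= normc (profile gam y) /\ rho <= `|y|].
Proof.
move=> cgam gpos g0.
have g1 : 0 < normc (profile gam 0).
  have wg : wdom 1 gam := cc_rapid cgam 1%N.
  have [ig _] := wdom_cinteg wg.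
  apply: lt_le_trans (normc_Re _); apply: lt_le_trans (ler_norm _).
  have -> : profile gam 0 = cintegral gam.
    rewrite /profile /FT; congr cintegral; apply/funext => x.
    have -> : dot x 0 = 0 by rewrite /dot big1// => i _; rewrite mxE mulr0.
    by rewrite !mulr0 cis0 mul1r.
  rewrite /cintegral /=; apply: (@rint_gt0 _ _ (ReF gam) 0) => //.
  - by case: wg => -[].
  - by move=> x; rewrite /ReF; have [r r0 ->] := gpos x.
pose eta := normc (profile gam 0) / 2.
have eta0 : 0 < eta by rewrite divr_gt0.
have cp : continuous (fun x => normc (profile gam x)).
  by apply: ccont_normc; have [] := profile_rapid cgam 1%N.
have : \forall x \near (0 : 'rV[R]_n), eta < normc (profile gam x).
  have /cvgr_gt h : normc (profile gam x) @[x --> (0 : 'rV[R]_n)] --> normc (profile gam 0) by exact: cp.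
  by apply: h; rewrite /eta ltr_pdivrMr// ltr_pMr// ltr1n.
move=> /nbhs_ballP[r' r'0 hr']; rewrite /= in r'0.
pose y0 : 'rV[R]_n := const_mx (r' / 2).
have y0n : `|y0| <= r' / 2.
  by apply/rV_norm_leP => [|i]; rewrite ?mxE ?ger0_norm// divr_ge0// ltW.
have y0n' : r' / 2 <= `|y0|.
  have := (rV_norm_leP y0 (normr_ge0 y0)).1 (lexx _) (Ordinal n0).
  by rewrite mxE ger0_norm// divr_ge0// ltW.
exists y0, (r' / 4), eta, (r' / 4); split; rewrite ?divr_gt0// => y; rewrite /cube /mkset => hy.
split.
  apply/ltW/(hr' y); rewrite -ball_normE /ball_ /mkset sub0r normrN.
  rewrite -[y](subrK y0) (le_lt_trans (ler_normD _ _))//; lra.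
have := ler_normB y0 (y0 - y); rewrite opprB addrC subrK.
have := ler_normD (y0 - y) y; rewrite subrK distrC; lra.
Qed.
End decay.

(** * Superpositions of localized functions *)

Section superposition.
Context (R : realType) (n : nat).
#[local] Opaque smooth.
Variables (phi : int -> cfun R n).
Hypothesis n0 : (0 < n)%N.
Hypothesis hphi : dyadic_partition phi.
Implicit Types (h : cfun R n) (x : 'rV[R]_n).

Lemma wblkZ s (z : R) h j x : 0 <= z -> rapid h -> wdom 1 (FT (-1) h) ->
  wblk phi s (fun y => z%:C%C * h y) j x = z * wblk phi s h j x.
Proof.
move=> z0 rh dh; rewrite /wblk (BlkZ hphi)// normcM normc_real ger0_norm//; ring.
Qed.

Lemma wblk_sum_le s (N : nat) (H : nat -> cfun R n) j x : (forall i, rapid (H i)) ->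
  (forall i, wdom 1 (FT (-1) (H i))) ->
  wblk phi s (fun y => \sum_(i < N) H i y) j x <= \sum_(i < N) wblk phi s (H i) j x.
Proof.
move=> rH dH; rewrite /wblk (Blk_sum hphi)// -mulr_sumr ler_wpM2l ?powR_ge0//.
elim: N => [|N IH]; first by rewrite !big_ord0 normc0.
by rewrite !big_ord_recr/= (le_trans (le_normcD _ _))// lerD.
Qed.

Lemma wblk_far s l h j x : localized l h -> ~~ (l - 1 <= j <= l + 1)%R -> wblk phi s h j x = 0.
Proof. by move=> lh jl; rewrite /wblk (Blk_far n0 hphi lh jl) normc0 mulr0. Qed.

Variables (N : nat) (H : nat -> cfun R n) (l : nat -> int).
Hypothesis lH : forall i, localized (l i) (H i).
Hypothesis lsep : forall i k (j : int), l i - 1 <= j <= l i + 1 -> l k - 1 <= j <= l k + 1 -> k = i.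
Let rH i : rapid (H i). Proof. by have [] := lH i. Qed.
Let dH i : wdom 1 (FT (-1) (H i)). Proof. by have [] := lH i. Qed.

Lemma wblk_sep s i j x : (i < N)%N -> l i - 1 <= j <= l i + 1 ->
  wblk phi s (fun y => \sum_(k < N) H k y) j x = wblk phi s (H i) j x.
Proof.
move=> iN hj; rewrite /wblk (Blk_sum hphi)// (bigD1 (Ordinal iN))//= big1 ?addr0// => k ki.
rewrite (Blk_far n0 hphi (lH k))//; apply: contra ki => hk; apply/eqP/val_inj; exact: lsep hj hk.
Qed.

Lemma wblk_sep_le s j x M : 0 <= M -> (forall i, wblk phi s (H i) j x <= M) ->
  wblk phi s (fun y => \sum_(k < N) H k y) j x <= M.
Proof.
move=> M0 hM; have [[i [iN ij]]|no] := pselect (exists i, (i < N)%N /\ (l i - 1 <= j <= l i + 1)).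
  by rewrite (wblk_sep _ _ iN ij).
rewrite /wblk (Blk_sum hphi)// big1 ?normc0 ?mulr0// => k _.
rewrite (Blk_far n0 hphi (lH k))//; apply/negP => hk; apply: no; by exists k.
Qed.
End superposition.

(** * Growth of powers *)

Section powers.
Context (R : realType).

Lemma pow2D (a b : R) : 2 `^ (a + b) = 2 `^ a * 2 `^ b :> R.
Proof. by rewrite powRD// pnatr_eq0 implybT. Qed.

Lemma pow2_gt0 (a : R) : 0 < 2 `^ a :> R. Proof. by rewrite powR_gt0. Qed.

Lemma pow2_int (l : int) : (2 : R) ^ l = 2 `^ (l%:~R).
Proof. by rewrite powR_intmul. Qed.

Lemma pow_ratio (b a : R) (i N : nat) : 0 < b ->
  (b ^+ i / b ^+ N) `^ a = (b `^ a) ^+ i / (b `^ a) ^+ N.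
Proof.
move=> b0; have bn m : 0 <= b ^+ m by rewrite exprn_ge0// ltW.
have X m : (b ^+ m) `^ a = (b `^ a) ^+ m.
  by rewrite -(powR_mulrn m (ltW b0)) -(powR_mulrn m (powR_ge0 b a)) -!powRrM mulrC.
rewrite powRM ?invr_ge0// -[(b ^+ N)^-1]powR_inv1// -[_ `^ a in X in _ * X]powRrM mulN1r powRN.
by rewrite !X.
Qed.

Lemma pow2_bounded (e K : R) : (forall m : nat, 2 `^ (m%:R * e) <= K) -> e <= 0.
Proof.
move=> hK; rewrite leNgt; apply/negP => e0.
have q1 : 1 < 2 `^ e :> R by have := @gt0_ltr_powR R e e0 1 2; rewrite !nnegrE powR1; apply => //; rewrite ltr1n.
pose d := 2 `^ e - 1 : R; have d0 : 0 < d by rewrite subr_gt0.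
have hm (m : nat) : 1 + m%:R * d <= K.
  apply: le_trans (hK m); rewrite [_ * e]mulrC powRrM powR_mulrn ?powR_ge0//.
  elim: m => [|m IH]; first by rewrite mul0r addr0 expr0.
  rewrite exprS; have := ler_wpM2l (ltW (pow2_gt0 e)) IH => /(le_trans _); apply.
  have -> : 2 `^ e = 1 + d by rewrite /d; ring.
  have := mulr_ge0 (ler0n R m) (sqr_ge0 d); rewrite -natr1 expr2; nra.
have K1 : 0 <= K / d by rewrite divr_ge0 ?(ltW d0)// (le_trans _ (hm 0%N))// mul0r addr0.
have := archi_boundP K1; set m := Num.Def.archi_bound _; rewrite ltr_pdivrMr//.
have := hm m; lra.
Qed.

Lemma nat_bounded (K e : R) : (forall N : nat, N%:R * e <= K) -> e <= 0.
Proof.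
move=> hK; rewrite leNgt; apply/negP => e0.
have K1 : 0 <= K / e by rewrite divr_ge0 ?(ltW e0)// (le_trans _ (hK 0%N))// mul0r.
have := archi_boundP K1; set m := Num.Def.archi_bound _; rewrite ltr_pdivrMr//.
have := hK m; lra.
Qed.
End powers.

(** * The inequality on test functions *)

Section testing.
Context (R : realType) (n : nat).
#[local] Opaque smooth.
Implicit Types (h : cfun R n) (x : 'rV[R]_n).
Variables (phi : int -> cfun R n).
Hypothesis n0 : (0 < n)%N.
Hypothesis hphi : dyadic_partition phi.
Variables (gam : cfun R n).
Hypothesis cgam : Cc_infty gam.
Hypothesis gam_small : forall x, (4 * n%:R)^-1 <= `|x| -> gam x = 0.
Hypothesis gam_ge0 : forall x, exists2 r : R, 0 <= r & gam x = r%:C%C.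
Hypothesis gam0 : 0 < complex.Re (gam 0).
Variables (s s1 s2 p p1 p2 theta C : R).
Hypotheses (p1lt : 1 < p) (p11 : 1 < p1) (p21 : 1 < p2).
Hypotheses (th0 : 0 < theta) (th1 : theta < 1) (C0 : 0 < C).
Hypothesis ineq : forall f : functional R n,
  TLL_space phi s1 +oo%E p1 +oo%E f -> TLL_space phi s2 +oo%E p2 +oo%E f ->
  (TLL_norm phi s 1%:E p 1%:E f <=
   C%:E * TLL_norm phi s1 +oo p1 +oo f `^ (1 - theta) *
   TLL_norm phi s2 +oo p2 +oo f `^ theta)%E.

Let at_ (A : R) (l : int) := atom n0 gam A (2 ^ l).

(** This is where q > 1 matters: the exponent n / q of the weak norm stays below
    the decay of the n-th power of the weight. *)
Lemma critical_exponent (q : R) : 1 < q -> 0 < n%:R / q <= n%:R.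
Proof.
move=> q1; have q0 : 0 < q by rewrite (lt_trans ltr01).
rewrite divr_gt0 ?ltr0n//= ler_pdivrMr// ler_peMr ?ler0n//; exact: ltW.
Qed.

Lemma TLL_weak_ge0 t q f : (0 <= TLL_norm phi t +oo q +oo f)%E.
Proof.
rewrite /TLL_norm /lorentz_norm; set u := fun x => _.
apply: (@le_trans _ _ (1%:E * distr_fun u 1 `^ q^-1)%E); first by rewrite mule_ge0 ?poweR_ge0.
by apply: ereal_sup_ubound; exists 1 => //=; rewrite in_itv/= ltr01.
Qed.

(** The inequality in the form in which it is tested: pointwise bounds of the
    blocks on the right, any lower bound B on the left. *)
Lemma ineq_regular c1 c2 : 0 < c1 -> 0 < c2 -> exists2 K : R, 0 < K & forall h X1 X2 B,
  rapid h -> 0 < X1 -> 0 < X2 ->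
  (forall j x, x != 0 -> wblk phi s1 h j x <= c1 * X1 * `|x| `^ (- (n%:R / p1))) ->
  (forall j x, x != 0 -> wblk phi s2 h j x <= c2 * X2 * `|x| `^ (- (n%:R / p2))) ->
  (B%:E <= TLL_norm phi s 1%:E p 1%:E (regular h))%E ->
  B <= K * (X1 `^ (1 - theta) * X2 `^ theta).
Proof.
move=> c10 c20.
pose k1 := 2 `^ (n%:R / p1) * c1; pose k2 := 2 `^ (n%:R / p2) * c2.
have k10 : 0 < k1 by rewrite mulr_gt0// powR_gt0.
have k20 : 0 < k2 by rewrite mulr_gt0// powR_gt0.
exists (C * k1 `^ (1 - theta) * k2 `^ theta).
  by apply: mulr_gt0; [apply: mulr_gt0 => //|]; exact: powR_gt0.
move=> h X1 X2 B rh X10 X20 h1 h2 hB.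
have t1 : (TLL_norm phi s1 +oo p1 +oo (regular h) <= (k1 * X1)%:E)%E.
  by rewrite -mulrA; apply: TLL_upper => //; [exact: lt_trans p11|exact: mulr_gt0].
have t2 : (TLL_norm phi s2 +oo p2 +oo (regular h) <= (k2 * X2)%:E)%E.
  by rewrite -mulrA; apply: TLL_upper => //; [exact: lt_trans p21|exact: mulr_gt0].
have tmp := regular_tempered0 (rh 1%N).
have m1 : TLL_space phi s1 +oo%E p1 +oo%E (regular h).
  by split => //; exact: le_lt_trans t1 (ltry _).
have m2 : TLL_space phi s2 +oo%E p2 +oo%E (regular h).
  by split => //; exact: le_lt_trans t2 (ltry _).
have pw (t q e M : R) : 0 <= e -> (TLL_norm phi t +oo q +oo (regular h) <= M%:E)%E ->
    (TLL_norm phi t +oo q +oo (regular h) `^ e <= (M `^ e)%:E)%E.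
  move=> e0 hM; rewrite -poweR_EFin; apply: gt0_ler_poweR => //.
    by rewrite in_itv/= leey andbT TLL_weak_ge0.
  by rewrite in_itv/= leey andbT (le_trans _ hM)// TLL_weak_ge0.
have := le_trans hB (ineq m1 m2) => /le_trans hh.
have : (B%:E <= C%:E * ((k1 * X1) `^ (1 - theta))%:E * ((k2 * X2) `^ theta)%:E)%E.
  apply: hh; apply: lee_pmul; rewrite ?poweR_ge0//.
  - by rewrite mule_ge0 ?poweR_ge0// lee_fin ltW.
  - apply: lee_wpmul2l; first by rewrite lee_fin ltW.
    by apply: pw => //; rewrite subr_ge0 ltW.
  - by apply: pw => //; rewrite ltW.
have E (a b c d e : R) : a * (b * c) * (d * e) = a * b * d * (c * e) by ring.
rewrite -!EFinM lee_fin (powRM _ (ltW k10) (ltW X10)) (powRM _ (ltW k20) (ltW X20)).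
by rewrite E.
Qed.

Lemma atom_wblk : exists2 Ca : R, 0 < Ca & forall t A l j x, 0 < A -> A <= (2 : R) ^ l ->
  wblk phi t (at_ A l) j x <= Ca * 2 `^ `|t| * (2 `^ (l%:~R * t) * wt (A *: x) ^+ n).
Proof.
have [Ca Ca0 hCa] := atom_Blk_bound n0 hphi cgam n.
exists (Ca + 1); first by rewrite ltr_wpDl.
move=> t A l j x A0 Al.
have loc := atom_localized n0 hphi cgam gam_small A0 Al.
have w0 : 0 <= wt (A *: x) ^+ n by exact: wtX_ge0.
have [jl|jl] := boolP (l - 1 <= j <= l + 1); last first.
  by rewrite (wblk_far n0 hphi _ _ loc jl) !mulr_ge0 ?powR_ge0// ltW// ltr_wpDl.
have /andP[_ hw] := weight_near t jl.
apply: (@le_trans _ _ ((2 `^ `|t| * 2 `^ (l%:~R * t)) * ((Ca + 1) * wt (A *: x) ^+ n))).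
  rewrite /wblk; apply: ler_pM; [by rewrite powR_ge0|exact: normc_ge0|exact: hw|].
  apply: (le_trans (hCa A l j x A0 Al jl)); rewrite ler_wpM2r// lerDl; exact: ler01.
by rewrite le_eqVlt; apply/orP; left; apply/eqP; ring.
Qed.

Lemma wt_dilate_powRN A x (a : R) : 0 < A -> 0 <= a -> a <= n%:R -> x != 0 ->
  wt (A *: x) ^+ n <= A `^ (- a) * `|x| `^ (- a).
Proof.
move=> A0 a0 an x0; rewrite -powRM ?normr_ge0 ?(ltW A0)//.
rewrite -[X in X * `|x|](gtr0_norm A0) -normrZ; apply: wt_powRN => //.
by rewrite scaler_eq0 negb_or x0 gt_eqF.
Qed.

Lemma cube_dilate A (y0 : 'rV[R]_n) r x : 0 < A -> cube (A^-1 *: y0) (r / A) x -> cube y0 r (A *: x).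
Proof.
rewrite /cube /mkset => A0; rewrite ltr_pdivlMr// mulrC => /le_lt_trans; apply.
rewrite -[X in X * _](gtr0_norm A0) -normrZ scalerBr scalerA divff ?scale1r// gt_eqF//.
Qed.

Lemma volume_power (r A q : R) : 0 < r -> 0 < A ->
  ((2 * (r / A)) ^+ n) `^ q^-1 = (2 * r) `^ (n%:R / q) * A `^ (- (n%:R / q)).
Proof.
move=> r0 A0; have r2 : 0 <= 2 * r by rewrite mulr_ge0// ltW.
rewrite -powR_mulrn ?mulr_ge0 ?invr_ge0 ?(ltW A0) ?(ltW r0)// -powRrM mulrA powRM ?invr_ge0 ?(ltW A0)//.
by rewrite -[A^-1]powR_inv1 ?(ltW A0)// -powRrM mulN1r.
Qed.

(** The cube of profile_big, dilated along with the atom. *)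
Lemma atom_wblk_lower : exists kap (y0 : 'rV[R]_n) (r rho : R),
  [/\ 0 < kap, 0 < r, 0 < rho & (forall y, cube y0 r y -> rho <= `|y|) /\
   forall (A : R) (l : int) x, 0 < A -> A <= (2 : R) ^ l -> cube (A^-1 *: y0) (r / A) x ->
   kap * 2 `^ (l%:~R * s) <= \sum_(d <- [:: -1; 0; 1]) wblk phi s (at_ A l) (l + d) x].
Proof.
have [kap kap0 hk] := wblk_lower n0 hphi s.
have [y0 [r [eta [rho [r0 eta0 rho0 hy]]]]] := profile_big n0 cgam gam_ge0 gam0.
exists (kap * eta), y0, r, rho; split; rewrite ?mulr_gt0//; split; first by move=> y /hy[].
move=> A l x A0 Al /(cube_dilate A0)/hy[h1 _].
have loc := atom_localized n0 hphi cgam gam_small A0 Al.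
apply: le_trans (hk _ _ x loc); rewrite mulrAC ler_wpM2l ?mulr_ge0 ?powR_ge0 ?(ltW kap0)//.
by rewrite atom_normc.
Qed.

(** An atom is a bump of height one on a cube of side comparable to 1 / A, so that all
    three norms are known up to constants. *)
Lemma single_atom_test : exists2 K : R, 0 < K & forall (A : R) (l : int), 0 < A -> A <= (2 : R) ^ l ->
  2 `^ (l%:~R * s) * A `^ (- (n%:R / p)) <=
  K * ((2 `^ (l%:~R * s1) * A `^ (- (n%:R / p1))) `^ (1 - theta) *
       (2 `^ (l%:~R * s2) * A `^ (- (n%:R / p2))) `^ theta).
Proof.
have [Ca Ca0 hCa] := atom_wblk.
have [kap [y0 [r [rho [kap0 r0 rho0 [_ hl]]]]]] := atom_wblk_lower.
have p0 : 0 < p := lt_trans ltr01 p1lt.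
have c0 (t : R) : 0 < Ca * 2 `^ `|t| by rewrite mulr_gt0// pow2_gt0.
have [K K0 hK] := ineq_regular (c0 s1) (c0 s2).
pose D := p * (kap * (2 * r) `^ (n%:R / p) / 2).
have D0 : 0 < D by rewrite !mulr_gt0// powR_gt0// mulr_gt0.
exists (K / D); first by rewrite divr_gt0.
move=> A l A0 Al.
have X0 (t q : R) : 0 < 2 `^ (l%:~R * t) * A `^ (- (n%:R / q)) by rewrite mulr_gt0// powR_gt0.
have up t q : 1 < q -> forall j x, x != 0 -> wblk phi t (at_ A l) j x <=
    (Ca * 2 `^ `|t|) * (2 `^ (l%:~R * t) * A `^ (- (n%:R / q))) * `|x| `^ (- (n%:R / q)).
  move=> q1 j x x0; have /andP[a0 an] := critical_exponent q1.
  apply: (le_trans (hCa t A l j x A0 Al)); rewrite -!mulrA.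
  do 3 (apply: ler_wpM2l; first by rewrite ?powR_ge0// ltW).
  exact: wt_dilate_powRN (ltW a0) an x0.
have rh : rapid (at_ A l) by apply: atom_rapid.
rewrite mulrAC ler_pdivlMr//.
apply: (hK _ _ _ _ rh (X0 _ _) (X0 _ _) (up s1 p1 p11) (up s2 p2 p21)).
have E (a b c d e : R) : a * b * (e * (c * d / 2)) = e * (1%:R * (c * a * (d * b) / 2)) by ring.
rewrite E.
apply: (@TLL_lower _ _ _ n0 hphi s p _ 1%N (fun i => 2 ^+ i) (fun=> r / A) (fun=> A^-1 *: y0)) => //.
- by rewrite mulr_ge0 ?powR_ge0// ltW.
- by rewrite mulr_ge0 ?powR_ge0.
- by move=> i; rewrite exprS.
- by move=> i; rewrite divr_gt0.
- move=> i; rewrite volume_power// ler_peMl ?mulr_ge0 ?powR_ge0//.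
  by rewrite exprn_ege1// ler1n.
- case=> // x _ hx; exists [seq l + d | d <- [:: -1; 0; 1]].
    by rewrite map_inj_uniq//; exact: addrI.
  by rewrite expr0 mulr1 big_map; exact: hl.
Qed.

Let piece (c A : R) (l : int) : cfun R n := fun x => c%:C%C * at_ A l x.

Let piece_localized c A l : 0 < A -> A <= (2 : R) ^ l -> localized l (piece c A l).
Proof. by move=> A0 Al; apply: localizedZ; exact: (atom_localized n0 hphi cgam gam_small A0 Al). Qed.

Let wblk_piece t c A l j x : 0 <= c -> 0 < A -> A <= (2 : R) ^ l ->
  wblk phi t (piece c A l) j x = c * wblk phi t (at_ A l) j x.
Proof.
by move=> c0 A0 Al; have [r d _] := atom_localized n0 hphi cgam gam_small A0 Al; exact: wblkZ.
Qed.

Let near_shift (a d : int) : d \in [:: -1; 0; 1] -> a - 1 <= a + d <= a + 1.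
Proof. by rewrite !inE => /or3P[] /eqP ->; lia. Qed.

Let separated (m : nat) : (3 <= m)%N -> forall (i k : nat) (j : int),
  (m * i)%:Z - 1 <= j <= (m * i)%:Z + 1 -> (m * k)%:Z - 1 <= j <= (m * k)%:Z + 1 -> k = i.
Proof.
move=> m3 i k j h1 h2; have [ik|ik|//] := ltngtP k i.
  have : (m * k.+1 <= m * i)%N by rewrite leq_mul2l ik orbT.
  rewrite mulnS; lia.
have : (m * i.+1 <= m * k)%N by rewrite leq_mul2l ik orbT.
rewrite mulnS; lia.
Qed.

(** Atoms of width one at N separated frequencies, normalised in the smoothness
    s: every block is bounded by a single atom, while the sum of all blocks is
    of size N on a fixed cube. *)
Lemma not_same_smoothness : s1 = s -> s2 = s -> False.
Proof.
move=> e1 e2; have [Ca Ca0 hCa] := atom_wblk.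
have [kap [y0 [r [rho [kap0 r0 rho0 [_ hl]]]]]] := atom_wblk_lower.
have p0 : 0 < p := lt_trans ltr01 p1lt.
have c0 : 0 < Ca * 2 `^ `|s| by rewrite mulr_gt0// pow2_gt0.
have [K K0] := ineq_regular c0 c0; rewrite e1 e2 => hK.
pose V := (2 * r) `^ (n%:R / p).
have V0 : 0 < V by rewrite powR_gt0// mulr_gt0.
pose l (i : nat) : int := (4 * i)%:Z.
have l1 i : 1 <= (2 : R) ^ l i by rewrite -exprnP exprn_ege1// ler1n.
pose c (i : nat) : R := 2 `^ (- ((l i)%:~R * s)).
have cw i : c i * 2 `^ ((l i)%:~R * s) = 1 by rewrite -pow2D addNr powRr0.
pose H (i : nat) := piece (c i) 1 (l i).
have lH i : localized (l i) (H i) by apply: piece_localized.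
have rH i : rapid (H i) by have [] := lH i.
have lsep : forall i k (j : int), l i - 1 <= j <= l i + 1 -> l k - 1 <= j <= l k + 1 -> k = i.
  exact: separated.
suff : p * (kap * V / 2) <= 0.
  by rewrite leNgt !mulr_gt0.
apply: (@nat_bounded _ K) => N.
pose h : cfun R n := fun x => \sum_(i < N) H i x.
have rh : rapid h by apply: rapid_sum.
have up q : 1 < q -> forall j x, x != 0 -> wblk phi s h j x <= Ca * 2 `^ `|s| * 1 * `|x| `^ (- (n%:R / q)).
  move=> q1 j x x0; have /andP[a0 an] := critical_exponent q1.
  rewrite mulr1; apply: (wblk_sep_le n0 hphi _ lH lsep); first by rewrite mulr_ge0 ?powR_ge0// ltW.
  move=> i; rewrite /H wblk_piece ?powR_ge0//.
  apply: (le_trans (ler_wpM2l (powR_ge0 _ _) (hCa s 1 (l i) j x ltr01 (l1 i)))).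
  rewrite mulrCA ler_wpM2l ?(ltW c0)// mulrA cw mul1r scale1r.
  exact: wt_powRN (ltW a0) an x0.
have := hK h 1 1 (p * (1%:R * ((N%:R * kap) * V / 2))) rh ltr01 ltr01 (up _ p11) (up _ p21).
rewrite !powR1 !mulr1 => hh.
have E (a b d e : R) : a * (b * (d * e / 2)) = b * (1%:R * (a * d * e / 2)) by ring.
rewrite E; apply: hh.
apply: (@TLL_lower _ _ _ n0 hphi s p _ 1%N (fun i => 2 ^+ i) (fun=> r) (fun=> y0)) => //.
- by rewrite mulr_ge0 ?(ltW kap0).
- exact: ltW.
- by move=> i; rewrite exprS.
- move=> i; have := volume_power p r0 ltr01; rewrite divr1 powR1 mulr1 => ->.
  by rewrite ler_peMl ?(ltW V0)// exprn_ege1// ler1n.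
- case=> // x _ hx; exists [seq l i + d | i <- index_iota 0 N, d <- [:: -1; 0; 1]].
    apply: allpairs_uniq; rewrite /index_iota ?iota_uniq// => -[i d] [k e] /allpairsP[[i' d'] [_ hd [-> ->]]].
    move=> /allpairsP[[k' e'] [_ he [-> ->]]]; rewrite /uncurry /= in hd he * => hE.
    have ik : k' = i'.
      by apply: (lsep i' k' (l i' + d')); [|rewrite hE]; exact: near_shift.
    by move: hE; rewrite ik => /addrI ->.
  rewrite big_allpairs_dep big_mkord expr0 mulr1.
  rewrite mulr_natl -[N in X in X <= _]card_ord -sumr_const; apply: ler_sum => i _.
  apply: (@le_trans _ _ (\sum_(d <- [:: -1; 0; 1]) c i * wblk phi s (at_ 1 (l i)) (l i + d) x)).
    have hx1 : cube (1^-1 *: y0) (r / 1) x by rewrite invr1 scale1r mulr1.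
    rewrite -mulr_sumr; apply: le_trans (ler_wpM2l (powR_ge0 _ _) (hl 1 (l i) x ltr01 (l1 i) hx1)).
    by rewrite mulrCA cw mulr1.
  rewrite le_eqVlt; apply/orP; left; apply/eqP; rewrite !big_seq; apply: eq_bigr => d hd.
  rewrite (wblk_sep n0 hphi lH lsep _ _ (ltn_ord i)); last exact: near_shift.
  by rewrite /H wblk_piece// powR_ge0.
Qed.

(** Atoms with width equal to the inverse frequency, normalised in the common
    scaling s - n/p: every block is O(|x|^(-n/p1)) or O(|x|^(-n/p2)), while the N atoms live at
    N different heights, each of which contributes to the L^(p,1) norm. *)
Lemma not_same_scaling : s1 - n%:R / p1 = s - n%:R / p -> s2 - n%:R / p2 = s - n%:R / p -> False.
Proof.
move=> e1 e2; have [Ca Ca0 hCa] := atom_wblk.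
have [kap [y0 [r [rho [kap0 r0 rho0 [_ hl]]]]]] := atom_wblk_lower.
have p0 : 0 < p := lt_trans ltr01 p1lt.
have c0 (t : R) : 0 < Ca * 2 `^ `|t| by rewrite mulr_gt0// pow2_gt0.
have [K K0 hK] := ineq_regular (c0 s1) (c0 s2).
have /andP[a0 _] := critical_exponent p1lt.
pose V := (2 * r) `^ (n%:R / p).
have V0 : 0 < V by rewrite powR_gt0// mulr_gt0.
(* the spacing m separates the blocks and makes the levels at least double *)
have ai0 : 0 <= (n%:R / p)^-1 by rewrite invr_ge0 ltW.
pose m := (3 + Num.Def.archi_bound (n%:R / p)^-1)%N.
have m3 : (3 <= m)%N by rewrite leq_addr.
have ma : 1 <= m%:R * (n%:R / p).
  by rewrite -ler_pdivrMr// div1r (le_trans (ltW (archi_boundP ai0)))// ler_nat leq_addl.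
pose l (i : nat) : int := (m * i)%:Z.
pose A (i : nat) : R := 2 ^ l i.
have AE i : A i = 2 `^ ((l i)%:~R) by exact: pow2_int.
have A0 i : 0 < A i by rewrite exprz_gt0.
pose c (i : nat) : R := 2 `^ (- ((l i)%:~R * (s - n%:R / p))).
have cw t q i : t - n%:R / q = s - n%:R / p -> c i * (2 `^ ((l i)%:~R * t) * A i `^ (- (n%:R / q))) = 1.
  move=> tq; rewrite AE -powRrM -!pow2D /c -tq (_ : _ + _ = 0) ?powRr0//; ring.
pose H (i : nat) := piece (c i) (A i) (l i).
have lH i : localized (l i) (H i) by apply: piece_localized.
have rH i : rapid (H i) by have [] := lH i.
have lsep : forall i k (j : int), l i - 1 <= j <= l i + 1 -> l k - 1 <= j <= l k + 1 -> k = i.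
  exact: separated m3.
suff : p * (kap * V / 2) <= 0.
  by rewrite leNgt !mulr_gt0.
apply: (@nat_bounded _ K) => N.
pose h : cfun R n := fun x => \sum_(i < N) H i x.
have rh : rapid h by apply: rapid_sum.
have up t q : 1 < q -> t - n%:R / q = s - n%:R / p -> forall j x, x != 0 ->
    wblk phi t h j x <= Ca * 2 `^ `|t| * 1 * `|x| `^ (- (n%:R / q)).
  move=> q1 tq j x x0; have /andP[b0 bn] := critical_exponent q1.
  rewrite mulr1; apply: (wblk_sep_le n0 hphi _ lH lsep); first by rewrite mulr_ge0 ?powR_ge0// ltW.
  move=> i; rewrite /H wblk_piece ?powR_ge0//.
  apply: (le_trans (ler_wpM2l (powR_ge0 _ _) (hCa t (A i) (l i) j x (A0 i) (lexx _)))).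
  rewrite mulrCA; apply: ler_wpM2l; first exact: ltW.
  apply: (@le_trans _ _ (c i * (2 `^ ((l i)%:~R * t) * (A i `^ (- (n%:R / q)) * `|x| `^ (- (n%:R / q)))))).
    do 2 (apply: ler_wpM2l; first exact: powR_ge0).
    exact: wt_dilate_powRN (ltW b0) bn x0.
  by rewrite !mulrA -[X in X * _]mulrA cw// mul1r.
have := hK h 1 1 (p * (N%:R * (kap * V / 2))) rh ltr01 ltr01 (up _ _ p11 e1) (up _ _ p21 e2).
rewrite !powR1 !mulr1 => hh; rewrite mulrCA; apply: hh.
apply: (@TLL_lower _ _ _ n0 hphi s p _ N (fun i => 2 `^ ((l i)%:~R * (n%:R / p))) (fun i => r / A i) (fun i => (A i)^-1 *: y0)) => //.
- exact: ltW.
- exact: ltW.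
- move=> i; rewrite (_ : (l i.+1)%:~R * (n%:R / p) = m%:R * (n%:R / p) + (l i)%:~R * (n%:R / p)); last first.
    by rewrite /l mulnS PoszD intrD mulrDl.
  rewrite pow2D ler_wpM2r ?powR_ge0//; apply: (@le_trans _ _ (2 `^ 1)); first by rewrite powRr1.
  by apply: ler_powR ma; exact: ler1n.
- by move=> i; rewrite divr_gt0.
- move=> i; rewrite volume_power// AE -powRrM mulrCA -pow2D mulrN subrr powRr0 mulr1//.
- move=> i x iN hx; exists [seq l i + d | d <- [:: -1; 0; 1]].
    by rewrite map_inj_uniq//; exact: addrI.
  rewrite big_map.
  apply: (@le_trans _ _ (\sum_(d <- [:: -1; 0; 1]) c i * wblk phi s (at_ (A i) (l i)) (l i + d) x)).
    rewrite -mulr_sumr; apply: le_trans (ler_wpM2l (powR_ge0 _ _) (hl _ _ _ (A0 i) (lexx _) hx)).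
    rewrite [leRHS]mulrCA ler_wpM2l ?(ltW kap0)// -pow2D ler_powR ?ler1n//.
    rewrite le_eqVlt; apply/orP; left; apply/eqP; ring.
  rewrite le_eqVlt; apply/orP; left; apply/eqP; rewrite !big_seq; apply: eq_bigr => d hd.
  rewrite (wblk_sep n0 hphi lH lsep _ _ iN); last exact: near_shift.
  by rewrite /H wblk_piece// powR_ge0.
Qed.

(** All atoms have the same frequency, widths b^(N-i) and heights b^(-(N-i)n/p):
    a smooth truncation of |x|^(-n/p), which is bounded in weak L^p uniformly
    in N but not in L^(p,1).  With a large ratio b the i-th atom dominates the
    others on its own cube. *)
Lemma not_same_integrability : p1 = p -> p2 = p -> False.
Proof.
move=> e1 e2; have [Ca Ca0 hCa] := atom_wblk.
have p0 : 0 < p := lt_trans ltr01 p1lt.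
have /andP[] := critical_exponent p1lt; set a := n%:R / p => a0 an.
have [kap kap0 hk] := wblk_lower n0 hphi s.
have [y0 [r [eta [rho [r0 eta0 rho0 hy]]]]] := profile_big n0 cgam gam_ge0 gam0.
have [_ [C1 hC1]] := profile_rapid cgam n.
have C10 : 0 <= C1 by exact: wdom_cst_ge0 hC1.
pose zeta1 := rho `^ a.
have zeta10 : 0 < zeta1 by rewrite powR_gt0.
pose M := 4 * (1 + zeta1 ^- 2).
have M0 : 0 < M by rewrite mulr_gt0// ltr_wpDr// invr_ge0 exprn_ge0// ltW.
have D0 : 0 <= 4 * (C1 * M) / eta by rewrite divr_ge0 ?(ltW eta0)// mulr_ge0// mulr_ge0// ltW.
(* C1 M bounds the influence of the other atoms, eta is the size of the i-th *)
pose q := 2 + 4 * (C1 * M) / eta.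
have q2 : 2 <= q by rewrite lerDl.
have q0 : 0 < q by lra.
have q1 : 1 < q by lra.
pose b := q `^ a^-1.
have b0 : 0 < b by rewrite powR_gt0.
have ba : b `^ a = q by rewrite -powRrM mulVf ?powRr1 ?gt_eqF// ltW.
have b1 : 1 <= b.
  have := @ler_powR R q (ltW q1) 0 a^-1; rewrite powRr0; apply; by rewrite invr_ge0 ltW.
have c0 (t : R) : 0 < Ca * 2 `^ `|t| by rewrite mulr_gt0// pow2_gt0.
have [K K0 hK] := ineq_regular (mulr_gt0 (c0 s1) (ltr0n R 8)) (mulr_gt0 (c0 s2) (ltr0n R 8)).
rewrite e1 e2 in hK.
pose V := (2 * r) `^ a.
have V0 : 0 < V by rewrite powR_gt0// mulr_gt0.
suff : p * (kap * (eta / 2) * V / 2) <= 0.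
  by rewrite leNgt !mulr_gt0// divr_gt0.
apply: (@nat_bounded _ K) => N.
pose c (i : nat) : R := q ^+ i / q ^+ N.
pose A (i : nat) : R := b ^+ i / b ^+ N.
have cp i : 0 < c i by rewrite divr_gt0 ?exprn_gt0.
have A0 i : 0 < A i by rewrite divr_gt0 ?exprn_gt0.
have Aa i : A i `^ a = c i by rewrite /A pow_ratio// ba.
have cS i : c i.+1 = q * c i by rewrite /c exprS mulrA.
(* the indices are capped at N to keep every A at most 1 *)
pose H (i : nat) := piece (c (minn i N)) (A (minn i N)) 0.
have Ale i : A (minn i N) <= (2 : R) ^ (0 : int).
  by rewrite expr0z ler_pdivrMr ?exprn_gt0// mul1r ler_weXn2l// geq_minr.
have lH i : localized 0 (H i) by apply: piece_localized.
have rH i : rapid (H i) by have [] := lH i.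
have dH i : wdom 1 (FT (-1) (H i)) by have [] := lH i.
pose h : cfun R n := fun x => \sum_(i < N) H i x.
have rh : rapid h by apply: rapid_sum.
have minE (i : 'I_N) : minn i N = i by apply/minn_idPl/ltnW.
have normA i x : `|A i *: x| `^ a = c i * `|x| `^ a.
  by rewrite normrZ gtr0_norm// powRM ?(ltW (A0 _))// Aa.
have up t : forall j x, x != 0 -> wblk phi t h j x <= Ca * 2 `^ `|t| * 8 * 1 * `|x| `^ (- a).
  move=> j x x0; apply: (le_trans (wblk_sum_le hphi _ _ _ _ rH dH)).
  set z := `|x| `^ a; have z0 : 0 < z by rewrite powR_gt0// normr_gt0.
  pose y (i : nat) := c i * z.
  have yp i : 0 < y i by rewrite mulr_gt0.
  apply: (@le_trans _ _ (\sum_(i < N) Ca * 2 `^ `|t| * (4 / z) * (y i / (1 + y i) ^+ 2))).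
    apply: ler_sum => i _; rewrite /H wblk_piece ?(ltW (cp _))//.
    apply: (le_trans (ler_wpM2l (ltW (cp _)) (hCa t _ _ j x (A0 _) (Ale i)))).
    rewrite minE mul0r powRr0 mul1r mulrCA -[leRHS]mulrA; apply: ler_wpM2l; first exact: ltW.
    apply: (le_trans (ler_wpM2l (ltW (cp i)) (wt_powR n0 (A i *: x) (ltW a0) an))).
    rewrite normA -/z -/(y i) le_eqVlt; apply/orP; left; apply/eqP.
    by rewrite {2}/y; field; rewrite !gt_eqF// addr_gt0.
  rewrite -mulr_sumr; apply: (@le_trans _ _ (Ca * 2 `^ `|t| * (4 / z) * 2)).
    apply: ler_wpM2l; first by rewrite mulr_ge0 ?divr_ge0 ?(ltW (c0 _)) ?(ltW z0).
    apply: (le_trans (telescope_lacunary N q2 (yp 0%N) _)); first by move=> i; rewrite /y cS mulrA.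
    by rewrite ger_pMr// lerBlDr lerDl invr_ge0 addr_ge0// ltW.
  rewrite powRN -/z mulr1 -!mulrA; do 2 (apply: ler_wpM2l; first by rewrite ?powR_ge0// ltW).
  rewrite le_eqVlt; apply/orP; left; apply/eqP; field; exact: lt0r_neq0.
have := hK h 1 1 (p * (N%:R * (kap * (eta / 2) * V / 2))) rh ltr01 ltr01 (up s1) (up s2).
rewrite !powR1 !mulr1 => hh; rewrite mulrCA; apply: hh.
have keta : 0 < kap * (eta / 2) by rewrite mulr_gt0// divr_gt0.
apply: (@TLL_lower _ _ _ n0 hphi s p _ N c (fun i => r / A i) (fun i => (A i)^-1 *: y0)) => //.
- exact: ltW.
- exact: ltW.
- by move=> i; rewrite cS ler_wpM2r// ltW.
- by move=> i; rewrite divr_gt0.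
- move=> i; rewrite volume_power// -/a powRN Aa mulrCA divff ?mulr1//; exact: lt0r_neq0.
- move=> i x iN hx; exists [seq 0 + d | d <- [:: -1; 0; 1]].
    by rewrite map_inj_uniq//; exact: addrI.
  rewrite big_map; have lh : localized 0 h by apply: localized_sum.
  apply: le_trans (hk 0 h x lh); rewrite mul0r powRr0 mulr1 -mulrA; apply: ler_wpM2l; first exact: ltW.
  have [h1 h2] := hy _ (cube_dilate (A0 i) hx).
  have hz : zeta1 <= c i * `|x| `^ a.
    by rewrite -normA; apply: ge0_ler_powR; rewrite ?nnegrE ?(ltW a0) ?(ltW rho0).
  have nH (k : nat) : (k <= N)%N -> normc (H k x) = c k * normc (profile gam (A k *: x)).
    move=> kN; rewrite /H /piece normcM normc_real ger0_norm ?(ltW (cp _))// (minn_idPl kN).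
    by rewrite atom_normc.
  apply: le_trans (normc_sum_lower (fun k => H k x) iN).
  pose S := \sum_(k < N | k != i :> nat) (if (k < i)%N then q ^+ k / q ^+ i else q ^+ i / q ^+ k).
  have S0 : 0 <= S by apply: sumr_ge0 => k _; case: ifP => _; rewrite divr_ge0 ?exprn_ge0// ltW.
  have hS : (q - 1) * S <= 2 := offdiagonal_lacunary i N q1.
  have hoff : \sum_(k < N | k != i :> nat) normc (H k x) <= c i * (C1 * M) * S.
    rewrite /S mulr_sumr; apply: ler_sum => k ki; rewrite nH; last exact: ltnW.
    pose u := c k / c i; have u0 : 0 < u by rewrite divr_gt0.
    have cu : c k = c i * u by rewrite /u mulrCA divff ?mulr1//; exact: lt0r_neq0.
    have uE : u = q ^+ k / q ^+ i by rewrite /u /c; field; rewrite !expf_neq0// gt_eqF.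
    have vE : q ^+ i / q ^+ k = u^-1 by rewrite uE invf_div.
    have t1 := tail_term u0 (erefl u^-1) zeta10 hz.
    have t2 : normc (profile gam (A k *: x)) <= C1 * (4 / (1 + u * (c i * `|x| `^ a)) ^+ 2).
      apply: (le_trans (hC1 _)); apply: ler_wpM2l => //.
      by apply: (le_trans (wt_powR n0 _ (ltW a0) an)); rewrite normA mulrA [u * _]mulrC -cu.
    apply: (@le_trans _ _ (c i * (u * normc (profile gam (A k *: x))))); first by rewrite mulrA -cu.
    rewrite -[leRHS]mulrA; apply: ler_wpM2l; first exact: ltW (cp i).
    rewrite -[leRHS]mulrA.
    apply: (le_trans (ler_wpM2l (ltW u0) t2)); rewrite mulrCA; apply: ler_wpM2l => //.
    apply: (le_trans t1); apply: ler_wpM2l; first exact: ltW M0.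
    by rewrite -uE vE; case: ifP => _; rewrite ge_min lexx ?orbT.
  have hoff2 : C1 * M * S <= eta / 2.
    have : 4 * (C1 * M) / eta * S <= 2.
      by apply: le_trans hS; apply: ler_wpM2r => //; rewrite /q; lra.
    rewrite mulrAC ler_pdivrMr//; set w := C1 * M * S => hw.
    have : 4 * w <= 2 * eta by rewrite /w mulrA.
    lra.
  have := ler_wpM2l (ltW (cp i)) hoff2; have := ler_wpM2l (ltW (cp i)) h1.
  rewrite (nH i (ltnW iN)); move: hoff; rewrite -(mulrA (c i)).
  move: (_ * normc _) (_ * (C1 * M * S)) (\sum_(_ < N | _) _) => u v w; lra.
Qed.
End testing.

Theorem theorem3p12 (R : realType) (n : nat) (phi : int -> cfun R n)
  (s s1 s2 p p1 p2 theta sstar pstar : R)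
  (n_gt0 : (0 < n)%N)
  (phi_dyadic : dyadic_partition phi)
  (p_gt1 : 1 < p) (p1_gt1 : 1 < p1) (p2_gt1 : 1 < p2)
  (theta_gt0 : 0 < theta) (theta_lt1 : theta < 1)
  (sstarE : sstar = (1 - theta) * s1 + theta * s2)
  (pstarE : pstar^-1 = (1 - theta) / p1 + theta / p2)
  (ineq : exists C : R, 0 < C /\
    forall f : functional R n,
      TLL_space phi s1 +oo%E p1 +oo%E f ->
      TLL_space phi s2 +oo%E p2 +oo%E f ->
      (TLL_norm phi s 1%:E p 1%:E f <=
       C%:E * TLL_norm phi s1 +oo p1 +oo f `^ (1 - theta) *
         TLL_norm phi s2 +oo p2 +oo f `^ theta)%E) :
  [/\ sstar = s, pstar = p, s1 != s2, p1 != p2 &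
      s2 - s1 != n%:R / p2 - n%:R / p1] \/
  [/\ sstar - s = n%:R / pstar - n%:R / p,
      0 < n%:R / pstar - n%:R / p &
      s2 - s1 != n%:R / p2 - n%:R / p1].
Proof.
have [C [C0 hC]] := ineq.
have nR : 0 < n%:R :> R by rewrite ltr0n.
have d0 : 0 < (4 * n%:R : R)^-1 by rewrite invr_gt0 mulr_gt0.
have [gam [cgam gsmall gge0 g0]] := bump_exists n_gt0 phi_dyadic d0.
have [K K0 hK] := single_atom_test n_gt0 phi_dyadic cgam gsmall gge0 g0 p_gt1 p1_gt1 p2_gt1
  theta_gt0 theta_lt1 C0 hC.
have exponents (m l : R) (t1 t2 q1 q2 : R) :
    (2 `^ (l * t1) * (2 `^ m) `^ (- (n%:R / q1))) `^ (1 - theta) *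
    (2 `^ (l * t2) * (2 `^ m) `^ (- (n%:R / q2))) `^ theta =
    2 `^ (l * ((1 - theta) * t1 + theta * t2) - m * (n%:R * ((1 - theta) / q1 + theta / q2))).
  by rewrite -!powRrM -!pow2D -!powRrM -pow2D; congr (2 `^ _); ring.
have test (m l : int) : (m <= l)%R ->
    2 `^ (l%:~R * s - m%:~R * (n%:R / p)) <= K * 2 `^ (l%:~R * sstar - m%:~R * (n%:R / pstar)).
  move=> ml; have := hK (2 `^ m%:~R) l (pow2_gt0 _).
  rewrite pow2_int ler_powR ?ler1n ?ler_int// => /(_ isT).
  by rewrite exponents -sstarE -pstarE -powRrM -pow2D mulrN.
have test' (m l : int) : (m <= l)%R ->
    2 `^ (l%:~R * (s - sstar) - m%:~R * (n%:R / p - n%:R / pstar)) <= K.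
  move=> ml; have := test m l ml; rewrite -ler_pdivrMr ?pow2_gt0// -powRN -pow2D.
  by congr (2 `^ _ <= K); ring.
pose e := (s - sstar) - (n%:R / p - n%:R / pstar).
have e_le0 : e <= 0.
  apply: (@pow2_bounded _ _ K) => m; have := test' m%:Z m%:Z (lexx _).
  by rewrite -mulrBr pmulrn.
have e_ge0 : 0 <= e.
  rewrite -oppr_le0; apply: (@pow2_bounded _ _ K) => m; have := test' (- m%:Z) (- m%:Z) (lexx _).
  by rewrite -mulrBr intrN -pmulrn mulNr mulrN.
have scaling : sstar - s = n%:R / pstar - n%:R / p.
  have : e = 0 by apply/eqP; rewrite eq_le e_le0.
  rewrite /e; lra.
have integ : 0 <= n%:R / pstar - n%:R / p.
  rewrite -oppr_le0 opprB; apply: (@pow2_bounded _ _ K) => m.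
  have := test' (- m%:Z) 0 _; rewrite oppr_le0 lez_nat leq0n => /(_ isT).
  by rewrite mul0r add0r intrN -pmulrn mulNr opprK.
have pstarM : n%:R / pstar = (1 - theta) * (n%:R / p1) + theta * (n%:R / p2).
  by rewrite pstarE; ring.
have diag : s2 - s1 != n%:R / p2 - n%:R / p1.
  apply/eqP => h.
  have h1 : s1 - n%:R / p1 = s - n%:R / p.
    have -> : s - n%:R / p = sstar - n%:R / pstar by lra.
    rewrite sstarE pstarM; have -> : s2 = s1 + (n%:R / p2 - n%:R / p1) by lra.
    ring.
  apply: (not_same_scaling n_gt0 phi_dyadic cgam gsmall gge0 g0 p_gt1 p1_gt1 p2_gt1
    theta_gt0 theta_lt1 C0 hC h1); lra.
have [pos|npos] := ltP 0 (n%:R / pstar - n%:R / p); [by right|left].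
have np : n%:R / pstar = n%:R / p by lra.
have ss : sstar = s by lra.
have pp : pstar = p.
  by apply: invr_inj; apply: (mulfI (lt0r_neq0 nR)).
split => //.
- apply/eqP => h; apply: (not_same_smoothness n_gt0 phi_dyadic cgam gsmall gge0 g0 p_gt1 p1_gt1 p2_gt1
    theta_gt0 theta_lt1 C0 hC); rewrite -ss sstarE -h; ring.
- apply/eqP => h.
  have pi : p^-1 = p1^-1 by rewrite -pp pstarE -h; ring.
  by apply: (not_same_integrability n_gt0 phi_dyadic cgam gsmall gge0 g0 p_gt1 p1_gt1 p2_gt1
    theta_gt0 theta_lt1 C0 hC); [|rewrite -h]; apply: invr_inj.
Qed.
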